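(* Assume that $\mathcal{H}_c(n)<\infty$ for some $n\in\mathbb{N}$. Then there exists a piecewise polynomial vector field of degree $n$ (with discontinuity line $\{x=0\}$) possessing exactly $\mathcal{H}_c(n)$ hyperbolic crossing limit cycles.
   Context: A planar piecewise polynomial vector field is $Z=(P,Q)$ with $(P,Q)=(P^+,Q^+)$ for $x>0$ and $(P,Q)=(P^-,Q^-)$ for $x<0$, where $P^\pm,Q^\pm$ are real polynomials in $(x,y)$. Trajectories follow the Filippov convention. Set $\deg P=\max\{\deg P^+,\deg P^-\}$ and similarly $\deg Q$; the degree of $Z$ is the maximum of $\deg P$ and $\deg Q$. A point $(0,y)$ is a crossing point if $P^+(0,y)P^-(0,y)>0$; there, trajectories of one side are continued by trajectories of the other side. A crossing limit cycle is a limit cycle (isolated periodic orbit) of $Z$ that intersects the discontinuity line $\{x=0\}$ and crosses it transversely, i.e. meets it only at (finitely many) crossing points. Near each point $(0,y_C)$ where a crossing limit cycle $C$ meets $\{x=0\}$ there is a well-defined analytic first return map $\pi_C$ on $\{x=0\}$ fixing $y_C$; $C$ is hyperbolic if $y_C$ is a simple zero of $y\mapsto\pi_C(y)-y$, i.e. $\pi_C'(y_C)\ne1$. Let $\pi_c(P,Q)$ be the number of crossing limit cycles of $Z$, and \[ \mathcal{H}_c(n):=\sup\{\pi_c(P,Q):\ \deg P\le n,\ \deg Q\le n\}. \] *)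

(* Defs.v *)
From HB Require Import structures.
From mathcomp Require Import all_boot all_order all_algebra.
From mathcomp Require Import all_classical all_reals all_analysis.
(* The notations of mpoly clash with those of MathComp-Analysis. *)
From mathcomp.multinomials Require Import -(notations) mpoly.

Set Implicit Arguments.
Unset Strict Implicit.
Unset Printing Implicit Defensive.

Import Order.TTheory GRing.Theory Num.Theory.
Import numFieldNormedType.Exports.

Local Open Scope classical_set_scope.
Local Open Scope ring_scope.

(* [pwP_pos], [pwQ_pos] govern x > 0 and [pwP_neg], [pwQ_neg] govern x < 0; the
   polynomial variables of index 0 and 1 are x and y. *)
Record pw_field (R : realType) := PwField {
  pwP_pos : mpoly 2 R;
  pwQ_pos : mpoly 2 R;
  pwP_neg : mpoly 2 R;
  pwQ_neg : mpoly 2 R }.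

Definition eval2 (R : realType) (p : mpoly 2 R) (z : R * R) : R :=
  meval (fun i : 'I_2 => if i == ord0 then z.1 else z.2) p.

(* As for [msize], sizes are total degrees plus one, and 0 for the zero
   polynomial. *)
Definition sizeP (R : realType) (Z : pw_field R) : nat :=
  maxn (msize (pwP_pos Z)) (msize (pwP_neg Z)).

Definition sizeQ (R : realType) (Z : pw_field R) : nat :=
  maxn (msize (pwQ_pos Z)) (msize (pwQ_neg Z)).

Definition has_degree (R : realType) (Z : pw_field R) (n : nat) : Prop :=
  maxn (sizeP Z) (sizeQ Z) = n.+1.

Definition field_pos (R : realType) (Z : pw_field R) (z : R * R) : R * R :=
  (eval2 (pwP_pos Z) z, eval2 (pwQ_pos Z) z).

Definition field_neg (R : realType) (Z : pw_field R) (z : R * R) : R * R :=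
  (eval2 (pwP_neg Z) z, eval2 (pwQ_neg Z) z).

Definition Sigma (R : realType) : set (R * R) := [set z | z.1 = 0].

(* Filippov's set-valued extension of the field: on x = 0 it is the segment
   joining the values of the two one-sided fields. *)
Definition filippov (R : realType) (Z : pw_field R) (z : R * R) : set (R * R) :=
  [set v | [\/ 0 < z.1 /\ v = field_pos Z z,
               z.1 < 0 /\ v = field_neg Z z |
               z.1 = 0 /\ exists2 l : R, 0 <= l <= 1 &
                 v = l *: field_pos Z z + (1 - l) *: field_neg Z z]].

Definition abs_continuous (R : realType) (a b : R) (f : R -> R * R) : Prop :=
  forall e : R, 0 < e -> exists2 d : R, 0 < d &
    forall (n : nat) (s t : 'I_n -> R),
      (forall i, [/\ a <= s i, s i <= t i & t i <= b]) ->
      (forall i j, i != j -> t i <= s j \/ t j <= s i) ->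
      \sum_(i < n) (t i - s i) < d ->
      \sum_(i < n) `|f (t i) - f (s i)| < e.

(* Solution on [a, b] of the differential inclusion g' \in filippov Z g; the
   values of g outside [a, b] are irrelevant. *)
Definition trajectory (R : realType) (Z : pw_field R) (a b : R)
    (g : R -> R * R) : Prop :=
  abs_continuous a b g /\
  {ae lebesgue_measure, forall t : R, a < t < b ->
     exists2 v : R * R, filippov Z (g t) v & is_derive t (1 : R) g v}.

Definition crossing_point (R : realType) (Z : pw_field R) (y : R) : Prop :=
  0 < eval2 (pwP_pos Z) (0, y) * eval2 (pwP_neg Z) (0, y).

(* Orbits are identified with their images in the plane. *)
Definition periodic_orbit (R : realType) (Z : pw_field R) (C : set (R * R)) :
    Prop :=
  exists (g : R -> R * R) (T : R),
    [/\ forall a b, trajectory Z a b g,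
        0 < T /\ (forall t, g (t + T) = g t),
        exists t, g t <> g 0 &
        C = range g].

Definition limit_cycle (R : realType) (Z : pw_field R) (C : set (R * R)) :
    Prop :=
  periodic_orbit Z C /\
  exists U : set (R * R), [/\ open U, C `<=` U &
    forall C', periodic_orbit Z C' -> C' `<=` U -> C' = C].

Definition crossing_limit_cycle (R : realType) (Z : pw_field R)
    (C : set (R * R)) : Prop :=
  [/\ limit_cycle Z C,
      C `&` Sigma (R:=R) !=set0,
      finite_set (C `&` Sigma (R:=R)) &
      forall y, C (0, y) -> crossing_point Z y].

(* The trajectory issued from (0, y) meets the section {0} x I again, for the
   first time, at (0, y'). *)
Definition first_return (R : realType) (Z : pw_field R) (I : set R)
    (y y' : R) : Prop :=
  exists (g : R -> R * R) (T : R),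
    [/\ 0 < T, trajectory Z 0 T g, g 0 = (0, y) /\ g T = (0, y'), I y' &
        forall t w : R, 0 < t < T -> I w -> g t <> (0, w)].

(* The section is a neighbourhood of yC in x = 0, not the whole line: a cycle
   meets x = 0 in several points, and its first return to the line itself is
   not its return to yC. *)
Definition return_map (R : realType) (Z : pw_field R) (yC : R) (p : R -> R) :
    Prop :=
  p yC = yC /\
  exists2 r : R, 0 < r &
    \forall y \near yC, first_return Z (ball yC r) y (p y).

Definition hyperbolic (R : realType) (Z : pw_field R) (C : set (R * R)) :
    Prop :=
  forall yC, C (0, yC) -> exists2 p : R -> R, return_map Z yC p &
    derivable p yC 1 /\ (p^`())%classic yC <> 1.

Definition num_crossing (R : realType) (Z : pw_field R) : \bar R :=
  counting [set C | crossing_limit_cycle Z C].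

Definition num_hyperbolic_crossing (R : realType) (Z : pw_field R) : \bar R :=
  counting [set C | crossing_limit_cycle Z C /\ hyperbolic Z C].

Definition Hc (R : realType) (n : nat) : \bar R :=
  ereal_sup [set num_crossing Z |
    Z in [set Z : pw_field R | (sizeP Z <= n.+1)%N /\ (sizeQ Z <= n.+1)%N]].

(* Main.v *)
(* Let Z attain H_c(n) = m. The component of Z on x > 0 is translated by mu in
   the direction of the discontinuity line, and multiplied by a power of 1 + x,
   which preserves the arcs in x > 0 and adjusts the degree to n. A crossing
   limit cycle is a closed chain of N arcs, N even, alternately in x < 0 and
   x > 0. Every half-return map F is decreasing, and the perturbation replaces
   it in x > 0 by u |-> F (u - mu) + mu. Consequently the displacement
   D (mu, u) of the return map along the chain satisfies
   D (mu', u) - D (mu, u) >= mu' - mu for mu <= mu'.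

   At mu = 0, D vanishes at the cycle y0 and, since the cycle is isolated, not
   at other points near y0. As D (mu, y0) has the sign of mu, on each side of
   y0 a zero of D (mu, .) appears for one of the two signs of mu. The m cycles
   have 2 m sides, so for one sign of mu at least m zeros appear, and they
   belong to distinct cycles of the perturbed field. By the monotonicity in mu
   and a Sard type argument, arbitrarily small mu of that sign exist for which
   all zeros of D (mu, .) near the cycles are simple, i.e. the new cycles are
   hyperbolic. They are at least m, and by definition of m at most m. *)
Require Import Defs.
From HB Require Import structures.
From mathcomp Require Import all_boot all_order all_algebra.
From mathcomp Require Import all_classical all_reals all_analysis.
From mathcomp Require Import ring lra.
From mathcomp.multinomials Require Import -(notations) mpoly.

Set Implicit Arguments.
Unset Strict Implicit.
Unset Printing Implicit Defensive.

Import Order.TTheory GRing.Theory Num.Theory.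
Import numFieldNormedType.Exports.

Local Open Scope classical_set_scope.
Local Open Scope ring_scope.

(** * Real analysis and absolutely continuous curves *)

Section RealAnalysis.
Context {R : realType}.

(** A half-return map is only known to have a first-order expansion with quadratic remainder, with
    constants uniform near the cycle, and every later step lives on that. Sard's theorem thus
    becomes a count: [D] grows in mu at rate at least 1, so if u is a critical zero for mu and u' is
    any zero for mu', then mu - mu' is O((u - u')^2). The rate 1 comes from the last arc, which lies
    in x > 0 and ends with + mu; the earlier arcs contribute with the right sign. Translating both
    half-planes would merely conjugate the field. Two points need care. A limit cycle is isolated
    among all periodic Filippov orbits, so a simple zero of [D] has to give a cycle that is isolated
    in this strong sense; trajectories are compared forward in time, where crossing points preserve
    uniqueness. And the new cycles have to be distinct: each meets the line at its own zero of [D]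
    and otherwise only near the remaining points of the old cycle from which it was born. *)

Definition cts {V : normedModType R} (f : R -> V) (t : R) := forall e : R, 0 < e ->
  exists2 d : R, 0 < d & forall s, `|s - t| < d -> `|f s - f t| < e.

Lemma ctsP {V : normedModType R} (f : R -> V) (t : R) :
  cts f t <-> {for t, continuous f}.
Proof.
split.
  move=> H; apply/cvgrPdist_lt => e e0; have [d d0 Hd] := H _ e0.
  by exists d => // s /= sd; rewrite distrC; apply: Hd; rewrite distrC.
move=> /cvgrPdist_lt H e e0; have [d /= d0 Hd] := H _ e0.
by exists d => // s sd; rewrite distrC; apply: Hd; rewrite /ball_/= distrC.
Qed.

(** Multiplied out by [|h|], the estimate includes h = 0 and frees later proofs from difference
    quotients. *)
Lemma is_deriveP {V : normedModType R} (f : R -> V) (t : R) (v : V) :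
  is_derive t 1 f v <->
  (forall e : R, 0 < e -> exists2 d : R, 0 < d &
     forall h, `|h| < d -> `|f (t + h) - f t - h *: v| <= e * `|h|).
Proof.
split=> [[dv vE] e e0|H].
  have : h^-1 *: (f (h *: 1 + t) - f t) @[h --> 0^'] --> v.
    by rewrite -vE; exact: dv.
  move=> /cvgrPdist_le /(_ _ e0)[d /= d0 Hd].
  exists d => // h hd; have [->|h0] := eqVneq h 0.
    by rewrite addr0 subrr scale0r subr0 !normr0 mulr0.
  have := Hd h; rewrite /ball_/= sub0r normrN => /(_ hd h0).
  rewrite -(ler_pM2r (x := `|h|)) ?normr_gt0// => hl; apply: le_trans hl.
  rewrite mulrC -normrZ scalerBr scalerA divff// scale1r distrC.
  by rewrite /GRing.scale/= mulr1 [h + t]addrC.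
have Hcvg : h^-1 *: (f (h *: 1 + t) - f t) @[h --> 0^'] --> v.
  apply/cvgrPdist_le => e e0; have [d d0 Hd] := H _ e0.
  exists d => //= h; rewrite /ball_/= sub0r normrN => hd h0.
  rewrite -(ler_pM2l (x := `|h|)) ?normr_gt0// mulrC.
  rewrite mulrC -normrZ scalerBr scalerA divff// scale1r distrC.
  by rewrite /GRing.scale/= mulr1 [h + t]addrC [leRHS]mulrC; exact: Hd.
apply: DeriveDef; first by apply/cvg_ex; exists v; exact: Hcvg.
exact/cvg_lim.
Qed.

Lemma is_derive_cts {V : normedModType R} (f : R -> V) (t : R) (v : V) :
  is_derive t 1 f v -> cts f t.
Proof.
move=> [df _]; apply/ctsP; apply: differentiable_continuous.
exact/derivable1_diffP.
Qed.

Lemma cts_within {V : normedModType R} (f : R -> V) (a b : R) :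
  (forall t, a <= t <= b -> cts f t) -> {within `[a, b], continuous f}.
Proof.
move=> H; apply: continuous_in_subspaceT => t; rewrite inE/= in_itv/= => tab.
exact/ctsP/H.
Qed.

Lemma cousin (P : R -> Prop) (a b : R) : a <= b -> P a ->
  (forall x, a <= x <= b -> exists2 d : R, 0 < d &
     forall u w, a <= u -> w <= b -> x - d < u -> u <= x -> x <= w -> w < x + d ->
       P u -> P w) ->
  P b.
Proof.
move=> ab Pa H.
pose S := [set x | a <= x <= b /\ P x].
have Sa : S a by split=> //; rewrite lexx.
have hS : has_sup S by split; [exists a | exists b => x [/andP[]]].
pose c := sup S.
have ac : a <= c by apply: ub_le_sup => //; case: hS.
have cb : c <= b by apply: ge_sup => [|x [/andP[]]]//; exists a.
have [d d0 Hd] : exists2 d : R, 0 < d &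
     forall u w, a <= u -> w <= b -> c - d < u -> u <= c -> c <= w -> w < c + d ->
       P u -> P w by apply: H; rewrite ac.
have [u [/andP[au ub] Pu] cu] := sup_adherent d0 hS.
have uc : u <= c by apply: ub_le_sup; [case: hS|split=> //; rewrite au].
have Pc w : c <= w -> w <= b -> w < c + d -> P w.
  by move=> cw wb wd; apply: (Hd u w).
have [cd|cd] := leP (c + d) b; last by apply: Pc.
have : S (c + d / 2).
  by split; [apply/andP; split; lra|apply: Pc; lra].
move=> /(ub_le_sup (proj2 hS)); rewrite -/c; lra.
Qed.

Lemma mvt_ge (f df : R -> R) (a b c : R) : a <= b ->
  (forall t, a <= t <= b -> cts f t) ->
  (forall t, a < t < b -> is_derive t 1 f (df t)) ->
  (forall t, a < t < b -> c <= df t) -> c * (b - a) <= f b - f a.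
Proof.
rewrite le_eqVlt => /predU1P[->|ab] fc fd fl; first by rewrite !subrr mulr0.
have fd' t : t \in `]a, b[ -> is_derive t 1 f (df t).
  by rewrite in_itv/=; exact: fd.
have [x] := MVT ab fd' (cts_within fc).
rewrite in_itv/= => xab ->; rewrite ler_wpM2r ?subr_ge0 ?(ltW ab)//.
exact: fl.
Qed.

Lemma mvt_le (f df : R -> R) (a b c : R) : a <= b ->
  (forall t, a <= t <= b -> cts f t) ->
  (forall t, a < t < b -> is_derive t 1 f (df t)) ->
  (forall t, a < t < b -> df t <= c) -> f b - f a <= c * (b - a).
Proof.
rewrite le_eqVlt => /predU1P[->|ab] fc fd fl; first by rewrite !subrr mulr0.
have fd' t : t \in `]a, b[ -> is_derive t 1 f (df t).
  by rewrite in_itv/=; exact: fd.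
have [x] := MVT ab fd' (cts_within fc).
rewrite in_itv/= => xab ->; rewrite ler_wpM2r ?subr_ge0 ?(ltW ab)//.
exact: fl.
Qed.

Lemma cts_IVT (f : R -> R) (a b : R) : a <= b ->
  (forall t, a <= t <= b -> cts f t) -> f a <= 0 <= f b \/ f b <= 0 <= f a ->
  exists2 c, a <= c <= b & f c = 0.
Proof.
move=> ab fc H; have [|c] := @IVT R f a b 0 ab (cts_within fc).
  by case: H => /andP[h1 h2]; rewrite ge_min le_max h1 h2 ?orbT.
by rewrite in_itv/= => cab fc0; exists c.
Qed.

Lemma cts_bounded {V : normedModType R} (f : R -> V) (a b : R) :
  (forall t, a <= t <= b -> cts f t) ->
  exists2 M : R, 0 < M & forall t, a <= t <= b -> `|f t| <= M.
Proof.
move=> fc; have [ab|ba] := leP a b; last first.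
  by exists 1 => // t /andP[h1 h2]; lra.
have cn t : a <= t <= b -> cts (fun s => `|f s|) t.
  move=> /fc H e e0; have [d d0 Hd] := H _ e0; exists d => // s /Hd.
  by apply: le_lt_trans; apply: ler_dist_dist.
have [c _ Hc] := EVT_max ab (cts_within cn).
exists (`|f c| + 1); first by rewrite ltr_wpDl.
by move=> t tab; apply: le_trans (Hc t _) _; rewrite ?in_itv//= lerDl.
Qed.

Lemma cts_min_pos (f : R -> R) (a b : R) :
  (forall t, a <= t <= b -> cts f t) -> (forall t, a <= t <= b -> 0 < f t) ->
  exists2 m : R, 0 < m & forall t, a <= t <= b -> m <= f t.
Proof.
move=> fc fp; have [ab|ba] := leP a b; last first.
  by exists 1 => // t /andP[h1 h2]; lra.
have [c] := EVT_min ab (cts_within fc); rewrite in_itv/= => cab Hc.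
by exists (f c) => [|t tab]; [exact: fp | apply: Hc; rewrite in_itv].
Qed.

Lemma normP (z : R * R) : `|z| = Num.max `|z.1| `|z.2|.
Proof. by rewrite prod_normE. Qed.

Lemma norm_ge (z : R * R) : `|z.1| <= `|z| /\ `|z.2| <= `|z|.
Proof. by rewrite normP !le_max !lexx orbT. Qed.

Lemma norm_le_pair (z : R * R) (c : R) : `|z.1| <= c -> `|z.2| <= c -> `|z| <= c.
Proof. by rewrite normP ge_max => -> ->. Qed.

Lemma norm_lt_pair (z : R * R) (c : R) : `|z.1| < c -> `|z.2| < c -> `|z| < c.
Proof. by rewrite normP gt_max => -> ->. Qed.

Lemma is_derive_pair (g : R -> R * R) (t : R) (v : R * R) :
  is_derive t 1 g v <->
  is_derive t 1 (fun s => (g s).1) v.1 /\ is_derive t 1 (fun s => (g s).2) v.2.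
Proof.
split.
  move=> /is_deriveP H; split; apply/is_deriveP => e e0;
    have [d d0 Hd] := H _ e0; exists d => // h hd; apply: le_trans _ (Hd h hd).
    exact: (norm_ge (g (t + h) - g t - h *: v)).1.
  exact: (norm_ge (g (t + h) - g t - h *: v)).2.
move=> [/is_deriveP H1 /is_deriveP H2]; apply/is_deriveP => e e0.
have [d1 d10 Hd1] := H1 _ e0; have [d2 d20 Hd2] := H2 _ e0.
exists (Num.min d1 d2) => [|h]; rewrite lt_min ?d10// => /andP[h1 h2].
by apply: norm_le_pair; [exact: Hd1|exact: Hd2].
Qed.

Lemma cts_pair (g : R -> R * R) (t : R) :
  cts g t <-> cts (fun s => (g s).1) t /\ cts (fun s => (g s).2) t.
Proof.
split.
  move=> H; split=> e e0; have [d d0 Hd] := H _ e0; exists d => // s /Hd;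
    apply: le_lt_trans.
    exact: (norm_ge (g s - g t)).1.
  exact: (norm_ge (g s - g t)).2.
move=> [H1 H2] e e0.
have [d1 d10 Hd1] := H1 _ e0; have [d2 d20 Hd2] := H2 _ e0.
exists (Num.min d1 d2) => [|s]; rewrite lt_min ?d10// => /andP[h1 h2].
by apply: norm_lt_pair; [exact: Hd1|exact: Hd2].
Qed.

End RealAnalysis.

(** * Increments of absolutely continuous solutions of a differential inclusion *)

Section AbsolutelyContinuous.
Context {R : realType}.
Local Notation mu := (@lebesgue_measure R).

Let mu_le (A B : set R) : measurable A -> measurable B -> A `<=` B ->
  (mu A <= mu B)%E.
Proof. by move=> mA mB AB; apply: le_measure; rewrite ?inE. Qed.

Let mu_U (A B : set R) : measurable A -> measurable B -> A `&` B = set0 ->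
  (mu (A `|` B) = mu A + mu B)%E.
Proof. by move=> mA mB AB; exact: (measureU mu mA mB AB). Qed.

Let mu_ge0 (A : set R) : (0 <= mu A)%E.
Proof. by apply: (measure_ge0 (mu : {measure set _ -> \bar R})). Qed.

Lemma negligible_open_cover (N : set R) (e : R) : mu.-negligible N -> 0 < e ->
  exists W : set R, [/\ open W, N `<=` W & (mu W < e%:E)%E].
Proof.
move=> [A [mA A0 NA]] e0.
have [|W [oO AO mO]] := @lebesgue_regularity_outer R A e mA _ e0.
  exact: (eq_ind_r (fun z => (z < +oo)%E) (ltry 0) A0).
exists W; split => //; first exact: subset_trans AO.
have mO' : measurable W by exact: measurable_realfun.open_measurable.
have E : (mu W = mu (W `\` A) + mu (W `&` A))%E := measureDI mu mO' mA.
have mOA : measurable (W `&` A) by exact: measurableI.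
have OA : mu (W `&` A) = 0%E.
  apply/eqP; rewrite eq_le mu_ge0 andbT -A0.
  by apply: mu_le => //; exact: subIsetr.
by rewrite E OA adde0.
Qed.

Lemma norm_lin (al be : R) (z : R * R) :
  `|al * z.1 + be * z.2| <= (`|al| + `|be| + 1) * `|z|.
Proof.
have [h1 h2] := norm_ge z.
apply: (le_trans (ler_normD _ _)); rewrite !normrM.
have := ler_wpM2l (normr_ge0 al) h1; have := ler_wpM2l (normr_ge0 be) h2.
have := normr_ge0 z; lra.
Qed.

(** The exceptional null set lies in an open [W] of small measure, and [cousin] walks from a to b.
    Outside [W] the derivative controls the increment up to a multiple of e; inside [W] the interval
    is put on a list, whose total variation is bounded at the end by absolute continuity. The
    derivative is never integrated. *)
Lemma abs_continuous_ge (a b : R) (f : R -> R * R) (F : R -> set (R * R))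
    (al be c : R) : a <= b ->
  abs_continuous a b f ->
  {ae mu, forall t, a < t < b -> exists2 v, F t v & is_derive t (1 : R) f v} ->
  (forall t v, a < t < b -> F t v -> c <= al * v.1 + be * v.2) ->
  c * (b - a) <= (al * (f b).1 + be * (f b).2) - (al * (f a).1 + be * (f a).2).
Proof.
move=> ab ac ae Fc.
pose l (z : R * R) := al * z.1 + be * z.2.
pose K := `|al| + `|be| + 1.
have K0 : 0 < K by rewrite /K ltr_wpDl// addr_ge0.
have lK z : `|l z| <= K * `|z| by exact: norm_lin.
have lB z w : l (z - w) = l z - l w by rewrite /l/=; ring.
rewrite -/(l (f b)) -/(l (f a)).
(* The loss is e times a fixed constant, so it disappears as e tends to 0. *)
suff H e : 0 < e -> c * (b - a) - e * (K * (b - a) + `|c| + K) <= l (f b) - l (f a).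
  have T0 : 0 < K * (b - a) + `|c| + K.
    by apply: ltr_wpDl => //; apply: addr_ge0 => //; apply: mulr_ge0; lra.
  rewrite leNgt; apply/negP => hlt.
  have /H : 0 < (c * (b - a) - (l (f b) - l (f a))) / 2 / (K * (b - a) + `|c| + K).
    by rewrite !divr_gt0// subr_gt0.
  by rewrite divfK ?gt_eqF//; lra.
move=> e0; have [d0 d00 Hd0] := ac _ e0.
pose d := Num.min d0 e.
have d_gt0 : 0 < d by rewrite lt_min d00.
pose N := ~` [set t | a < t < b -> exists2 v, F t v & is_derive t (1 : R) f v].
(* The endpoints join the exceptional set, so that every remaining point of [a, b] is interior. *)
have negN : mu.-negligible (N `|` [set a] `|` [set b]).
  apply: negligibleU; last first.
    by apply/negligibleP => //; exact: lebesgue_measure_set1.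
  apply: negligibleU; first exact: ae.
  by apply/negligibleP => //; exact: lebesgue_measure_set1.
have [W [oO NO mO]] := negligible_open_cover negN d_gt0.
have mO' : measurable W by exact: measurable_realfun.open_measurable.
have mOt t : measurable (W `&` `]a, t]) by exact: measurableI.
have fO t : (mu (W `&` `]a, t]) < d%:E)%E.
  by apply: le_lt_trans mO; apply: mu_le => //; exact: subIsetl.
have f1 t : mu (W `&` `]a, t]) \is a fin_num.
  by rewrite ge0_fin_numE ?mu_ge0//; apply: lt_trans (fO t) _; rewrite ltry.
pose V t := fine (mu (W `&` `]a, t])).
have VE t : mu (W `&` `]a, t]) = (V t)%:E by rewrite /V fineK.
have V0 t : 0 <= V t by rewrite -lee_fin -VE mu_ge0.
have Vd t : V t < d by rewrite -lte_fin -VE.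
have Vmono u w : u <= w -> V u <= V w.
  move=> uw; rewrite -lee_fin -!VE; apply: mu_le => //.
  apply: setIS => x /=; rewrite !in_itv/= => /andP[-> h]/=; exact: le_trans h uw.
have Vadd u w : a <= u -> u <= w -> (forall x, u < x <= w -> W x) ->
    V u + (w - u) <= V w.
  move=> au uw sub; rewrite -lee_fin -VE EFinD -VE.
  have -> : (w - u)%:E = mu `]u, w].
    rewrite lebesgue_measure_itv/= lte_fin; case: ltP => // wu.
    by congr (_%:E); lra.
  rewrite -mu_U//.
    apply: mu_le => //; first exact: measurableU.
    move=> x [[Ox]|] /=; rewrite !in_itv/= => /andP[h1 h2].
      by split=> //; rewrite h1 (le_trans h2 uw).
    by split; [apply: sub; rewrite h1|rewrite (le_lt_trans au h1)].
  rewrite -subset0 => x [[_]] /=; rewrite !in_itv/= => /andP[_ h1] /andP[h2 _]; lra.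
(* The list records the intervals spent inside [W], latest first; their total length is at most the
   measure [V t] of the part of [W] passed so far. *)
pose P t := a <= t /\ exists s : seq (R * R),
  [/\ forall p, p \in s -> [/\ a <= p.1, p.1 <= p.2 & p.2 <= t],
      pairwise (fun p q : R * R => q.2 <= p.1) s,
      \sum_(p <- s) (p.2 - p.1) <= V t &
      (c - K * e) * (t - a) - `|c| * (\sum_(p <- s) (p.2 - p.1))
        - K * (\sum_(p <- s) `|f p.2 - f p.1|) <= l (f t) - l (f a)].
have : P b.
  apply: (@cousin _ P a b ab).
    split=> //; exists [::]; split => //; first by rewrite big_nil.
    by rewrite !big_nil !subrr !mulr0 !subrr.
  move=> x /andP[ax xb]; have [Ox|nOx] := pselect (W x).
    have : nbhs x W by apply: open_nbhs_nbhs.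
    move=> /nbhs_ballP[r /= r0 rO]; exists r => //.
    move=> u w au wb xru ux xw wxr [_ [s [s1 s2 s3 s4]]].
    have uw : u <= w by exact: le_trans ux xw.
    have uwO y : u < y <= w -> W y.
      move=> /andP[uy yw]; apply: rO; rewrite /ball/= ltr_norml; apply/andP; split; lra.
    split; first exact: le_trans au uw.
    exists ((u, w) :: s); split.
    - move=> p; rewrite inE => /predU1P[->//|/s1[h1 h2 h3]].
      by split => //; exact: le_trans h3 uw.
    - by rewrite pairwise_cons s2 andbT; apply/allP => p /s1[].
    - rewrite big_cons/=; apply: le_trans (Vadd _ _ au uw uwO).
      by rewrite addrC lerD2r.
    rewrite !big_cons/=; move: s4.
    set S1 := \sum_(p <- s) _; set S2 := \sum_(p <- s) _.
    have : - (K * `|f w - f u|) <= l (f w) - l (f u).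
      by rewrite -lB lerNl; apply: le_trans (lK _); rewrite -normrN ler_norm.
    have : (c - K * e) * (w - u) <= `|c| * (w - u).
      apply: ler_wpM2r; first lra.
      have := ler_norm c; have : 0 < K * e by exact: mulr_gt0.
      lra.
    lra.
  have xN : ~ (N `|` [set a] `|` [set b]) x by move=> /NO.
  have axb : a < x < b.
    apply/andP; split; rewrite lt_neqAle ?ax ?xb andbT; apply/eqP => E; apply: xN.
      by left; right; rewrite E.
    by right; rewrite E.
  have [v Fv /is_deriveP dv] : exists2 v, F x v & is_derive x (1 : R) f v.
    by apply: contrapT => h; apply: xN; left; left; rewrite /N/=; move=> /(_ axb).
  have [r r0 Hr] := dv _ e0; exists r => //.
  move=> u w au wb xru ux xw wxr [_ [s [s1 s2 s3 s4]]].
  have uw : u <= w by exact: le_trans ux xw.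
  split; first exact: le_trans au uw.
  exists s; split => //.
  - by move=> p /s1[h1 h2 h3]; split => //; exact: le_trans h3 uw.
  - exact: le_trans s3 (Vmono _ _ uw).
  have key h : `|h| < r -> `|l (f (x + h)) - l (f x) - h * l v| <= K * (e * `|h|).
    move=> hr; have -> : l (f (x + h)) - l (f x) - h * l v =
      l (f (x + h) - f x - h *: v) by rewrite /l/=; rewrite /GRing.scale/=; ring.
    by apply: le_trans (lK _) _; rewrite ler_pM2l//; exact: Hr.
  have := key (w - x); have := key (u - x).
  rewrite !subrKC (ger0_norm (x := w - x)) ?subr_ge0// (ler0_norm (x := u - x)) ?subr_le0//.
  have h1 : - (u - x) < r by lra.
  have h2 : w - x < r by lra.
  move=> /(_ h1) + /(_ h2).
  rewrite !ler_norml => /andP[_ k1] /andP[k2 _].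
  have h3 : 0 <= w - u by lra.
  have := ler_wpM2r h3 (Fc _ _ axb Fv).
  rewrite -/(l v) => h4.
  move: s4 k1 k2 h4; set S1 := \sum_(p <- s) _; set S2 := \sum_(p <- s) _.
  lra.
move=> [_ [s [s1 s2 s3 s4]]].
have sumlt : \sum_(p <- s) `|f p.2 - f p.1| < e.
  have sn : pairwise (fun p q : R * R => q.2 <= p.1) s by [].
  have szi i : (i < size s)%N -> nth (0, 0) s i \in s by exact: mem_nth.
  have := Hd0 (size s) (fun i => (nth (0, 0) s i).1) (fun i => (nth (0, 0) s i).2).
  rewrite (big_nth (0, 0)) big_mkord; apply.
  - by move=> i; case: (s1 _ (szi _ (ltn_ord i))).
  - move=> i j; rewrite -val_eqE neq_ltn => /orP[] ij; [right|left].
      by have /(pairwiseP (0, 0)) := s2; apply => //; rewrite inE.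
    by have /(pairwiseP (0, 0)) := s2; apply => //; rewrite inE.
  - have <- := big_mkord xpredT (fun i => (nth (0, 0) s i).2 - (nth (0, 0) s i).1).
    rewrite -(big_nth (0, 0) xpredT (fun p : R * R => p.2 - p.1)).
    by apply: le_lt_trans s3 _; apply: lt_le_trans (Vd b) _; rewrite ge_min lexx.
apply: le_trans s4.
have h1 : \sum_(p <- s) (p.2 - p.1) <= e.
  by apply: le_trans s3 _; apply: ltW; apply: lt_le_trans (Vd b) _; rewrite ge_min lexx orbT.
have := ler_wpM2l (normr_ge0 c) h1.
have := ler_wpM2l (ltW K0) (ltW sumlt).
set S1 := \sum_(p <- s) _; set S2 := \sum_(p <- s) _.
lra.
Qed.

End AbsolutelyContinuous.

(** * Flows of locally Lipschitz planar fields *)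

Section Flow.
Context {R : realType}.

Lemma mvt_abs (f df : R -> R) (t h m c : R) :
  (forall s, `|s - t| <= `|h| -> is_derive s 1 f (df s)) ->
  (forall s, `|s - t| <= `|h| -> `|df s - m| <= c) ->
  `|f (t + h) - f t - h * m| <= c * `|h|.
Proof.
move=> fd fc.
have fcts s : `|s - t| <= `|h| -> cts f s by move=> /fd; exact: is_derive_cts.
have fl s : `|s - t| <= `|h| -> m - c <= df s.
  by move=> /fc; rewrite ler_norml => /andP[]; lra.
have fu s : `|s - t| <= `|h| -> df s <= m + c.
  by move=> /fc; rewrite ler_norml => /andP[]; lra.
have [h0|h0] := leP 0 h.
  have nt s : t <= s <= t + h -> `|s - t| <= `|h|.
    by move=> /andP[h1 h2]; rewrite !ger0_norm //; lra.
  have nt' s : t < s < t + h -> `|s - t| <= `|h|.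
    by move=> /andP[h1 h2]; apply: nt; rewrite !ltW.
  have th : t <= t + h by lra.
  have H1 := mvt_ge th (fun s hs => fcts s (nt s hs))
    (fun s hs => fd s (nt' s hs)) (fun s hs => fl s (nt' s hs)).
  have H2 := mvt_le th (fun s hs => fcts s (nt s hs))
    (fun s hs => fd s (nt' s hs)) (fun s hs => fu s (nt' s hs)).
  by rewrite (ger0_norm h0) ler_norml; apply/andP; split; lra.
have nt s : t + h <= s <= t -> `|s - t| <= `|h|.
  by move=> /andP[h1 h2]; rewrite !ler0_norm //; lra.
have nt' s : t + h < s < t -> `|s - t| <= `|h|.
  by move=> /andP[h1 h2]; apply: nt; rewrite !ltW.
have th : t + h <= t by lra.
have H1 := mvt_ge th (fun s hs => fcts s (nt s hs))
  (fun s hs => fd s (nt' s hs)) (fun s hs => fl s (nt' s hs)).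
have H2 := mvt_le th (fun s hs => fcts s (nt s hs))
  (fun s hs => fd s (nt' s hs)) (fun s hs => fu s (nt' s hs)).
by rewrite (ltr0_norm h0) ler_norml; apply/andP; split; lra.
Qed.

Lemma is_deriveB_fun (f g : R -> R) (t a b : R) : is_derive t 1 f a ->
  is_derive t 1 g b -> is_derive t 1 (fun s => f s - g s) (a - b).
Proof. by move=> fa gb; exact: (is_deriveB fa gb). Qed.

Lemma is_derive_refl (f : R -> R) (t a : R) : is_derive t 1 f a ->
  is_derive (- t) 1 (fun s => f (- s)) (- a).
Proof.
move=> /is_deriveP H; apply/is_deriveP => e e0; have [d d0 Hd] := H _ e0.
exists d => // h hd; have := Hd (- h); rewrite normrN => /(_ hd).
rewrite opprD opprK /GRing.scale/= => k.
by have -> : f (t - h) - f t - h * - a = f (t - h) - f t - - h * a by ring.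
Qed.

Lemma is_derive_expW (L t : R) :
  is_derive t 1 (fun s => expR (L * s)) (L * expR (L * t)).
Proof.
have H : is_derive t (1 : R) (fun s : R => L * s) L.
  have := @is_deriveZ _ _ _ (@id R) L t 1 1 (is_derive_id _ _).
  by rewrite /GRing.scale/= mulr1.
have -> : (fun s => expR (L * s)) = expR \o (fun s : R => L * s) by [].
by have := is_derive1_comp (is_derive_expR (L * t)) H; rewrite mulrC.
Qed.

Lemma is_derive_shift (V : normedModType R) (f : R -> V) (t a : R) (v : V) :
  is_derive (t + a) 1 f v -> is_derive t 1 (fun s => f (s + a)) v.
Proof.
move=> /is_deriveP H; apply/is_deriveP => e e0; have [d d0 Hd] := H _ e0.
by exists d => // h hd; have := Hd h hd; rewrite [t + a + h]addrAC.
Qed.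

Lemma primitive_right (f : R -> R) : (forall t, cts f t) ->
  exists F : R -> R, F 0 = 0 /\ forall t : R, -1 < t -> is_derive t (1 : R) F (f t).
Proof.
(* Integrating from -1 makes 0 an interior point, where the derivative is two-sided. *)
move=> fc; pose F x := (\int[lebesgue_measure]_(t in [set` `[(-1), x]]) (f t))%R.
exists (fun x => F x - F 0); split; first by rewrite subrr.
move=> t t1; have tt : t < t + 1 by rewrite ltrDl.
have it : lebesgue_measure.-integrable `[(-1), t + 1] (EFin \o f).
  apply: continuous_compact_integrable; first exact: segment_compact.
  by apply: cts_within => s _; exact: fc.
have fct : {for t, continuous f} by apply/ctsP; exact: fc.
have [dF dE] := continuous_FTC1_closed tt it t1 fct.
rewrite -[f t]subr0; apply: (@is_deriveB_fun F (fun=> F 0) t (f t) 0).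
by apply: DeriveDef; [exact: dF|rewrite -derive1E].
Qed.

(** A primitive of the reflected function covers the negative axis. Both pieces vanish at 0 and have
    the same derivative on ]-1, 1[, so they agree there and switching at 0 is harmless. *)
Lemma primitive (f : R -> R) : (forall t, cts f t) ->
  exists F : R -> R, F 0 = 0 /\ forall t : R, is_derive t (1 : R) F (f t).
Proof.
move=> fc; have [F [F0 dF]] := primitive_right fc.
have gc t : cts (fun s => - f (- s)) t.
  move=> e e0; have [d d0 Hd] := fc (- t) _ e0; exists d => // s sd.
  by have := Hd (- s); rewrite -!opprD !normrN; apply.
have [G [G0 dG]] := primitive_right gc.
pose H (t : R) := if 0 <= t then F t else G (- t).
have HG (t : R) : -1 < t < 1 -> F t = G (- t).
  move=> /andP[t1 t2].
  have D (s : R) : `|s - 0| <= `|t| ->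
      is_derive s (1 : R) (fun s => F s - G (- s)) (f s - - - f (- - s)).
    rewrite subr0 ler_norml => /andP[s1 s2].
    have : `|t| < 1 by rewrite ltr_norml t1 t2.
    move=> tn; apply: is_deriveB_fun; first by apply: dF; lra.
    have := @is_derive_refl G (- s) _ (dG (- s) _).
    by rewrite opprK; apply; lra.
  have := mvt_abs (m := 0) (c := 0) D.
  rewrite !oppr0 add0r F0 G0 mul0r mulr0 !subr0 normr_le0 => k.
  apply/eqP; rewrite -subr_eq0; apply: k => s _.
  by rewrite !opprK addr0 subrr normr0.
exists H; split; first by rewrite /H lexx.
move=> t; have [t0|t0] := ltP (- 1 / 2) t.
  apply: (near_eq_is_derive (f := F)); last by apply: dF; lra.
  have : \forall s \near t, - 1 / 2 < s by exact: lt_nbhsr.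
  apply: filterS => s s0; rewrite /H; case: ifPn => //.
  by rewrite -ltNge => sn; apply: HG; apply/andP; split; lra.
apply: (near_eq_is_derive (f := fun s => G (- s))).
  have : \forall s \near t, s < 0 by apply: lt_nbhsl; lra.
  by apply: filterS => s s0; rewrite /H leNgt s0.
have := @is_derive_refl G (- t) _ (dG (- t) _).
by rewrite !opprK; apply; lra.
Qed.

Lemma ler_geometric_lim (a b c : R) : (forall k, a <= b + c / 2 ^+ k) -> a <= b.
Proof.
move=> H; rewrite leNgt; apply/negP => ba.
have c0 : 0 < c by have := H 0%N; rewrite expr0 divr1; lra.
have dpos : 0 < c / (a - b) by rewrite divr_gt0// subr_gt0.
have := archi_boundP (ltW dpos); set k := Num.bound _ => hk.
have kk : k%:R < 2 ^+ k :> R by rewrite -natrX ltr_nat ltn_expl.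
have := lt_trans hk kk; rewrite ltr_pdivrMr ?subr_gt0// mulrC => hc.
have := H k; rewrite -lerBlDl ler_pdivlMr ?exprn_gt0//; lra.
Qed.

(** Nested intervals: the points at distance [2 * B / 2 ^+ k] below and above [x k] are monotone in
    k, and the supremum of the lower ones is the limit. *)
Lemma geometric_limit (x : nat -> R) (B : R) :
  (forall k, `|x k.+1 - x k| <= B / 2 ^+ k) ->
  exists l, forall k, `|x k - l| <= 2 * B / 2 ^+ k.
Proof.
move=> H; pose y k := x k - 2 * B / 2 ^+ k; pose z k := x k + 2 * B / 2 ^+ k.
have step k : 2 * B / 2 ^+ k.+1 = B / 2 ^+ k.
  by rewrite exprS invfM; field; rewrite expf_neq0.
have B0 k : 0 <= B / 2 ^+ k by exact: le_trans (H k).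
have yz j k : y j <= z k.
  have ym i : y i <= y i.+1.
    rewrite /y step; have := H i; rewrite ler_norml => /andP[+ _].
    by rewrite -!mulrA; lra.
  have zm i : z i.+1 <= z i.
    rewrite /z step; have := H i; rewrite ler_norml => /andP[_ +].
    by rewrite -!mulrA; lra.
  have ymm : {homo y : a b / (a <= b)%N >-> a <= b}.
    by apply: homo_leq => // a b c; exact: le_trans.
  have zmm a b : (a <= b)%N -> z b <= z a.
    elim: b => [|b IH]; first by rewrite leqn0 => /eqP->.
    rewrite leq_eqVlt => /predU1P[->//|]; rewrite ltnS => /IH.
    exact: le_trans.
  apply: (le_trans (ymm _ _ (leq_maxl j k))).
  apply: le_trans (zmm _ _ (leq_maxr j k)).
  by rewrite /y /z; have := B0 (maxn j k); rewrite -!mulrA; lra.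
pose S := [set y k | k in setT].
have hS : has_sup S.
  by split; [exists (y 0%N), 0%N | exists (z 0%N) => _ [j _ <-]].
exists (sup S) => k.
have h1 : y k <= sup S by apply: ub_le_sup; [case: hS|exists k].
have h2 : sup S <= z k by apply: ge_sup; [case: hS|move=> _ [j _ <-]].
by rewrite ler_norml; move: h1 h2; rewrite /y /z => h1 h2; apply/andP; split; lra.
Qed.

(** Bielecki's weighted norm: integrating from 0 divides a bound in the weight [expR (L * |t|)] by
    L, uniformly on the whole line. *)
Lemma exp_weight_bound (u du : R -> R) (A L : R) :
  u 0 = 0 -> (forall t : R, is_derive t (1 : R) u (du t)) ->
  (forall t, `|du t| <= A * L * expR (L * `|t|)) -> 0 <= A ->
  forall t, `|u t| <= A * expR (L * `|t|).
Proof.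
move=> u0 ud ub A0 t.
wlog t0 : u du u0 ud ub t / 0 <= t.
  move=> H; have [t0|t0] := leP 0 t; first exact: (H u du).
  have := H (fun s => u (- s)) (fun s => - du (- s)) _ _ _ (- t) _.
  rewrite normrN opprK; apply; rewrite ?oppr0// ?oppr_ge0 ?(ltW t0)//.
    move=> s; have := is_derive_refl (ud (- s)); rewrite opprK; exact.
  by move=> s; rewrite normrN; have := ub (- s); rewrite normrN.
rewrite (ger0_norm t0).
have wd (s : R) : is_derive s (1 : R) (fun s => A * expR (L * s))
    (A * (L * expR (L * s))).
  exact: (@is_deriveZ _ _ _ (fun s => expR (L * s)) A s 1 _ (is_derive_expW L s)).
have D1 (s : R) : 0 < s < t -> is_derive s (1 : R)
  (fun s => u s - A * expR (L * s)) (du s - A * (L * expR (L * s))).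
  by move=> _; apply: is_deriveB_fun.
have D2 (s : R) : 0 < s < t -> is_derive s (1 : R)
  (fun s => A * expR (L * s) - (- u s)) (A * (L * expR (L * s)) - (- du s)).
  by move=> _; exact: (is_deriveB_fun (wd s) (is_deriveN (ud s))).
have C1 s : 0 <= s <= t -> cts (fun s => u s - A * expR (L * s)) s.
  by move=> _; apply: is_derive_cts; apply: is_deriveB_fun.
have C2 r : 0 <= r <= t -> cts (fun s => A * expR (L * s) - (- u s)) r.
  by move=> _; exact: (is_derive_cts (is_deriveB_fun (wd r) (is_deriveN (ud r)))).
have := @mvt_le _ _ _ _ _ 0 t0 C1 D1; have := @mvt_ge _ _ _ _ _ 0 t0 C2 D2.
rewrite !mul0r !mulr0 expR0 u0 => H2 H1.
have K1 : forall s, 0 < s < t -> 0 <= A * (L * expR (L * s)) - (- du s).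
  move=> s /andP[s0 _]; have := ub s; rewrite (ger0_norm (ltW s0)) ler_norml.
  by move=> /andP[+ _]; rewrite -!mulrA; lra.
have K2 : forall s, 0 < s < t -> du s - A * (L * expR (L * s)) <= 0.
  move=> s /andP[s0 _]; have := ub s; rewrite (ger0_norm (ltW s0)) ler_norml.
  by move=> /andP[_]; rewrite -!mulrA; lra.
have := H1 K2; have := H2 K1; rewrite ler_norml => k1 k2.
by apply/andP; split; lra.
Qed.

End Flow.

(** * Global solutions by Picard iteration *)

Section Picard.
Context {R : realType}.

Lemma lipschitz_cts (X : R * R -> R * R) (L : R) (g : R -> R * R) (t : R) :
  0 < L -> (forall z w, `|X z - X w| <= L * `|z - w|) -> cts g t ->
  cts (fun s => X (g s)) t.
Proof.
move=> L0 XL gc e e0; have [d d0 Hd] := gc _ (divr_gt0 e0 L0).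
exists d => // s /Hd; rewrite ltr_pdivlMr// mulrC; apply: le_lt_trans.
exact: XL.
Qed.

Let sum3 (a b c x1 x2 x3 : R) : x1 <= a + c -> x2 <= b / 2 -> x3 <= b / 2 ->
  0 <= a -> 0 <= b -> x1 + x2 + x3 <= c + (2 * a + 4 * b).
Proof. lra. Qed.

(** A Lipschitz constant L against a weight of rate [2 * L] contracts by the factor 1 / 2 on all of
    the time axis, so no continuation of local solutions occurs. *)
Lemma flow_exists (X : R * R -> R * R) (M L : R) : 0 < L ->
  (forall z, `|X z| <= M) -> (forall z w, `|X z - X w| <= L * `|z - w|) ->
  forall z0, exists g : R -> R * R,
    g 0 = z0 /\ forall t : R, is_derive t (1 : R) g (X (g t)).
Proof.
move=> L0 XM XL z0.
have M0 : 0 <= M by exact: le_trans (XM 0).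
have step (g : {g : R -> R * R | forall t, cts g t}) :
  exists g' : {g : R -> R * R | forall t, cts g t},
    sval g' 0 = z0 /\ forall t : R, is_derive t (1 : R) (sval g') (X (sval g t)).
  have Xg t : cts (fun s => X (sval g s)) t.
    exact: lipschitz_cts L0 XL (svalP g t).
  have [F [F0 dF]] := primitive (fun t => ((cts_pair _ _).1 (Xg t)).1).
  have [G [G0 dG]] := primitive (fun t => ((cts_pair _ _).1 (Xg t)).2).
  pose h t := (z0.1 + F t, z0.2 + G t).
  have dh (t : R) : is_derive t (1 : R) h (X (sval g t)).
    apply/is_derive_pair; split => /=.
      have := is_deriveD (is_derive_cst z0.1 t (1 : R)) (dF t).
      by rewrite add0r.
    have := is_deriveD (is_derive_cst z0.2 t (1 : R)) (dG t).
    by rewrite add0r.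
  exists (exist _ h (fun t => is_derive_cts (dh t))); split => //=.
  by rewrite /h F0 G0 !addr0; case: (z0).
have [N HN] := choice step.
have c0 : forall t, cts (fun=> z0 : R * R) t.
  by move=> t e e0; exists 1 => // s _; rewrite subrr normr0.
(* Each iterate carries its continuity, as the next one is a primitive of [X] along it. *)
pose q k := iter k N (exist _ (fun=> z0) c0).
pose g k := sval (q k).
have g0 k : g k 0 = z0 by case: k => [//|k]; rewrite /g /q iterS;
  case: (HN (iter k N (exist _ (fun=> z0) c0))).
have dg k (t : R) : is_derive t (1 : R) (g k.+1) (X (g k t)).
  by rewrite /g /q iterS; case: (HN (iter k N (exist _ (fun=> z0) c0))).
pose W (t : R) : R := expR (2 * L * `|t|).
have W1 t : 1 <= W t by rewrite -expR0 ler_expR !mulr_ge0// ltW.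
(* Chosen so that the speed bound [M] equals [A * (2 * L)], the growth rate of [A * W] at 0. *)
pose A := M / (2 * L).
have A0 : 0 <= A by rewrite divr_ge0// mulr_ge0// ltW.
have AL : A * (2 * L) = M by rewrite divfK// mulf_neq0// gt_eqF.
have bound k t : `|g k.+1 t - g k t| <= A / 2 ^+ k * W t.
  elim: k t => [|k IH] t.
    have E s : g 0%N s = z0 by [].
    have d1 s := (is_derive_pair _ _ _).1 (dg 0%N s).
    apply: norm_le_pair; rewrite expr0 divr1.
      have := @exp_weight_bound R (fun s => (g 1%N s).1 - z0.1)
        (fun s => (X z0).1) A (2 * L) _ _ _ A0 t.
      apply; first by rewrite /= g0 subrr.
        move=> s; have := is_deriveB (d1 s).1 (is_derive_cst z0.1 s (1 : R)).
        by rewrite subr0.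
      move=> s; rewrite AL; apply: le_trans (norm_ge _).1 _.
      by apply: le_trans (XM _) _; rewrite ler_peMr//; exact: W1.
    have := @exp_weight_bound R (fun s => (g 1%N s).2 - z0.2)
      (fun s => (X z0).2) A (2 * L) _ _ _ A0 t.
    apply; first by rewrite /= g0 subrr.
      move=> s; have := is_deriveB (d1 s).2 (is_derive_cst z0.2 s (1 : R)).
      by rewrite subr0.
    move=> s; rewrite AL; apply: le_trans (norm_ge _).2 _.
    by apply: le_trans (XM _) _; rewrite ler_peMr//; exact: W1.
  have d1 s := (is_derive_pair _ _ _).1 (dg k.+1 s).
  have d2 s := (is_derive_pair _ _ _).1 (dg k s).
  have Ak0 : 0 <= A / 2 ^+ k.+1 by rewrite divr_ge0// exprn_ge0.
  have key s : `|X (g k.+1 s) - X (g k s)| <= A / 2 ^+ k.+1 * (2 * L) * W s.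
    apply: le_trans (XL _ _) _.
    have -> : A / 2 ^+ k.+1 * (2 * L) * W s = L * (A / 2 ^+ k * W s).
      by rewrite exprS; field; rewrite expf_neq0.
    by rewrite ler_pM2l.
  apply: norm_le_pair.
    apply: (@exp_weight_bound R (fun s => (g k.+2 s).1 - (g k.+1 s).1)
      (fun s => (X (g k.+1 s)).1 - (X (g k s)).1)) => //.
    - by rewrite !g0 subrr.
    - by move=> s; apply: is_deriveB_fun; [exact: (d1 s).1|exact: (d2 s).1].
    - by move=> s; apply: le_trans (key s); exact: (norm_ge (_ - _)).1.
  apply: (@exp_weight_bound R (fun s => (g k.+2 s).2 - (g k.+1 s).2)
    (fun s => (X (g k.+1 s)).2 - (X (g k s)).2)) => //.
  - by rewrite !g0 subrr.
  - by move=> s; apply: is_deriveB_fun; [exact: (d1 s).2|exact: (d2 s).2].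
  - by move=> s; apply: le_trans (key s); exact: (norm_ge (_ - _)).2.
have bnd' t k : A / 2 ^+ k * W t = A * W t / 2 ^+ k by rewrite mulrAC.
have lim1 t : exists l, forall k, `|(g k t).1 - l| <= 2 * (A * W t) / 2 ^+ k.
  apply: geometric_limit => k; rewrite -bnd'; apply: le_trans (bound k t).
  exact: (norm_ge (_ - _)).1.
have lim2 t : exists l, forall k, `|(g k t).2 - l| <= 2 * (A * W t) / 2 ^+ k.
  apply: geometric_limit => k; rewrite -bnd'; apply: le_trans (bound k t).
  exact: (norm_ge (_ - _)).2.
have [G1 HG1] := choice lim1; have [G2 HG2] := choice lim2.
pose G t := (G1 t, G2 t).
have HG t k : `|g k t - G t| <= 2 * (A * W t) / 2 ^+ k.
  by apply: norm_le_pair; [exact: HG1|exact: HG2].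
have gL k t s : `|g k.+1 s - g k.+1 t| <= M * `|s - t|.
  have d1 s := (is_derive_pair _ _ _).1 (dg k s).
  have e : s = t + (s - t) by rewrite subrKC.
  apply: norm_le_pair => /=; rewrite {1}e.
    have := @mvt_abs R (fun s => (g k.+1 s).1) (fun s => (X (g k s)).1) t (s - t) 0 M.
    rewrite mulr0 subr0; apply; first by move=> x _; exact: (d1 x).1.
    by move=> x _; rewrite subr0; apply: le_trans (norm_ge _).1 (XM _).
  have := @mvt_abs R (fun s => (g k.+1 s).2) (fun s => (X (g k s)).2) t (s - t) 0 M.
  rewrite mulr0 subr0; apply; first by move=> x _; exact: (d1 x).2.
  by move=> x _; rewrite subr0; apply: le_trans (norm_ge _).2 (XM _).
have pow2le t k : 2 * (A * W t) / 2 ^+ k.+1 <= 2 * (A * W t) / 2 ^+ k.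
  have := le_trans ler01 (W1 t) => W0.
  apply: ler_wpM2l; first by rewrite mulr_ge0// mulr_ge0.
  by rewrite lef_pV2 ?posrE ?exprn_gt0// ler_eXn2l ?ltr1n.
have GL t s : `|G s - G t| <= M * `|s - t|.
  apply: (@ler_geometric_lim _ _ _ (2 * (A * W s) + 2 * (A * W t))) => k.
  have -> : G s - G t = (g k.+1 s - g k.+1 t) - (g k.+1 s - G s) + (g k.+1 t - G t).
    rewrite [X in _ = X]addrAC [g k.+1 t - _]addrC addrA.
    by apply/eqP; rewrite -subr_eq0; apply/eqP; congr (_, _) => /=; ring.
  apply: le_trans (ler_normD _ _) _; apply: le_trans (lerD (ler_normB _ _) (lexx _)) _.
  rewrite mulrDl addrA; apply: lerD.
    apply: lerD; first exact: gL.
    apply: le_trans (HG s k.+1) _; exact: pow2le.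
  apply: le_trans (HG t k.+1) _; exact: pow2le.
exists G; split.
  have E : `|G 0 - z0| <= 0.
    apply: (@ler_geometric_lim _ _ _ (2 * (A * W 0))) => k.
    by rewrite add0r distrC -(g0 k); exact: HG.
  by move: E; rewrite normr_le0 subr_eq0 => /eqP.
move=> t; apply/is_deriveP => e e0.
have LM : 0 < L * M + 1 by rewrite ltr_wpDl// mulr_ge0// ltW.
exists (e / (L * M + 1)) => [|h hd]; first exact: divr_gt0.
pose Wm := W (`|t| + `|h|).
have Ws s : `|s - t| <= `|h| -> W s <= Wm.
  move=> st; rewrite ler_expR ler_pM2l ?mulr_gt0//.
  rewrite [leRHS]ger0_norm ?addr_ge0//.
  by have := ler_normD t (s - t); rewrite subrKC; lra.
(* The limit is M-Lipschitz, so [X] varies by at most [L * M * |h|] along it over time h; this is a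
   quadratic error. *)
suff H : `|G (t + h) - G t - h *: X (G t)| <= L * M * `|h| * `|h|.
  apply: le_trans H _; rewrite ler_wpM2r//.
  move: hd; rewrite ltr_pdivlMr// => hd.
  have := normr_ge0 h; have := mulr_ge0 (ltW L0) M0; lra.
have key k s : `|s - t| <= `|h| ->
    `|X (g k.+1 s) - X (G t)| <= L * (2 * (A * Wm) / 2 ^+ k.+1 + M * `|h|).
  move=> st; apply: le_trans (XL _ _) _; rewrite ler_pM2l//.
  apply: le_trans (ler_distD (G s) _ _) _; apply: lerD.
    apply: le_trans (HG s k.+1) _.
    by rewrite ler_wpM2r ?invr_ge0 ?exprn_ge0// ler_pM2l// ler_wpM2l// Ws.
  by apply: le_trans (GL _ _) _; rewrite ler_wpM2l.
have fin k : `|g k.+2 (t + h) - g k.+2 t - h *: X (G t)| <=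
    L * (2 * (A * Wm) / 2 ^+ k.+1 + M * `|h|) * `|h|.
  have d1 s := (is_derive_pair _ _ _).1 (dg k.+1 s).
  apply: norm_le_pair.
    apply: (@mvt_abs R (fun s => (g k.+2 s).1) (fun s => (X (g k.+1 s)).1)).
      by move=> s _; exact: (d1 s).1.
    by move=> s st; apply: le_trans (key k s st); exact: (norm_ge (_ - _)).1.
  apply: (@mvt_abs R (fun s => (g k.+2 s).2) (fun s => (X (g k.+1 s)).2)).
    by move=> s _; exact: (d1 s).2.
  by move=> s st; apply: le_trans (key k s st); exact: (norm_ge (_ - _)).2.
apply: (@ler_geometric_lim _ _ _ (L * (2 * (A * Wm)) * `|h| + 4 * (A * Wm))) => k.
have -> : G (t + h) - G t - h *: X (G t) =
   (g k.+2 (t + h) - g k.+2 t - h *: X (G t)) - (g k.+2 (t + h) - G (t + h))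
   + (g k.+2 t - G t).
  by congr (_, _) => /=; ring.
apply: le_trans (ler_normD _ _) _; apply: le_trans (lerD (ler_normB _ _) (lexx _)) _.
have P k' : 0 <= (2 ^+ k')^-1 :> R by rewrite invr_ge0 exprn_ge0.
have k0 : 2 ^+ k != 0 :> R by rewrite expf_neq0.
have E1 : (2 ^+ k.+1)^-1 = (2 ^+ k)^-1 / 2 :> R by rewrite exprS; field.
have E2 : (2 ^+ k.+2)^-1 = (2 ^+ k)^-1 / 4 :> R.
  by rewrite !exprS; field.
have h1 := fin k.
have AW : 0 <= A * Wm by rewrite mulr_ge0// (le_trans ler01)// W1.
have h2 : `|g k.+2 (t + h) - G (t + h)| <= 2 * (A * Wm) / 2 ^+ k.+2.
  apply: le_trans (HG _ _) _; rewrite ler_wpM2r// ler_pM2l// ler_wpM2l// Ws//.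
  by rewrite addrAC subrr add0r.
have h3 : `|g k.+2 t - G t| <= 2 * (A * Wm) / 2 ^+ k.+2.
  by apply: le_trans (HG _ _) _; rewrite ler_wpM2r// ler_pM2l// ler_wpM2l// Ws// subrr normr0.
have p0 := P k.
have q0 : 0 <= L * (A * Wm) * `|h| * (2 ^+ k)^-1.
  by apply: mulr_ge0 => //; apply: mulr_ge0 => //; apply: mulr_ge0 => //; exact: ltW.
have q1 : 0 <= A * Wm * (2 ^+ k)^-1 by rewrite mulr_ge0.
rewrite E1 in h1; rewrite E2 in h2 h3.
have F1 : (L * (2 * (A * Wm)) * `|h| + 4 * (A * Wm)) / 2 ^+ k =
   2 * (L * (A * Wm) * `|h| / 2 ^+ k) + 4 * (A * Wm / 2 ^+ k) by ring.
rewrite F1; apply: sum3 => //.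
- by apply: le_trans h1 _; rewrite le_eqVlt; apply/orP; left; apply/eqP; field.
- by apply: le_trans h2 _; rewrite le_eqVlt; apply/orP; left; apply/eqP; field.
- by apply: le_trans h3 _; rewrite le_eqVlt; apply/orP; left; apply/eqP; field.
Qed.

End Picard.

(** * Gronwall's inequality *)

Section Gronwall.
Context {R : realType}.

Lemma is_deriveM_fun (f g : R -> R) (t a b : R) : is_derive t 1 f a ->
  is_derive t 1 g b -> is_derive t 1 (fun s => f s * g s) (f t * b + g t * a).
Proof. by move=> fa gb; exact: (is_deriveM fa gb). Qed.

Lemma is_deriveD_fun (f g : R -> R) (t a b : R) : is_derive t 1 f a ->
  is_derive t 1 g b -> is_derive t 1 (fun s => f s + g s) (a + b).
Proof. by move=> fa gb; exact: (is_deriveD fa gb). Qed.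

Lemma ctsB (f g : R -> R) (t : R) : cts f t -> cts g t ->
  cts (fun s => f s - g s) t.
Proof. by move=> /ctsP fc /ctsP gc; apply/ctsP; exact: (continuousB fc gc). Qed.

Lemma ctsD (f g : R -> R) (t : R) : cts f t -> cts g t ->
  cts (fun s => f s + g s) t.
Proof. by move=> /ctsP fc /ctsP gc; apply/ctsP; exact: (continuousD fc gc). Qed.

Lemma ctsM (f g : R -> R) (t : R) : cts f t -> cts g t ->
  cts (fun s => f s * g s) t.
Proof. by move=> /ctsP fc /ctsP gc; apply/ctsP; exact: (continuousM fc gc). Qed.

Lemma cts_cst {V : normedModType R} (c : V) (t : R) : cts (fun=> c) t.
Proof. by move=> e e0; exists 1 => // s _; rewrite subrr normr0. Qed.

Let energy_rate (x y a b L m : R) : `|a| <= L * m -> `|b| <= L * m ->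
  0 < L -> 0 <= m -> `|x| <= m -> `|y| <= m -> m ^+ 2 <= x ^+ 2 + y ^+ 2 ->
  2 * (x * a + y * b) <= 4 * L * (x ^+ 2 + y ^+ 2).
Proof.
move=> ha hb L0 m0 hx hy hm.
have xa : x * a <= m * (L * m).
  by apply: le_trans (ler_norm _) _; rewrite normrM ler_pM.
have yb : y * b <= m * (L * m).
  by apply: le_trans (ler_norm _) _; rewrite normrM ler_pM.
have : L * m ^+ 2 <= L * (x ^+ 2 + y ^+ 2) by rewrite ler_pM2l.
rewrite expr2; lra.
Qed.

Lemma norm_sqr_bounds (z : R * R) :
  `|z| ^+ 2 <= z.1 ^+ 2 + z.2 ^+ 2 /\ z.1 ^+ 2 + z.2 ^+ 2 <= 2 * `|z| ^+ 2.
Proof.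
rewrite normP -(real_normK (num_real z.1)) -(real_normK (num_real z.2)).
have a0 := normr_ge0 z.1; have b0 := normr_ge0 z.2.
move: `|z.1| `|z.2| a0 b0 => a b a0 b0.
have [ab|ba] := leP a b; split.
- by rewrite lerDr sqr_ge0.
- have : a ^+ 2 <= b ^+ 2 by rewrite ler_pXn2r ?nnegrE.
  lra.
- by rewrite lerDl sqr_ge0.
- have : b ^+ 2 <= a ^+ 2 by rewrite ler_pXn2r ?nnegrE// ltW.
  lra.
Qed.

(** The squared Euclidean distance times [expR (- (4 * L) * t)] is nonincreasing. It is
    differentiable, unlike the max norm of the product; comparing the two norms costs a factor sqrt
    2, rounded up to 2. *)
Lemma gronwall (k1 k2 d1 d2 : R -> R * R) (T L : R) : 0 <= T -> 0 < L ->
  (forall t, 0 <= t <= T -> cts k1 t) -> (forall t, 0 <= t <= T -> cts k2 t) ->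
  (forall t : R, 0 < t < T -> is_derive t (1 : R) k1 (d1 t)) ->
  (forall t : R, 0 < t < T -> is_derive t (1 : R) k2 (d2 t)) ->
  (forall t, 0 < t < T -> `|d1 t - d2 t| <= L * `|k1 t - k2 t|) ->
  `|k1 T - k2 T| <= 2 * expR (2 * L * T) * `|k1 0 - k2 0|.
Proof.
move=> T0 L0 c1 c2 D1 D2 lip.
pose x t := (k1 t).1 - (k2 t).1; pose y t := (k1 t).2 - (k2 t).2.
pose u t := x t ^+ 2 + y t ^+ 2.
pose v t := u t * expR (- (4 * L) * t).
have cx t : 0 <= t <= T -> cts x t.
  by move=> tT; apply: ctsB; [case/cts_pair: (c1 _ tT)|case/cts_pair: (c2 _ tT)].
have cy t : 0 <= t <= T -> cts y t.
  by move=> tT; apply: ctsB; [case/cts_pair: (c1 _ tT)|case/cts_pair: (c2 _ tT)].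
have cv t : 0 <= t <= T -> cts v t.
  move=> tT; apply: ctsM; last exact: (is_derive_cts (is_derive_expW _ _)).
  by apply: ctsD; apply: ctsM; (exact: cx || exact: cy).
pose a t := (d1 t).1 - (d2 t).1; pose b t := (d1 t).2 - (d2 t).2.
have dv t : 0 < t < T -> is_derive t (1 : R) v
   (u t * (- (4 * L) * expR (- (4 * L) * t))
    + expR (- (4 * L) * t) * ((x t * a t + x t * a t) + (y t * b t + y t * b t))).
  move=> tT; apply: is_deriveM_fun; last exact: is_derive_expW.
  have dx : is_derive t (1 : R) x (a t).
    by apply: is_deriveB_fun; [case/is_derive_pair: (D1 _ tT)|case/is_derive_pair: (D2 _ tT)].
  have dy : is_derive t (1 : R) y (b t).
    by apply: is_deriveB_fun; [case/is_derive_pair: (D1 _ tT)|case/is_derive_pair: (D2 _ tT)].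
  by apply: is_deriveD_fun; apply: is_deriveM_fun.
have sq t := norm_sqr_bounds (k1 t - k2 t).
have neg t : 0 < t < T -> u t * (- (4 * L) * expR (- (4 * L) * t))
    + expR (- (4 * L) * t) * ((x t * a t + x t * a t) + (y t * b t + y t * b t)) <= 0.
  move=> tT.
  have -> : u t * (- (4 * L) * expR (- (4 * L) * t))
    + expR (- (4 * L) * t) * ((x t * a t + x t * a t) + (y t * b t + y t * b t))
    = expR (- (4 * L) * t) * (2 * (x t * a t + y t * b t) - 4 * L * u t) by ring.
  rewrite pmulr_rle0 ?expR_gt0// subr_le0.
  apply: (@energy_rate _ _ _ _ L `|k1 t - k2 t|) => //.
  - by apply: le_trans (lip t tT); exact: (norm_ge (_ - _)).1.
  - by apply: le_trans (lip t tT); exact: (norm_ge (_ - _)).2.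
  - exact: (norm_ge (k1 t - k2 t)).1.
  - exact: (norm_ge (k1 t - k2 t)).2.
  - exact: (sq t).1.
have := mvt_le T0 cv dv neg.
rewrite mul0r subr_le0 /v mulr0 expR0 mulr1.
have -> : expR (- (4 * L) * T) = (expR (2 * L * T) ^+ 2)^-1.
  by rewrite expr2 -expRD -expRN; congr expR; ring.
rewrite ler_pdivrMr ?exprn_gt0 ?expR_gt0// => h.
have E0 := expR_gt0 (2 * L * T).
have R0 : 0 <= 2 * expR (2 * L * T) * `|k1 0 - k2 0|.
  by apply: mulr_ge0 => //; apply: mulr_ge0 => //; exact: ltW.
rewrite -(ler_pXn2r (n := 2)) ?nnegrE//.
apply: le_trans (sq T).1 _; apply: le_trans h _.
have h2 := (sq 0).2.
have E2 : 0 < expR (2 * L * T) ^+ 2 by rewrite exprn_gt0.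
apply: le_trans (_ : 2 * `|k1 0 - k2 0| ^+ 2 * expR (2 * L * T) ^+ 2 <= _).
  by rewrite ler_pM2r.
have -> : (2 * expR (2 * L * T) * `|k1 0 - k2 0|) ^+ 2 =
   4 * `|k1 0 - k2 0| ^+ 2 * expR (2 * L * T) ^+ 2 by ring.
rewrite ler_pM2r// ler_wpM2r ?sqr_ge0//; lra.
Qed.

End Gronwall.

(** * Polynomials as maps with locally uniform second-order control *)

Section Smooth.
Context {R : realType}.
Implicit Types (f g p q : R * R -> R).

Definition loclip f := forall r : R, exists2 C : R, 0 < C &
  forall z w : R * R, `|z| <= r -> `|w| <= r ->
    `|f z| <= C /\ `|f w - f z| <= C * `|w - z|.

(** The quadratic remainder, uniform on boxes, is all that is later needed of the partial
    derivatives [px] and [py]. In this form the property is stable under sums and products, hence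
    reaches all polynomials. *)
Definition taylor p px py := [/\ loclip p, loclip px, loclip py &
  forall r : R, exists2 C : R, 0 < C &
    forall z w : R * R, `|z| <= r -> `|w| <= r ->
    `|p w - p z - (px z * (w.1 - z.1) + py z * (w.2 - z.2))| <= C * `|w - z| ^+ 2].

Lemma loclip_cst (c : R) : loclip (fun=> c).
Proof.
move=> r; exists (`|c| + 1) => [|z w _ _]; first by rewrite ltr_wpDl.
split; first by rewrite lerDl.
by rewrite subrr normr0; apply: mulr_ge0 => //; exact: addr_ge0.
Qed.

Lemma loclip_fst : loclip fst.
Proof.
move=> r; exists (`|r| + 1) => [|z w zr _]; first by rewrite ltr_wpDl.
split; first by apply: le_trans (norm_ge z).1 _; have := ler_norm r; lra.
apply: le_trans (norm_ge (w - z)).1 _; rewrite ler_peMl// lerDr.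
exact: normr_ge0.
Qed.

Lemma loclip_snd : loclip snd.
Proof.
move=> r; exists (`|r| + 1) => [|z w zr _]; first by rewrite ltr_wpDl.
split; first by apply: le_trans (norm_ge z).2 _; have := ler_norm r; lra.
apply: le_trans (norm_ge (w - z)).2 _; rewrite ler_peMl// lerDr.
exact: normr_ge0.
Qed.

Lemma loclipD f g : loclip f -> loclip g -> loclip (fun z => f z + g z).
Proof.
move=> Hf Hg r; have [C C0 HC] := Hf r; have [D D0 HD] := Hg r.
exists (C + D) => [|z w zr wr]; first exact: addr_gt0.
have [h1 h2] := HC z w zr wr; have [h3 h4] := HD z w zr wr; split.
  by apply: le_trans (ler_normD _ _) _; exact: lerD.
have -> : f w + g w - (f z + g z) = (f w - f z) + (g w - g z) by ring.
by apply: le_trans (ler_normD _ _) _; rewrite mulrDl; exact: lerD.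
Qed.

Lemma loclipM f g : loclip f -> loclip g -> loclip (fun z => f z * g z).
Proof.
move=> Hf Hg r; have [C C0 HC] := Hf r; have [D D0 HD] := Hg r.
exists (2 * C * D) => [|z w zr wr]; first by rewrite !mulr_gt0.
have [h1 h2] := HC z w zr wr; have [h3 h4] := HD z w zr wr.
have [h5 _] := HC w w wr wr; split.
  rewrite normrM; apply: le_trans (ler_pM _ _ h1 h3) _ => //.
  by rewrite -mulrA ler_peMl ?mulr_ge0 ?ltW// ltr1n.
have -> : f w * g w - f z * g z = f w * (g w - g z) + g z * (f w - f z) by ring.
apply: le_trans (ler_normD _ _) _; rewrite !normrM.
have -> : 2 * C * D * `|w - z| = C * (D * `|w - z|) + D * (C * `|w - z|) by ring.
by apply: lerD; apply: ler_pM.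
Qed.

Lemma taylor_cst (c : R) : taylor (fun=> c) (fun=> 0) (fun=> 0).
Proof.
split; [exact: loclip_cst..|] => r; exists 1 => // z w _ _.
by rewrite subrr !mul0r addr0 subr0 normr0 mul1r sqr_ge0.
Qed.

Lemma taylor_fst : taylor fst (fun=> 1) (fun=> 0).
Proof.
split; [exact: loclip_fst|exact: loclip_cst|exact: loclip_cst|] => r.
exists 1 => // z w _ _.
by rewrite mul0r addr0 mul1r subrr normr0 mul1r sqr_ge0.
Qed.

Lemma taylor_snd : taylor snd (fun=> 0) (fun=> 1).
Proof.
split; [exact: loclip_snd|exact: loclip_cst|exact: loclip_cst|] => r.
exists 1 => // z w _ _.
by rewrite mul0r add0r mul1r subrr normr0 mul1r sqr_ge0.
Qed.

Lemma taylorD p px py q qx qy : taylor p px py -> taylor q qx qy ->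
  taylor (fun z => p z + q z) (fun z => px z + qx z) (fun z => py z + qy z).
Proof.
move=> [p1 p2 p3 Hp] [q1 q2 q3 Hq]; split; [exact: loclipD..|] => r.
have [C C0 HC] := Hp r; have [D D0 HD] := Hq r.
exists (C + D) => [|z w zr wr]; first exact: addr_gt0.
have h1 := HC z w zr wr; have h2 := HD z w zr wr.
have -> : p w + q w - (p z + q z) - ((px z + qx z) * (w.1 - z.1) + (py z + qy z) * (w.2 - z.2))
  = (p w - p z - (px z * (w.1 - z.1) + py z * (w.2 - z.2)))
    + (q w - q z - (qx z * (w.1 - z.1) + qy z * (w.2 - z.2))) by ring.
by apply: le_trans (ler_normD _ _) _; rewrite mulrDl; exact: lerD.
Qed.

Lemma taylorM p px py q qx qy : taylor p px py -> taylor q qx qy ->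
  taylor (fun z => p z * q z) (fun z => p z * qx z + q z * px z)
    (fun z => p z * qy z + q z * py z).
Proof.
move=> [p1 p2 p3 Hp] [q1 q2 q3 Hq]; split; first exact: loclipM.
- by apply: loclipD; exact: loclipM.
- by apply: loclipD; exact: loclipM.
move=> r.
have [C C0 HC] := Hp r; have [D D0 HD] := Hq r.
have [A A0 HA] := p1 r; have [B B0 HB] := q1 r.
exists (A * D + B * C + A * B) => [|z w zr wr].
  by rewrite !addr_gt0 ?mulr_gt0.
have h1 := HC z w zr wr; have h2 := HD z w zr wr.
have [h3 h4] := HA z w zr wr; have [h5 h6] := HB z w zr wr.
have -> : p w * q w - p z * q z
    - ((p z * qx z + q z * px z) * (w.1 - z.1) + (p z * qy z + q z * py z) * (w.2 - z.2))
  = p z * (q w - q z - (qx z * (w.1 - z.1) + qy z * (w.2 - z.2)))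
    + q z * (p w - p z - (px z * (w.1 - z.1) + py z * (w.2 - z.2)))
    + (p w - p z) * (q w - q z) by ring.
apply: le_trans (ler_normD _ _) _; apply: le_trans (lerD (ler_normD _ _) (lexx _)) _.
rewrite !normrM !mulrDl -!mulrA; apply: lerD; last first.
  have -> : A * (B * `|w - z| ^+ 2) = (A * `|w - z|) * (B * `|w - z|) by ring.
  exact: ler_pM.
by apply: lerD; apply: ler_pM.
Qed.

Lemma eval2_taylor (p : mpoly 2 R) : exists px py, taylor (eval2 p) px py.
Proof.
have ext (f g : R * R -> R) : f =1 g -> (exists px py, taylor f px py) ->
  exists px py, taylor g px py by move=> /funext ->.
elim/mpolyind: p => [|c m p _ _ IH].
  apply: (ext (fun=> 0)); first by move=> z; rewrite /eval2 meval0.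
  by exists (fun=> 0), (fun=> 0); exact: taylor_cst.
have pw (f fx fy : R * R -> R) k : taylor f fx fy ->
    exists px py, taylor (fun z => f z ^+ k) px py.
  move=> Hf; elim: k => [|k [px [py IHk]]].
    apply: (ext (fun=> 1)); first by move=> z; rewrite expr0.
    by exists (fun=> 0), (fun=> 0); exact: taylor_cst.
  apply: (ext (fun z => f z * f z ^+ k)); first by move=> z; rewrite exprS.
  by do 2 eexists; exact: taylorM Hf IHk.
have [ax [ay Ha]] := pw _ _ _ (m ord0) taylor_fst.
have [bx [by_ Hb]] := pw _ _ _ (m (lift ord0 ord0)) taylor_snd.
have [qx [qy Hq]] := IH.
apply: (ext (fun z => c * (z.1 ^+ m ord0 * z.2 ^+ m (lift ord0 ord0)) + eval2 p z)).
  move=> z; rewrite /eval2 mevalD mevalZ mevalX !big_ord_recl big_ord0 mulr1.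
  by [].
by do 2 eexists; exact: taylorD (taylorM (taylor_cst c) (taylorM Ha Hb)) Hq.
Qed.

End Smooth.

(** * Smooth planar fields and their truncated flows *)

Section Fields.
Context {R : realType}.

Definition smooth_field (X : R * R -> R * R) := exists Px Py Qx Qy,
  taylor (fun z => (X z).1) Px Py /\ taylor (fun z => (X z).2) Qx Qy.

Lemma smooth_bound X : smooth_field X -> forall r : R, exists2 C : R, 0 < C &
  forall z w : R * R, `|z| <= r -> `|w| <= r ->
    `|X z| <= C /\ `|X w - X z| <= C * `|w - z|.
Proof.
move=> [Px [Py [Qx [Qy [[HP _ _ _] [HQ _ _ _]]]]]] r.
have [A A0 HA] := HP r; have [B B0 HB] := HQ r.
exists (A + B) => [|z w zr wr]; first exact: addr_gt0.
have [h1 h2] := HA z w zr wr; have [h3 h4] := HB z w zr wr.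
split; apply: norm_le_pair => /=.
- by apply: le_trans h1 _; rewrite lerDl ltW.
- by apply: le_trans h3 _; rewrite lerDr ltW.
- by apply: le_trans h2 _; rewrite ler_wpM2r// lerDl ltW.
- by apply: le_trans h4 _; rewrite ler_wpM2r// lerDr ltW.
Qed.

Definition clamp1 (r x : R) : R := Num.max (- r) (Num.min r x).
Definition clamp (r : R) (z : R * R) : R * R := (clamp1 r z.1, clamp1 r z.2).

Lemma clamp1_id r x : `|x| <= r -> clamp1 r x = x.
Proof.
rewrite ler_norml => /andP[h1 h2]; rewrite /clamp1 (min_idPr h2).
exact: max_idPr.
Qed.

Lemma clamp_id r z : `|z| <= r -> clamp r z = z.
Proof.
move=> zr; have [h1 h2] := norm_ge z; case: z zr h1 h2 => a b zr /= h1 h2.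
by rewrite /clamp !clamp1_id//; [exact: le_trans h2 zr|exact: le_trans h1 zr].
Qed.

Lemma clamp1_norm r x : 0 <= r -> `|clamp1 r x| <= r.
Proof.
move=> r0; rewrite /clamp1 ler_norml le_max lexx /= ge_max ge_min lexx /= andbT.
lra.
Qed.

Lemma clamp_norm r z : 0 <= r -> `|clamp r z| <= r.
Proof. by move=> r0; apply: norm_le_pair; exact: clamp1_norm. Qed.

Lemma max_lip (a x y : R) : `|Num.max a x - Num.max a y| <= `|x - y|.
Proof.
rewrite /Order.max; have k1 := ler_norm (x - y); have k2 := ler_norm (y - x).
rewrite distrC in k2.
by rewrite ler_norml; case: (ltP a x) => ?; case: (ltP a y) => ?; apply/andP; split; lra.
Qed.

Lemma min_lip (a x y : R) : `|Num.min a x - Num.min a y| <= `|x - y|.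
Proof.
rewrite /Order.min; have k1 := ler_norm (x - y); have k2 := ler_norm (y - x).
rewrite distrC in k2.
by rewrite ler_norml; case: (ltP a x) => ?; case: (ltP a y) => ?; apply/andP; split; lra.
Qed.

Lemma clamp1_lip r x y : `|clamp1 r x - clamp1 r y| <= `|x - y|.
Proof. exact: le_trans (max_lip _ _ _) (min_lip _ _ _). Qed.

Lemma clamp_lip r z w : `|clamp r z - clamp r w| <= `|z - w|.
Proof.
apply: norm_le_pair; apply: le_trans (clamp1_lip _ _ _) _.
  exact: (norm_ge (z - w)).1.
exact: (norm_ge (z - w)).2.
Qed.

(* The flow of the field that coincides with X on the box of radius r, which is
   globally Lipschitz and hence complete. *)
Definition box_flow (X : R * R -> R * R) (r : R) (phi : R * R -> R -> R * R) :=
  forall z, phi z 0 = z /\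
    forall t : R, is_derive t (1 : R) (phi z) (X (clamp r (phi z t))).

Lemma box_flow_exists X r : smooth_field X -> 0 <= r ->
  exists phi, box_flow X r phi.
Proof.
move=> HX r0; have [C C0 HC] := smooth_bound HX r.
have := @flow_exists R (fun z => X (clamp r z)) C C C0.
case/(_ _ _)/choice.
- by move=> z; exact: (HC _ _ (clamp_norm z r0) (clamp_norm z r0)).1.
- move=> z w; apply: le_trans (HC _ _ (clamp_norm w r0) (clamp_norm z r0)).2 _.
  by rewrite ler_pM2l//; exact: clamp_lip.
by move=> phi Hphi; exists phi.
Qed.

Definition solves (X : R * R -> R * R) (k : R -> R * R) (a b : R) :=
  forall t : R, a < t < b -> is_derive t (1 : R) k (X (k t)).

Lemma solves_unique X k1 k2 (T : R) : smooth_field X -> 0 <= T ->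
  (forall t, 0 <= t <= T -> cts k1 t) -> (forall t, 0 <= t <= T -> cts k2 t) ->
  solves X k1 0 T -> solves X k2 0 T -> k1 0 = k2 0 -> k1 T = k2 T.
Proof.
move=> HX T0 c1 c2 D1 D2 k0.
have [M1 _ HM1] := cts_bounded c1; have [M2 _ HM2] := cts_bounded c2.
have [C C0 HC] := smooth_bound HX (Num.max M1 M2).
have := gronwall T0 C0 c1 c2 D1 D2.
rewrite k0 subrr normr0 mulr0 normr_le0 subr_eq0 => H; apply/eqP; apply: H.
move=> t /andP[t0 tT]; have tT' : 0 <= t <= T by rewrite !ltW.
by apply: (HC _ _ _ _).2; rewrite le_max ?HM1 ?HM2 ?orbT.
Qed.

Lemma box_flow_cts X r phi z t : box_flow X r phi -> cts (phi z) t.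
Proof. by move=> /(_ z)[_ D]; exact: is_derive_cts (D t). Qed.

Lemma box_flow_dist X r phi : smooth_field X -> 0 <= r -> box_flow X r phi ->
  forall T : R, 0 <= T -> exists2 K : R, 0 < K & forall z w t, 0 <= t <= T ->
    `|phi z t - phi w t| <= K * `|z - w|.
Proof.
move=> HX r0 Hphi T T0; have [C C0 HC] := smooth_bound HX r.
exists (2 * expR (2 * C * T)) => [|z w t /andP[t0 tT]].
  by rewrite mulr_gt0// expR_gt0.
have h : `|phi z t - phi w t| <= 2 * expR (2 * C * t) * `|phi z 0 - phi w 0|.
  apply: (gronwall t0 C0 (fun s _ => box_flow_cts z s Hphi)
    (fun s _ => box_flow_cts w s Hphi) (fun s _ => (Hphi z).2 s)
    (fun s _ => (Hphi w).2 s)) => s _.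
  apply: le_trans (HC _ _ (clamp_norm _ r0) (clamp_norm _ r0)).2 _.
  by rewrite ler_pM2l//; exact: clamp_lip.
apply: le_trans h _; rewrite (Hphi z).1 (Hphi w).1 ler_wpM2r//.
by rewrite ler_pM2l// ler_expR ler_wpM2l// mulr_ge0// ltW.
Qed.

Lemma box_flow_time X r phi : smooth_field X -> 0 <= r -> box_flow X r phi ->
  exists2 M : R, 0 < M & forall z t s, `|phi z t - phi z s| <= M * `|t - s|.
Proof.
move=> HX r0 Hphi; have [C C0 HC] := smooth_bound HX r.
exists C => // z t s.
have D x := (is_derive_pair _ _ _).1 ((Hphi z).2 x).
have e : t = s + (t - s) by rewrite subrKC.
have B x : `|X (clamp r (phi z x))| <= C.
  exact: (HC _ _ (clamp_norm _ r0) (clamp_norm _ r0)).1.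
apply: norm_le_pair => /=; rewrite {1}e.
  have := @mvt_abs R (fun s => (phi z s).1) (fun s => (X (clamp r (phi z s))).1) s (t - s) 0 C.
  rewrite mulr0 subr0; apply; first by move=> x _; exact: (D x).1.
  by move=> x _; rewrite subr0; apply: le_trans (norm_ge _).1 (B x).
have := @mvt_abs R (fun s => (phi z s).2) (fun s => (X (clamp r (phi z s))).2) s (t - s) 0 C.
rewrite mulr0 subr0; apply; first by move=> x _; exact: (D x).2.
by move=> x _; rewrite subr0; apply: le_trans (norm_ge _).2 (B x).
Qed.

(** One of the two curves staying in the box is enough: if k does, it also solves the truncated
    field; if the truncated flow does, it also solves [X]. *)
Lemma box_flow_unique X r phi k (T : R) : smooth_field X -> 0 <= r ->
  box_flow X r phi -> (forall t, 0 <= t <= T -> cts k t) -> solves X k 0 T ->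
  (forall t, 0 <= t <= T -> `|k t| <= r) \/
  (forall t, 0 <= t <= T -> `|phi (k 0) t| <= r) ->
  forall t, 0 <= t <= T -> k t = phi (k 0) t.
Proof.
move=> HX r0 Hphi kc ks kr t /andP[t0 tT].
have [C C0 HC] := smooth_bound HX r.
have sub s : 0 <= s <= t -> 0 <= s <= T.
  by move=> /andP[-> st]; exact: le_trans st tT.
have sub' s : 0 < s < t -> 0 < s < T.
  by move=> /andP[-> st]; exact: lt_le_trans st tT.
case: kr => kr.
  have := gronwall t0 C0 (fun s hs => kc s (sub s hs))
    (fun s _ => box_flow_cts (k 0) s Hphi) (fun s hs => ks s (sub' s hs))
    (fun s _ => (Hphi (k 0)).2 s).
  rewrite (Hphi (k 0)).1 subrr normr0 mulr0 normr_le0 subr_eq0 => H; apply/eqP; apply: H.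
  move=> s /andP[s0 st]; have sT : 0 <= s <= T by rewrite ltW//= (le_trans (ltW st)).
  rewrite -{1}(clamp_id (kr s sT)).
  apply: le_trans (HC _ _ (clamp_norm _ r0) (clamp_norm _ r0)).2 _.
  by rewrite ler_pM2l//; exact: clamp_lip.
apply: (solves_unique HX t0 (fun s hs => kc s (sub s hs))
    (fun s _ => box_flow_cts (k 0) s Hphi) (fun s hs => ks s (sub' s hs))).
  move=> s /sub' /andP[s0 sT]; rewrite -[in X (phi _ _)](@clamp_id r (phi (k 0) s)).
    exact: (Hphi (k 0)).2.
  by apply: kr; rewrite !ltW.
by rewrite (Hphi (k 0)).1.
Qed.

Lemma taylor_chain p px py (g : R -> R * R) (t : R) (v : R * R) :
  taylor p px py -> is_derive t (1 : R) g v ->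
  is_derive t (1 : R) (fun s => p (g s)) (px (g t) * v.1 + py (g t) * v.2).
Proof.
move=> [_ _ _ Hp] gv; have gc := is_derive_cts gv.
move: gv => /is_deriveP gd; apply/is_deriveP => e e0.
have [C C0 HC] := Hp (`|g t| + 1).
set A := `|px (g t)| + `|py (g t)| + 1.
have A0 : 0 < A by rewrite /A ltr_wpDl// addr_ge0.
set B := `|v| + 1.
have B0 : 0 < B by rewrite /B ltr_wpDl.
have [d1 d10 Hd1] := gc _ ltr01.
have [d2 d20 Hd2] := gd _ ltr01.
have [d3 d30 Hd3] := gd _ (divr_gt0 e0 (mulr_gt0 (ltr0Sn R 1) A0)).
have e4 : 0 < e / (2 * C * B ^+ 2) by rewrite divr_gt0// !mulr_gt0// exprn_gt0.
exists (Num.min (Num.min d1 d2) (Num.min d3 (e / (2 * C * B ^+ 2)))) => [|h].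
  by rewrite !lt_min d10 d20 d30 e4.
rewrite !lt_min -!andbA => /and4P[h1 h2 h3 h4].
set w := g (t + h); set z := g t.
have wz1 : `|w - z| < 1 by apply: Hd1; rewrite addrAC subrr add0r.
have wzh : `|w - z| <= B * `|h|.
  have -> : w - z = (w - z - h *: v) + h *: v by rewrite subrK.
  apply: le_trans (ler_normD _ _) _; rewrite normrZ.
  have := Hd2 h h2; rewrite -/w -/z /B => k; lra.
have lin : `|px z * (w.1 - z.1 - h * v.1) + py z * (w.2 - z.2 - h * v.2)| <= A * `|w - z - h *: v|.
  exact: (norm_lin (px z) (py z) (w - z - h *: v)).
have quad := HC z w _ _.
have zr : `|z| <= `|g t| + 1 by rewrite lerDl.
have wr : `|w| <= `|g t| + 1.
  have -> : w = z + (w - z) by rewrite subrKC.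
  by apply: le_trans (ler_normD _ _) _; rewrite lerD2l ltW.
rewrite [h *: (_ + _)]/(h * _).
have -> : p w - p z - h * (px z * v.1 + py z * v.2) =
  (p w - p z - (px z * (w.1 - z.1) + py z * (w.2 - z.2)))
  + (px z * (w.1 - z.1 - h * v.1) + py z * (w.2 - z.2 - h * v.2)) by ring.
apply: le_trans (ler_normD _ _) _.
have -> : e * `|h| = e / 2 * `|h| + e / 2 * `|h| by field.
apply: lerD.
  apply: le_trans (quad zr wr) _.
  apply: (@le_trans _ _ (C * ((B * `|h|) * (B * `|h|)))).
    by rewrite ler_pM2l// expr2 ler_pM.
  have -> : C * ((B * `|h|) * (B * `|h|)) = (C * B ^+ 2 * `|h|) * `|h| by ring.
  rewrite ler_wpM2r//; move: h4; rewrite ltr_pdivlMr ?mulr_gt0 ?exprn_gt0//.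
  by move=> /ltW; rewrite (_ : `|h| * _ = 2 * (C * B ^+ 2 * `|h|)); [lra|ring].
apply: le_trans lin _; apply: (le_trans (ler_wpM2l (ltW A0) (Hd3 h h3))).
by rewrite le_eqVlt; apply/orP; left; apply/eqP; field; rewrite gt_eqF.
Qed.

End Fields.

(** * Liouville's formula and transversal crossings *)

Section Wronskian.
Context {R : realType}.

Lemma mvt_norm (f df : R -> R) (a b c : R) : a <= b ->
  (forall t, a <= t <= b -> cts f t) ->
  (forall t, a < t < b -> is_derive t 1 f (df t)) ->
  (forall t, a < t < b -> `|df t| <= c) -> `|f b - f a| <= c * (b - a).
Proof.
move=> ab fc fd fl.
have l1 t : a < t < b -> - c <= df t by move=> /fl; rewrite ler_norml => /andP[].
have l2 t : a < t < b -> df t <= c by move=> /fl; rewrite ler_norml => /andP[].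
have h1 := mvt_ge ab fc fd l1; have h2 := mvt_le ab fc fd l2.
by rewrite ler_norml -mulNr h1 h2.
Qed.

Lemma is_derive_expN (f : R -> R) (t a : R) : is_derive t 1 f a ->
  is_derive t 1 (fun s => expR (- f s)) (- a * expR (- f t)).
Proof.
move=> fa; have H : is_derive t 1 (fun s => - f s) (- a) := is_deriveN fa.
by have := @is_derive1_comp R expR (fun s => - f s) t _ _ (is_derive_expR (- f t)) H; rewrite mulrC.
Qed.

Lemma loclip_clamp_cts (f : R * R -> R) (r : R) (g : R -> R * R) (t : R) :
  loclip f -> 0 <= r -> cts g t -> cts (fun s => f (clamp r (g s))) t.
Proof.
move=> Hf r0 gc e e0; have [C C0 HC] := Hf r.
have [d d0 Hd] := gc _ (divr_gt0 e0 C0).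
exists d => // s /Hd; rewrite ltr_pdivlMr// mulrC; apply: le_lt_trans.
apply: le_trans (HC _ _ (clamp_norm _ r0) (clamp_norm _ r0)).2 _.
by rewrite ler_pM2l//; exact: clamp_lip.
Qed.

(** The linear terms recombine into the trace of the Jacobian times the wedge; what is left are the
    Taylor remainders of the two components of the field. *)
Let wedge_rate (P Q P2 Q2 Px Py Qx Qy d1 d2 : R) :
  P * (Q2 - Q) + d2 * (Px * P + Py * Q) - (Q * (P2 - P) + d1 * (Qx * P + Qy * Q))
  = (Px + Qy) * (P * d2 - Q * d1)
    + (P * (Q2 - Q - (Qx * d1 + Qy * d2)) - Q * (P2 - P - (Px * d1 + Py * d2))).
Proof. ring. Qed.

Definition wedge (u v : R * R) := u.1 * v.2 - u.2 * v.1.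

(* Liouville's formula: the area of (X, z2 - z1) along z1 grows at the rate
   given by the divergence of X, up to a quadratic error. *)
Lemma wronskian X (r Tm : R) : smooth_field X -> 0 <= r -> 0 <= Tm ->
  exists2 C : R, 0 < C & forall (z1 : R -> R * R) (T : R), 0 <= T <= Tm ->
    (forall t, cts z1 t) ->
    (forall t : R, 0 <= t <= T -> `|z1 t| <= r /\ is_derive t (1 : R) z1 (X (z1 t))) ->
    exists E : R, [/\ 0 < E, E <= C, E^-1 <= C &
      forall (z2 : R -> R * R) (k : R),
      (forall t : R, 0 <= t <= T -> [/\ `|z2 t| <= r, `|z2 t - z1 t| <= k &
         is_derive t (1 : R) z2 (X (z2 t))]) ->
      `|wedge (X (z1 T)) (z2 T - z1 T) * E - wedge (X (z1 0)) (z2 0 - z1 0)|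
        <= C * k ^+ 2].
Proof.
move=> [Px [Py [Qx [Qy [HP HQ]]]]] r0 Tm0.
have [[lP lPx lPy tP] [lQ lQx lQy tQ]] := (HP, HQ).
have [A A0 HA] := lP r; have [B B0 HB] := lQ r.
have [D D0 HD] := loclipD lPx lQy r.
have [K K0 HK] := tP r; have [N N0 HN] := tQ r.
pose e0 := expR (D * Tm); have e0p : 0 < e0 by exact: expR_gt0.
have AN : 0 < A * N + B * K by rewrite addr_gt0// mulr_gt0.
exists (e0 + (A * N + B * K) * e0 * Tm) => [|z1 T /andP[T0 TTm] z1c Hz1].
  by rewrite ltr_wpDr// !mulr_ge0// ltW.
(* [I] integrates the divergence along z1. Clamping keeps the integrand bounded by [D] at all times
   and changes nothing while z1 is in the box. The factor [E] will be [expR (- I T)]. *)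
have [I [I0 dI]] := primitive (fun t => loclip_clamp_cts (loclipD lPx lQy) r0 (z1c t)).
have dIt t : 0 <= t <= T -> is_derive t (1 : R) I (Px (z1 t) + Qy (z1 t)).
  by move=> tT; have := dI t; rewrite clamp_id ?(Hz1 t tT).1.
have It t : 0 <= t <= T -> `|I t| <= D * Tm.
  move=> tT; have /andP[t0 tT'] := tT.
  have : `|I t - I 0| <= D * (t - 0).
    apply: (mvt_norm t0 (fun s _ => is_derive_cts (dI s)) (fun s _ => dI s)) => s _.
    exact: (HD _ _ (clamp_norm _ r0) (clamp_norm _ r0)).1.
  rewrite I0 !subr0 => /le_trans; apply; rewrite ler_pM2l//; exact: le_trans TTm.
have Ee t : 0 <= t <= T -> expR (- I t) <= e0 /\ (expR (- I t))^-1 <= e0.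
  move=> tT; have := It t tT; rewrite ler_norml => /andP[h1 h2].
  by rewrite -expRN opprK !ler_expR; split; lra.
have TT : 0 <= T <= T by rewrite T0 lexx.
have Q0 : 0 <= (A * N + B * K) * e0 * Tm by rewrite !mulr_ge0// ltW.
exists (expR (- I T)); split; first exact: expR_gt0.
- by apply: le_trans (Ee T TT).1 _; rewrite lerDl.
- by apply: le_trans (Ee T TT).2 _; rewrite lerDl.
move=> z2 k Hz2.
pose P t := (X (z1 t)).1; pose Q t := (X (z1 t)).2.
pose d1 t := (z2 t).1 - (z1 t).1; pose d2 t := (z2 t).2 - (z1 t).2.
pose w t := P t * d2 t - Q t * d1 t.
pose rho t := P t * ((X (z2 t)).2 - Q t - (Qx (z1 t) * d1 t + Qy (z1 t) * d2 t))
   - Q t * ((X (z2 t)).1 - P t - (Px (z1 t) * d1 t + Py (z1 t) * d2 t)).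
have dP t : 0 <= t <= T ->
    is_derive t (1 : R) P (Px (z1 t) * P t + Py (z1 t) * Q t).
  by move=> tT; exact: taylor_chain HP (Hz1 t tT).2.
have dQ t : 0 <= t <= T ->
    is_derive t (1 : R) Q (Qx (z1 t) * P t + Qy (z1 t) * Q t).
  by move=> tT; exact: taylor_chain HQ (Hz1 t tT).2.
have dd1 t : 0 <= t <= T -> is_derive t (1 : R) d1 ((X (z2 t)).1 - P t).
  move=> tT; apply: is_deriveB_fun; have [_ _] := Hz2 t tT => /is_derive_pair[] //.
  by move=> _ _; case/is_derive_pair: (Hz1 t tT).2.
have dd2 t : 0 <= t <= T -> is_derive t (1 : R) d2 ((X (z2 t)).2 - Q t).
  move=> tT; apply: is_deriveB_fun; have [_ _] := Hz2 t tT => /is_derive_pair[] //.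
  by move=> _ _; case/is_derive_pair: (Hz1 t tT).2.
have dw t : 0 <= t <= T ->
    is_derive t (1 : R) w ((Px (z1 t) + Qy (z1 t)) * w t + rho t).
  move=> tT; rewrite /w /rho -wedge_rate; apply: is_deriveB_fun.
    exact: is_deriveM_fun (dP t tT) (dd2 t tT).
  exact: is_deriveM_fun (dQ t tT) (dd1 t tT).
have dv t : 0 <= t <= T ->
    is_derive t (1 : R) (fun s => w s * expR (- I s)) (rho t * expR (- I t)).
  move=> tT; have -> : rho t * expR (- I t) =
    w t * (- (Px (z1 t) + Qy (z1 t)) * expR (- I t))
    + expR (- I t) * ((Px (z1 t) + Qy (z1 t)) * w t + rho t) by ring.
  by apply: is_deriveM_fun (dw t tT) (is_derive_expN (dIt t tT)).
have rho_le t : 0 <= t <= T -> `|rho t * expR (- I t)| <= (A * N + B * K) * k ^+ 2 * e0.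
  move=> tT; have [zr2 dk _] := Hz2 t tT; have [zr1 _] := Hz1 t tT.
  rewrite normrM (ger0_norm (ltW (expR_gt0 _))).
  apply: ler_pM => //; [|exact: (Ee t tT).1].
  apply: le_trans (ler_normB _ _) _; rewrite !normrM.
  have kk : `|z2 t - z1 t| ^+ 2 <= k ^+ 2.
    by rewrite ler_pXn2r// nnegrE//; exact: le_trans dk.
  have -> : (A * N + B * K) * k ^+ 2 = A * (N * k ^+ 2) + B * (K * k ^+ 2) by ring.
  apply: lerD; apply: ler_pM => //.
  - exact: (HA _ _ zr1 zr2).1.
  - by apply: le_trans (HN _ _ zr1 zr2) _; rewrite ler_pM2l.
  - exact: (HB _ _ zr1 zr2).1.
  - by apply: le_trans (HK _ _ zr1 zr2) _; rewrite ler_pM2l.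
have sub t : 0 < t < T -> 0 <= t <= T by move=> /andP[/ltW -> /ltW ->].
have := mvt_norm T0 (fun s hs => is_derive_cts (dv s hs)) (fun s hs => dv s (sub s hs))
   (fun s hs => rho_le s (sub s hs)).
rewrite I0 oppr0 expR0 mulr1 addr0 => h; apply: le_trans h _.
have -> : (A * N + B * K) * k ^+ 2 * e0 * T = ((A * N + B * K) * e0 * T) * k ^+ 2 by ring.
rewrite ler_wpM2r ?sqr_ge0//.
apply: (@le_trans _ _ ((A * N + B * K) * e0 * Tm)).
  by rewrite ler_wpM2l// mulr_ge0// ltW.
by rewrite lerDr ltW.
Qed.

Lemma crossing_time (x dx : R -> R) (a b c : R) : a <= b -> 0 < c ->
  (forall t, a <= t <= b -> is_derive t 1 x (dx t)) ->
  (forall t, a <= t <= b -> dx t <= - c) -> 0 < x a -> x b < 0 ->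
  exists T : R, [/\ a < T < b, x T = 0,
    forall t, a <= t <= T -> c * (T - t) <= x t &
    forall t, T <= t <= b -> x t <= - c * (t - T)].
Proof.
move=> ab c0 dX dl xa xb.
have xc t : a <= t <= b -> cts x t by move=> /dX; exact: is_derive_cts.
have [|T /andP[aT Tb] xT] := cts_IVT ab xc; first by right; rewrite !ltW.
exists T; split => //.
- rewrite !lt_neqAle aT Tb !andbT; apply/andP; split; apply/eqP => E.
    by move: xa; rewrite E xT ltxx.
  by move: xb; rewrite -E xT ltxx.
- move=> t /andP[t1 t2]; have i s : t <= s <= T -> a <= s <= b.
    by move=> /andP[h1 h2]; rewrite (le_trans t1)//= (le_trans h2).
  have i' s : t < s < T -> a <= s <= b by move=> /andP[h1 h2]; apply: i; rewrite !ltW.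
  have := mvt_le t2 (fun s hs => xc s (i s hs)) (fun s hs => dX s (i' s hs))
    (fun s hs => dl s (i' s hs)).
  by rewrite xT; lra.
move=> t /andP[t1 t2]; have i s : T <= s <= t -> a <= s <= b.
  by move=> /andP[h1 h2]; rewrite (le_trans aT)//= (le_trans h2).
have i' s : T < s < t -> a <= s <= b by move=> /andP[h1 h2]; apply: i; rewrite !ltW.
have := mvt_le t1 (fun s hs => xc s (i s hs)) (fun s hs => dX s (i' s hs))
  (fun s hs => dl s (i' s hs)).
by rewrite xT; lra.
Qed.

End Wronskian.

(** * Arcs on one side of the discontinuity line *)

Section HalfMap.
Context {R : realType}.
Implicit Types (X : R * R -> R * R) (s : R).

(** The sign [s] lets both half-planes be treated alike. Derivatives at the two end times are
    two-sided: [h] passes through the line with the velocity of the smooth field [X], whereas a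
    Filippov trajectory switches fields there. *)
Definition arc X s (u v T : R) (h : R -> R * R) :=
  [/\ 0 < T, h 0 = (0, u) /\ h T = (0, v),
    0 < s * (X (0, u)).1 /\ s * (X (0, v)).1 < 0,
    (forall t : R, 0 <= t <= T -> is_derive t (1 : R) h (X (h t))) &
    forall t, 0 < t < T -> 0 < s * (h t).1].

Lemma norm_section (u v : R) : `|(0, u) - (0, v) : R * R| = `|u - v|.
Proof. by rewrite normP /= subrr normr0; apply/max_idPr. Qed.

Lemma fst0_eq (z : R * R) : z.1 = 0 -> z = (0, z.2).
Proof. by case: z => a b /= ->. Qed.

Let unit_mul s (a b : R) : `|s| = 1 -> `|s * a - s * b| = `|a - b|.
Proof. by move=> s1; rewrite -mulrBr normrM s1 mul1r. Qed.

Let close_ge (a b e c : R) : `|a - b| <= e -> c + e <= b -> c <= a.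
Proof. by rewrite ler_norml => /andP[h1 h2] h3; lra. Qed.

Let close_le (a b e c : R) : `|a - b| <= e -> b <= c - e -> a <= c.
Proof. by rewrite ler_norml => /andP[h1 h2] h3; lra. Qed.

Let close_gt (a b e c : R) : `|a - b| <= e -> c + e < b -> c < a.
Proof. by rewrite ler_norml => /andP[h1 h2] h3; lra. Qed.

Let close_lt (a b e c : R) : `|a - b| <= e -> b < c - e -> a < c.
Proof. by rewrite ler_norml => /andP[h1 h2] h3; lra. Qed.

(** By compactness the normal velocity is bounded away from 0 within time tau of both ends, and the
    arc is bounded away from the line in between. Lipschitz dependence on the initial point carries
    these bounds to neighbours. *)
Lemma arc_tube X s u0 v0 T0 h0 : smooth_field X -> `|s| = 1 ->
  arc X s u0 v0 T0 h0 ->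
  exists r phi tau c rho, [/\ [/\ 0 <= r, box_flow X r phi, 0 < tau <= 1 /\
      tau + tau <= T0, 0 < c & 0 < rho],
    (forall t, 0 <= t <= T0 -> h0 t = phi (0, u0) t) &
    forall u, `|u - u0| <= rho -> let p := phi (0, u) in
     [/\ forall t, 0 <= t <= T0 + tau -> `|p t| <= r,
        forall t, 0 <= t <= tau -> c <= s * (X (p t)).1,
        forall t, T0 - tau <= t <= T0 + tau -> s * (X (p t)).1 <= - c,
        forall t, tau <= t <= T0 - tau -> 0 < s * (p t).1 &
        s * (p (T0 + tau)).1 < 0]].
Proof.
move=> HX s1 [T00 [h00 h0T] [su sv] hd hpos].
have hc t : 0 <= t <= T0 -> cts h0 t by move=> /hd; exact: is_derive_cts.
have [R0 R00 HR0] := cts_bounded hc.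
pose r := R0 + 1; have r0 : 0 <= r by rewrite /r addr_ge0// ltW.
have [phi Hphi] := box_flow_exists HX r0.
pose p0 := phi (0, u0).
have hp t : 0 <= t <= T0 -> h0 t = p0 t.
  rewrite /p0 -h00.
  apply: (box_flow_unique HX r0 Hphi hc (T := T0)).
    by move=> x /andP[x0 xT]; apply: hd; rewrite !ltW.
  by left => x xT; apply: le_trans (HR0 x xT) _; rewrite lerDl.
have [M M0 HM] := box_flow_time HX r0 Hphi.
have T01 : 0 <= T0 + 1 by rewrite addr_ge0// ltW.
have [K K0 HK] := box_flow_dist HX r0 Hphi T01.
have [C C0 HC] := smooth_bound HX r.
have GC z w : `|z| <= r -> `|w| <= r -> `|s * (X z).1 - s * (X w).1| <= C * `|z - w|.
  move=> zr wr; rewrite unit_mul//; apply: le_trans (HC w z wr zr).2.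
  exact: (norm_ge (X z - X w)).1.
have p00 : p0 0 = (0, u0) by case: (Hphi (0, u0)).
have p0T : p0 T0 = (0, v0) by rewrite -hp ?h0T// ltW//= lexx.
(* Of the normal speed [4 * c] at the ends, [2 * c] is left along the central orbit during time tau,
   and c along its neighbours. *)
have [c c0 [cu cv]] : exists2 c, 0 < c &
    4 * c <= s * (X (p0 0)).1 /\ s * (X (p0 T0)).1 <= - (4 * c).
  rewrite p00 p0T; exists (Num.min (s * (X (0, u0)).1) (- (s * (X (0, v0)).1)) / 4).
    by rewrite divr_gt0// lt_min su oppr_gt0.
  rewrite mulrC divfK ?pnatr_eq0//; split; first by rewrite ge_min lexx.
  by rewrite lerNr ge_min lexx orbT.
have [tau t0 [t1 t2 t3 t4]] : exists2 tau, 0 < tau &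
    [/\ tau <= 1, tau + tau <= T0, C * (M * tau) <= 2 * c & M * tau <= 1 / 2].
  exists (Num.min (Num.min 1 (T0 / 2)) (Num.min (2 * c / (C * M)) (1 / 2 / M))).
    by rewrite !lt_min ltr01 !divr_gt0 ?mulr_gt0.
  split; first by rewrite !ge_min lexx.
  - set x := Num.min _ _; have : x <= T0 / 2 by rewrite !ge_min lexx !orbT.
    by lra.
  - by rewrite mulrA mulrC -ler_pdivlMr ?mulr_gt0// !ge_min lexx !orbT.
  - by rewrite mulrC -ler_pdivlMr// !ge_min lexx !orbT.
have p0box t : 0 <= t <= T0 + tau -> `|p0 t| <= R0 + 1 / 2.
  move=> /andP[h1 h2]; have [tT|Tt] := leP t T0.
    by rewrite -hp ?h1//; apply: (le_trans (HR0 t _)); rewrite ?h1// lerDl.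
  rewrite -(subrK (p0 T0) (p0 t)); apply: le_trans (ler_normD _ _) _.
  rewrite addrC; apply: lerD; first by rewrite -hp ?(ltW T00) ?lexx// HR0// lexx ltW.
  apply: le_trans (HM _ _ _) _; apply: le_trans t4; rewrite ler_pM2l// ger0_norm; lra.
have p0r t : 0 <= t <= T0 + tau -> `|p0 t| <= r.
  by move=> /p0box /le_trans; apply; rewrite lerD2l; lra.
have G0 t : 0 <= t <= tau -> 2 * c <= s * (X (p0 t)).1.
  move=> /andP[h1 h2]; have e1 : 0 <= t <= T0 + tau by rewrite h1; lra.
  have e2 : 0 <= (0 : R) <= T0 + tau by rewrite lexx; lra.
  apply: close_ge (GC _ _ (p0r t e1) (p0r 0 e2)) _.
  have : C * `|p0 t - p0 0| <= 2 * c; last by move: cu; lra.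
  apply: le_trans t3; rewrite ler_pM2l//; apply: le_trans (HM _ _ _) _.
  by rewrite ler_pM2l// subr0 ger0_norm.
have GT t : T0 - tau <= t <= T0 + tau -> s * (X (p0 t)).1 <= - (2 * c).
  move=> /andP[h1 h2]; have e1 : 0 <= t <= T0 + tau by rewrite h2 andbT; lra.
  have e2 : 0 <= T0 <= T0 + tau by rewrite ltW//= lerDl ltW.
  apply: close_le (GC _ _ (p0r t e1) (p0r T0 e2)) _.
  have : C * `|p0 t - p0 T0| <= 2 * c; last by move: cv; lra.
  apply: le_trans t3; rewrite ler_pM2l//; apply: le_trans (HM _ _ _) _.
  by rewrite ler_pM2l// ler_norml; apply/andP; split; lra.
have p0c t : cts p0 t by exact: box_flow_cts Hphi.
have [m m0 Hm] : exists2 m, 0 < m & forall t, tau <= t <= T0 - tau -> m <= s * (p0 t).1.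
  apply: cts_min_pos => t /andP[h1 h2].
    by apply: ctsM; [exact: cts_cst|case/cts_pair: (p0c t)].
  by rewrite -hp; [apply: hpos|]; apply/andP; split; lra.
have xT : s * (p0 (T0 + tau)).1 <= - (2 * c * tau).
  have TT : T0 <= T0 + tau by rewrite lerDl ltW.
  have D t : T0 < t < T0 + tau -> is_derive t (1 : R) (fun x => s * (p0 x).1)
      (s * (X (clamp r (p0 t))).1).
    move=> _; have /is_derive_pair[D _] := (Hphi (0, u0)).2 t.
    exact: (is_deriveZ s D).
  have cc t : T0 <= t <= T0 + tau -> cts (fun x => s * (p0 x).1) t.
    by move=> _; apply: ctsM; [exact: cts_cst|case/cts_pair: (p0c t)].
  have := mvt_le TT cc D (c := - (2 * c)).
  rewrite p0T mulr0 subr0 => /(_ _) h; apply: le_trans (h _) _; last lra.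
  move=> t /andP[h1 h2]; rewrite clamp_id; last by apply: p0r; apply/andP; split; lra.
  by apply: GT; apply/andP; split; lra.
pose rho := Num.min (Num.min (1 / 2 / K) (c / (C * K))) (Num.min (m / 2 / K) (c * tau / K)).
have rho0 : 0 < rho by rewrite !lt_min !divr_gt0 ?mulr_gt0.
have [r1 r2 r3 r4] :
    [/\ K * rho <= 1 / 2, C * (K * rho) <= c, K * rho <= m / 2 & K * rho <= c * tau].
  split.
  - by rewrite mulrC -ler_pdivlMr// !ge_min lexx.
  - by rewrite mulrA mulrC -ler_pdivlMr ?mulr_gt0// !ge_min lexx !orbT.
  - by rewrite mulrC -ler_pdivlMr// !ge_min lexx !orbT.
  - by rewrite mulrC -ler_pdivlMr// !ge_min lexx !orbT.
exists r, phi, tau, c, rho; split => //; first by rewrite t0.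
move=> u ur p.
have pd t : 0 <= t <= T0 + tau -> `|p t - p0 t| <= K * rho.
  move=> /andP[h1 h2]; have h3 : 0 <= t <= T0 + 1 by rewrite h1; lra.
  by apply: le_trans (HK _ _ _ h3) _; rewrite norm_section ler_pM2l.
have pr t : 0 <= t <= T0 + tau -> `|p t| <= r.
  move=> tT; rewrite -(subrK (p0 t) (p t)); apply: le_trans (ler_normD _ _) _.
  by have := pd t tT; have := p0box t tT; rewrite /r => h1 h2; lra.
have GG t : 0 <= t <= T0 + tau -> `|s * (X (p t)).1 - s * (X (p0 t)).1| <= c.
  move=> tT; apply: le_trans (GC _ _ (pr t tT) (p0r t tT)) _.
  by apply: le_trans r2; rewrite ler_pM2l//; exact: pd.
have xx t : 0 <= t <= T0 + tau -> `|s * (p t).1 - s * (p0 t).1| <= K * rho.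
  by move=> tT; rewrite unit_mul//; apply: le_trans (pd t tT); exact: (norm_ge (_ - _)).1.
split => //.
- move=> t /andP[h1 h2]; have h : 0 <= t <= tau by rewrite h1.
  apply: close_ge (GG t _) _; first by rewrite h1; lra.
  by have := G0 t h; lra.
- move=> t /andP[h1 h2]; have h : T0 - tau <= t <= T0 + tau by rewrite h1.
  apply: close_le (GG t _) _; first by rewrite h2 andbT; lra.
  by have := GT t h; lra.
- move=> t /andP[h1 h2]; have h : tau <= t <= T0 - tau by rewrite h1.
  apply: close_gt (xx t _) _; first by apply/andP; split; lra.
  by have := Hm t h; lra.
apply: close_lt (xx _ _) _; first by rewrite lexx andbT; lra.
have : 0 < c * tau by rewrite mulr_gt0.
lra.
Qed.

(** Around [T0] the normal velocity is at most - c, so each neighbour crosses the line there exactly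
    once, and |x| grows at least linearly away from the crossing time. The latter bound later makes
    exit times Lipschitz in u. *)
Lemma arc_exit_times X s u0 v0 T0 h0 : smooth_field X -> `|s| = 1 ->
  arc X s u0 v0 T0 h0 ->
  exists r phi tau c rho (Tm : R -> R), [/\
    [/\ 0 <= r, box_flow X r phi, 0 < tau <= 1, 0 < c & 0 < rho],
    (forall t, 0 <= t <= T0 -> h0 t = phi (0, u0) t), Tm u0 = T0 &
    forall u, `|u - u0| <= rho -> let p := phi (0, u) in
     [/\ forall t, 0 <= t <= T0 + tau -> `|p t| <= r,
         (0 < Tm u /\ T0 - tau <= Tm u <= T0 + tau),
         (forall t, T0 - tau <= t <= T0 + tau -> c * `|t - Tm u| <= `|(p t).1|),
         c <= s * (X (0, u)).1 /\ s * (X (p (Tm u))).1 <= - c &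
         arc X s u (p (Tm u)).2 (Tm u) p]].
Proof.
move=> HX s1 Harc; have Harc' := Harc.
have [r [phi [tau [c [rho [[r0 Hphi [/andP[t0 t1] t2] c0 rho0] hp H]]]]]] := arc_tube HX s1 Harc.
have [T00 [h00 h0T] [su sv] hd hpos] := Harc'.
have ex u : exists Tu : R, `|u - u0| <= rho -> let p := phi (0, u) in
    [/\ T0 - tau < Tu < T0 + tau, (p Tu).1 = 0,
      forall t, T0 - tau <= t <= Tu -> c * (Tu - t) <= s * (p t).1 &
      forall t, Tu <= t <= T0 + tau -> s * (p t).1 <= - c * (t - Tu)].
  have [ur|//] := boolP (`|u - u0| <= rho); last by exists 0.
  have [Hr H0 HT Hm Hx] := H u ur; set p := phi (0, u) in Hr H0 HT Hm Hx *.
  have D t : T0 - tau <= t <= T0 + tau -> is_derive t (1 : R) (fun x => s * (p x).1)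
      (s * (X (p t)).1).
    move=> /andP[h1 h2]; have /is_derive_pair[D _] := (Hphi (0, u)).2 t.
    rewrite -[in X (p _)](@clamp_id R r (p t)); last by apply: Hr; rewrite h2 andbT; lra.
    exact: (is_deriveZ s D).
  have [||Tu [a1 a2 a3 a4]] := crossing_time _ c0 D HT _ Hx; first lra.
    by apply: Hm; apply/andP; split; lra.
  exists Tu => _; split => //.
  apply/eqP; rewrite -normr_eq0 -[`|_|]mul1r -s1 -normrM normr_eq0; exact/eqP.
have [Tm HTm] := choice ex.
have main u : `|u - u0| <= rho -> let p := phi (0, u) in
     [/\ forall t, 0 <= t <= T0 + tau -> `|p t| <= r,
         (0 < Tm u /\ T0 - tau <= Tm u <= T0 + tau),
         (forall t, T0 - tau <= t <= T0 + tau -> c * `|t - Tm u| <= `|(p t).1|),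
         c <= s * (X (0, u)).1 /\ s * (X (p (Tm u))).1 <= - c &
         arc X s u (p (Tm u)).2 (Tm u) p].
  move=> ur; have [Hr H0 HT Hm Hx] := H u ur; set p := phi (0, u) in Hr H0 HT Hm Hx *.
  have [/andP[a1 a1'] a2 a3 a4] := HTm u ur.
  have p0 : p 0 = (0, u) by case: (Hphi (0, u)).
  have b1 : c <= s * (X (0, u)).1 by rewrite -p0; apply: H0; rewrite lexx ltW.
  have b2 : s * (X (p (Tm u))).1 <= - c by apply: HT; rewrite !ltW.
  have pT : p (Tm u) = (0, (p (Tm u)).2) by exact: fst0_eq.
  have D (t : R) : 0 <= t <= T0 + tau -> is_derive t (1 : R) p (X (p t)).
    move=> /Hr h; have := (Hphi (0, u)).2 t; rewrite clamp_id//.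
  have Tu0 : 0 < Tm u by lra.
  split => //.
  - by rewrite !ltW.
  - move=> t /andP[h1 h2]; rewrite -[X in _ <= X]mul1r -s1 -normrM.
    have [tT|Tt] := leP t (Tm u).
      apply: le_trans (ler_norm _); rewrite ler0_norm ?subr_le0// opprB.
      by apply: a3; rewrite h1.
    rewrite -[X in _ <= X]normrN; apply: le_trans (ler_norm _).
    rewrite gtr0_norm ?subr_gt0//; have : Tm u <= t <= T0 + tau by rewrite ltW.
    by move=> /a4; rewrite mulNr lerNr.
  - split => //.
    + split; first exact: lt_le_trans c0 b1.
      by rewrite -pT; apply: le_lt_trans b2 _; rewrite oppr_lt0.
    + by move=> t /andP[h1 h2]; apply: D; rewrite h1; lra.
    move=> t /andP[h1 h2]; have [tt|tt] := leP t tau; last first.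
      have [tT|Tt] := leP t (T0 - tau); first by apply: Hm; rewrite (ltW tt).
      apply: lt_le_trans (a3 t _); first by rewrite mulr_gt0 ?subr_gt0.
      by rewrite !ltW.
    have cc x : 0 <= x <= t -> cts (fun x => s * (p x).1) x.
      by move=> _; apply: ctsM; [exact: cts_cst|case/cts_pair: (box_flow_cts (0, u) x Hphi)].
    have DD x : 0 < x < t -> is_derive x (1 : R) (fun x => s * (p x).1) (s * (X (p x)).1).
      move=> /andP[x1 x2]; have xT : 0 <= x <= T0 + tau by rewrite ltW//=; lra.
      have /is_derive_pair[DD _] := D x xT.
      exact: (is_deriveZ s DD).
    have := mvt_ge (ltW h1) cc DD (c := c); rewrite p0 mulr0 !subr0 => k.
    apply: lt_le_trans (k _); first by rewrite mulr_gt0.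
    by move=> x /andP[x1 x2]; apply: H0; rewrite !ltW//; exact: lt_le_trans tt.
exists r, phi, tau, c, rho, Tm; split => //; first by split => //; rewrite t0.
have u00 : `|u0 - u0| <= rho by rewrite subrr normr0 ltW.
have [_ _ k _ _] := main u0 u00.
(* At time [T0] the original arc is on the line, so the linear lower bound forces [Tm u0 = T0]. *)
have := k T0; rewrite -hp ?h0T; last by rewrite lexx ltW.
have T0i : T0 - tau <= T0 <= T0 + tau by rewrite lerBlDr lerDl ltW.
move=> /(_ T0i) /=; rewrite normr0 pmulr_rle0// normr_le0 subr_eq0 => /eqP.
by [].
Qed.

End HalfMap.

(** * Half-return maps and their slopes *)

Section HalfMapDerivative.
Context {R : realType}.
Implicit Types (X : R * R -> R * R) (s : R).

(** The expansion is required at every base point u of the interval with one constant, not only at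
    its centre, since zeros of the perturbed displacement may lie anywhere in it. *)
Definition decreasing_branch (a rho C : R) (F dF : R -> R) :=
  forall u v, `|u - a| <= rho -> `|v - a| <= rho ->
    [/\ dF u < 0, `|dF u| <= C,
        `|F v - F u - dF u * (v - u)| <= C * (v - u) ^+ 2 &
        u <= v -> F v <= F u].

Let quotient_error (D P E a W : R) : P != 0 -> 0 < E ->
  `|P * D * E - a * W| / (`|P| * E) = `|D - a / (P * E) * W|.
Proof.
move=> P0 E0; have En : E != 0 by rewrite gt_eqF.
have -> : D - a / (P * E) * W = (P * D * E - a * W) / (P * E).
  by field; rewrite P0 En.
by rewrite normrM normfV normrM (gtr0_norm E0).
Qed.

(** The wedge with the field kills a displacement along the field, so the difference t of the exit
    times drops out to first order. *)
Let wedge_shift (P Q d1 d2 e1 e2 t D : R) :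
  d1 + t * P + e1 = 0 -> d2 + t * Q + e2 = D ->
  P * D = (P * d2 - Q * d1) + (P * e2 - Q * e1).
Proof.
move=> h1 h2; have -> : d1 = - (t * P + e1) by apply/eqP; rewrite -addr_eq0 addrA h1.
by rewrite -h2; ring.
Qed.

(** By Liouville's formula the wedge at the start, the normal velocity at u times v - u, turns up to
    the factor [E] and a quadratic error into the normal velocity at F u times F v - F u. The slope
    is thus a quotient of normal velocities, and it is negative because the arc leaves the line at u
    and comes back to it at F u. *)
Lemma half_map X s u0 v0 T0 h0 : smooth_field X -> `|s| = 1 ->
  arc X s u0 v0 T0 h0 ->
  exists rho C F dF, [/\ 0 < rho, 0 < C, F u0 = v0,
    decreasing_branch u0 rho C F dF &
    forall u, `|u - u0| <= rho -> exists T h, arc X s u (F u) T h /\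
      forall t, 0 <= t <= T -> exists2 t', 0 <= t' <= T0 &
        `|h t - h0 t'| <= C * `|u - u0|].
Proof.
move=> HX s1 Harc.
have [r [phi [tau [c [rho [Tm [[r0 Hphi /andP[tau0 tau1] c0 rho0] hp Tm0 H]]]]]]]
  := arc_exit_times HX s1 Harc.
have [T00 [h00 h0T] _ _ _] := Harc.
have [M M0 HM] := box_flow_time HX r0 Hphi.
have Tt0 : 0 <= T0 + tau by rewrite addr_ge0 ?ltW.
have [K K0 HK] := box_flow_dist HX r0 Hphi Tt0.
have [C C0 HC] := smooth_bound HX r.
have [W W0 HW] := wronskian HX r0 Tt0.
have s0 : s != 0 by rewrite -normr_eq0 s1 oner_eq0.
pose F u := (phi (0, u) (Tm u)).2.
have Fsec u : `|u - u0| <= rho -> phi (0, u) (Tm u) = (0, F u).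
  by move=> /H[_ _ _ _ [_ [_ e] _ _ _]]; exact: e.
have pd u v t : 0 <= t <= T0 + tau -> `|phi (0, v) t - phi (0, u) t| <= K * `|v - u|.
  by move=> tT; apply: le_trans (HK _ _ _ tT) _; rewrite norm_section.
have TmI u : `|u - u0| <= rho -> 0 <= Tm u <= T0 + tau.
  by move=> /H[_ [h1 /andP[_ h2]] _ _ _]; rewrite h2 ltW.
have Tdist u v : `|u - u0| <= rho -> `|v - u0| <= rho ->
    `|Tm v - Tm u| <= K / c * `|v - u|.
  move=> ur vr; have [_ [_ a2] _ _ _] := H u ur.
  have [_ _ b3 _ _] := H v vr.
  rewrite -(ler_pM2l c0) mulrA mulrCA divff ?gt_eqF// mulr1 distrC.
  apply: le_trans (b3 _ a2) _; apply: le_trans (pd u v _ (TmI u ur)).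
  have := (norm_ge (phi (0, v) (Tm u) - phi (0, u) (Tm u))).1.
  by rewrite /= (Fsec u ur) /= subr0.
have exE u : exists E : R, `|u - u0| <= rho -> [/\ 0 < E, E <= W, E^-1 <= W &
    forall (z2 : R -> R * R) (k : R),
      (forall t : R, 0 <= t <= Tm u -> [/\ `|z2 t| <= r, `|z2 t - phi (0, u) t| <= k &
         is_derive t (1 : R) z2 (X (z2 t))]) ->
      `|wedge (X (phi (0, u) (Tm u))) (z2 (Tm u) - phi (0, u) (Tm u)) * E
        - wedge (X (phi (0, u) 0)) (z2 0 - phi (0, u) 0)| <= W * k ^+ 2].
  have [ur|//] := boolP (`|u - u0| <= rho); last by exists 0.
  have [a1 _ _ _ [_ _ _ ad _]] := H u ur.
  have [||E HE] := HW (phi (0, u)) (Tm u) (TmI u ur).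
  - by move=> t; exact: box_flow_cts Hphi.
  - move=> t tT; split; last exact: ad.
    apply: a1; have /andP[h1 h2] := tT; have /andP[h3 h4] := TmI u ur.
    by rewrite h1 (le_trans h2).
  by exists E => _.
have [E HE] := choice exE.
pose dF u := (X (0, u)).1 / ((X (0, F u)).1 * E u).
pose Ce := C * (M * (K / c) + K) * (K / c).
have Kc : 0 < K / c by rewrite divr_gt0.
have KM0 : 0 < K + M * (K / c) by rewrite addr_gt0// mulr_gt0.
have Ce0 : 0 < Ce by rewrite mulr_gt0// mulr_gt0// addrC.
pose Cq := (W * K ^+ 2 + W * (2 * (C * Ce))) * (W / c).
have Wc : 0 < W / c by rewrite divr_gt0.
have y0 : 0 < W * K ^+ 2 + W * (2 * (C * Ce)).
  apply: addr_gt0; first by apply: mulr_gt0 => //; exact: exprn_gt0.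
  by do 3!apply: mulr_gt0 => //.
have Cq0 : 0 < Cq by rewrite mulr_gt0.
have signs u : `|u - u0| <= rho -> [/\ c <= s * (X (0, u)).1, s * (X (0, F u)).1 <= - c,
    `|(X (0, u)).1| <= C & `|(X (0, F u)).1| <= C].
  move=> ur; have [a1 _ _ [a4 a5] _] := H u ur.
  rewrite (Fsec u ur) in a5; split => //.
    have h : `|(0, u) : R * R| <= r by rewrite -(Hphi (0, u)).1; apply: a1; rewrite lexx.
    by apply: le_trans (HC _ _ h h).1; exact: (norm_ge (X (0, u))).1.
  have h : `|(0, F u) : R * R| <= r by rewrite -(Fsec u ur); apply: a1; exact: TmI.
  by apply: le_trans (HC _ _ h h).1; exact: (norm_ge (X (0, F u))).1.
have Pabs u : `|u - u0| <= rho -> c <= `|(X (0, F u)).1| /\ c <= `|(X (0, u)).1|.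
  move=> /signs[h1 h2 _ _]; split.
    rewrite -[X in _ <= X]mul1r -s1 -normrM -normrN; apply: le_trans (ler_norm _).
    by rewrite lerNr.
  by rewrite -[X in _ <= X]mul1r -s1 -normrM; apply: le_trans (ler_norm _).
have dFneg u : `|u - u0| <= rho -> dF u < 0.
  move=> ur; have [h1 h2 _ _] := signs u ur; have [E0 _ _ _] := HE u ur.
  have -> : dF u = (s * (X (0, u)).1) / ((s * (X (0, F u)).1) * E u).
    by rewrite /dF -(mulrA s _ (E u)) -mulf_div divff// mul1r.
  rewrite pmulr_rlt0; last exact: lt_le_trans c0 h1.
  rewrite invr_lt0 pmulr_llt0//; apply: le_lt_trans h2 _.
  by rewrite oppr_lt0.
have dFabs u : `|u - u0| <= rho -> c / (C * W) <= `|dF u| /\ `|dF u| <= C / c * W.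
  move=> ur; have [_ _ h3 h4] := signs u ur; have [k1 k2] := Pabs u ur.
  have [E0 E1 E2 _] := HE u ur.
  have p0 : 0 < `|(X (0, F u)).1| by exact: lt_le_trans c0 k1.
  rewrite /dF normrM normfV normrM (gtr0_norm E0); split.
    apply: ler_pM => //; [exact: ltW|by rewrite invr_ge0 mulr_ge0 ?ltW|].
    by rewrite lef_pV2 ?posrE ?mulr_gt0//; apply: ler_pM => //; exact: ltW.
  rewrite invfM mulrA; apply: ler_pM => //; rewrite ?invr_ge0 ?(ltW E0)//.
  by apply: ler_pM => //; rewrite ?invr_ge0// lef_pV2.
have quad u v : `|u - u0| <= rho -> `|v - u0| <= rho ->
    `|F v - F u - dF u * (v - u)| <= Cq * (v - u) ^+ 2.
  move=> ur vr; have [E0 E1 E2 HEu] := HE u ur.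
  have [k1 _] := Pabs u ur; have [_ _ _ h4] := signs u ur.
  have p0 : 0 < `|(X (0, F u)).1| by exact: lt_le_trans c0 k1.
  have [b1 [_ bT] _ _ _] := H v vr.
  have [a1 [aT0 aT] _ _ _] := H u ur.
  pose k := K * `|v - u|.
  have wr : `|wedge (X (phi (0, u) (Tm u))) (phi (0, v) (Tm u) - phi (0, u) (Tm u)) * E u
        - wedge (X (phi (0, u) 0)) (phi (0, v) 0 - phi (0, u) 0)| <= W * k ^+ 2.
    apply: HEu => t /andP[t1 t2]; have /andP[_ t3] := TmI u ur.
    have tT : 0 <= t <= T0 + tau by rewrite t1 (le_trans t2).
    split; [exact: b1|exact: pd|].
    by have := (Hphi (0, v)).2 t; rewrite clamp_id// b1.
  rewrite (Hphi (0, u)).1 (Hphi (0, v)).1 (Fsec u ur) in wr.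
  have zu : `|(0, F u) : R * R| <= r by rewrite -(Fsec u ur); apply: a1; exact: TmI.
  pose dT := Tm v - Tm u; pose Xu := X (0, F u).
  have dTle : `|dT| <= K / c * `|v - u| by exact: Tdist.
  have key t : `|t - Tm u| <= `|dT| ->
      `|X (clamp r (phi (0, v) t)) - Xu| <= C * ((M * (K / c) + K) * `|v - u|).
    move=> tT; apply: le_trans (HC _ _ zu (clamp_norm _ r0)).2 _.
    rewrite ler_pM2l// -{1}(clamp_id zu); apply: le_trans (clamp_lip _ _ _) _.
    rewrite -(Fsec u ur); apply: le_trans (ler_distD (phi (0, v) (Tm u)) _ _) _.
    rewrite mulrDl; apply: lerD; last by apply: pd; exact: TmI.
    apply: le_trans (HM _ _ _) _; rewrite -mulrA ler_pM2l//.
    exact: le_trans tT dTle.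
  have D t := (is_derive_pair _ _ _).1 ((Hphi (0, v)).2 t).
  pose e1 := (phi (0, v) (Tm v)).1 - (phi (0, v) (Tm u)).1 - dT * Xu.1.
  pose e2 := (phi (0, v) (Tm v)).2 - (phi (0, v) (Tm u)).2 - dT * Xu.2.
  have TE : Tm u + dT = Tm v by rewrite subrKC.
  have small e : e <= C * ((M * (K / c) + K) * `|v - u|) * `|dT| -> e <= Ce * `|v - u| ^+ 2.
    move=> h; apply: le_trans h _.
    have -> : Ce * `|v - u| ^+ 2 = C * ((M * (K / c) + K) * `|v - u|) * (K / c * `|v - u|).
      by rewrite /Ce; ring.
    apply: ler_wpM2l => //; apply: mulr_ge0; first exact: ltW.
    by apply: mulr_ge0 => //; rewrite addrC ltW.
  have e1le : `|e1| <= Ce * `|v - u| ^+ 2.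
    apply: small; rewrite /e1 -{1}TE.
    apply: (@mvt_abs R (fun t => (phi (0, v) t).1) (fun t => (X (clamp r (phi (0, v) t))).1)).
      by move=> t _; exact: (D t).1.
    by move=> t /key; apply: le_trans; exact: (norm_ge (_ - _)).1.
  have e2le : `|e2| <= Ce * `|v - u| ^+ 2.
    apply: small; rewrite /e2 -{1}TE.
    apply: (@mvt_abs R (fun t => (phi (0, v) t).2) (fun t => (X (clamp r (phi (0, v) t))).2)).
      by move=> t _; exact: (D t).2.
    by move=> t /key; apply: le_trans; exact: (norm_ge (_ - _)).2.
  have shift : Xu.1 * (F v - F u) =
     wedge Xu (phi (0, v) (Tm u) - (0, F u)) + (Xu.1 * e2 - Xu.2 * e1).
    apply: (@wedge_shift Xu.1 Xu.2 _ _ e1 e2 dT).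
      by rewrite /e1 (Fsec v vr) /=; ring.
    by rewrite /e2 (Fsec v vr) /=; ring.
  have w0 : wedge (X (0, u)) ((0, v) - (0, u)) = (X (0, u)).1 * (v - u).
    by rewrite /wedge /= subrr mulr0 subr0.
  have Xu1 : `|Xu.1| <= C by exact: h4.
  have Xu2 : `|Xu.2| <= C by apply: le_trans (HC _ _ zu zu).1; exact: (norm_ge Xu).2.
  have P0 : (X (0, F u)).1 != 0 by rewrite -normr_gt0.
  rewrite /dF -quotient_error// -real_normK ?num_real//.
  rewrite ler_pdivrMr ?mulr_gt0//.
  apply: (@le_trans _ _ ((W * K ^+ 2 + W * (2 * (C * Ce))) * `|v - u| ^+ 2)).
    rewrite -/Xu shift.
    have -> : (wedge Xu (phi (0, v) (Tm u) - (0, F u)) + (Xu.1 * e2 - Xu.2 * e1)) * E u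
       - (X (0, u)).1 * (v - u)
     = (wedge Xu (phi (0, v) (Tm u) - (0, F u)) * E u - wedge (X (0, u)) ((0, v) - (0, u)))
       + E u * (Xu.1 * e2 - Xu.2 * e1) by rewrite w0; ring.
    apply: le_trans (ler_normD _ _) _; rewrite [leRHS]mulrDl; apply: lerD.
      by apply: le_trans wr _; rewrite /k exprMn mulrA.
    rewrite normrM (gtr0_norm E0) -(mulrA W); apply: ler_pM => //; first exact: ltW.
    apply: le_trans (ler_normB _ _) _; rewrite !normrM.
    have -> : 2 * (C * Ce) * `|v - u| ^+ 2 =
      C * (Ce * `|v - u| ^+ 2) + C * (Ce * `|v - u| ^+ 2) by ring.
    by apply: lerD; apply: ler_pM.
  rewrite /Cq; move: y0; move: (W * K ^+ 2 + W * (2 * (C * Ce))) => y y0.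
  have yv0 : 0 <= y * `|v - u| ^+ 2 by rewrite mulr_ge0 ?sqr_ge0// ltW.
  have -> : y * (W / c) * `|v - u| ^+ 2 * (`|(X (0, F u)).1| * E u)
    = y * `|v - u| ^+ 2 * ((W * E u) * (`|(X (0, F u)).1| / c)) by ring.
  rewrite ler_peMr// -[leLHS]mulr1; apply: ler_pM => //.
    by rewrite -(mulfV (lt0r_neq0 E0)) mulrC ler_pM2r.
  by rewrite ler_pdivlMr// mul1r.
pose d0 := c / (C * W); have d00 : 0 < d0 by rewrite divr_gt0// mulr_gt0.
(* [d0] bounds the slopes away from 0; on this smaller interval the remainder [Cq * (v - u) ^+ 2]
   cannot outweigh them, whence monotonicity. *)
pose rho' := Num.min rho (d0 / (2 * Cq)).
have rho'0 : 0 < rho' by rewrite lt_min rho0 divr_gt0// mulr_gt0.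
have rr u : `|u - u0| <= rho' -> `|u - u0| <= rho.
  by move=> /le_trans; apply; rewrite ge_min lexx.
pose CC := C / c * W + Cq + (K + M * (K / c)).
have CW0 : 0 < C / c * W by rewrite mulr_gt0// divr_gt0.
have CC0 : 0 < CC by rewrite addr_gt0// addr_gt0.
exists rho', CC, F, dF; split => //.
- by rewrite /F Tm0 -hp ?h0T// ltW//= lexx.
- move=> u v ur' vr'; have ur := rr u ur'; have vr := rr v vr'.
  have [l1 l2] := dFabs u ur; have q := quad u v ur vr.
  split.
  + exact: dFneg.
  + by apply: le_trans l2 _; rewrite /CC -addrA lerDl addr_ge0 ?ltW.
  + apply: le_trans q _; rewrite ler_wpM2r ?sqr_ge0// /CC.
    by rewrite -addrA addrCA lerDl addr_ge0 ?ltW.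
  move=> uv; have n := dFneg u ur.
  have h1 : v - u <= d0 / Cq.
    have e1 : `|v - u0| <= d0 / (2 * Cq) by apply: le_trans vr' _; rewrite ge_min lexx orbT.
    have e2 : `|u - u0| <= d0 / (2 * Cq) by apply: le_trans ur' _; rewrite ge_min lexx orbT.
    have -> : d0 / Cq = d0 / (2 * Cq) + d0 / (2 * Cq) by field; rewrite gt_eqF.
    have -> : v - u = (v - u0) - (u - u0) by ring.
    apply: le_trans (ler_norm _) _; apply: le_trans (ler_normB _ _) _.
    exact: lerD.
  rewrite ltr0_norm// in l1.
  have h2 : Cq * (v - u) <= d0 by rewrite mulrC -ler_pdivlMr.
  have h3 : Cq * (v - u) ^+ 2 <= d0 * (v - u).
    by rewrite expr2 mulrA ler_wpM2r// subr_ge0.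
  have h4 : dF u * (v - u) <= - d0 * (v - u).
    by rewrite ler_wpM2r ?subr_ge0// lerNr.
  move: q; rewrite ler_norml => /andP[_ q]; rewrite mulNr in h4.
  rewrite -subr_le0; have := lerD q (lerD h3 h4); clear; lra.
move=> u ur'; have ur := rr u ur'; have [_ [Tu0 TuT] _ _ ar] := H u ur.
exists (Tm u), (phi (0, u)); split => // t /andP[t0 tT].
have TT : `|Tm u - T0| <= K / c * `|u - u0|.
  by rewrite -Tm0; apply: Tdist => //; rewrite subrr normr0 ltW.
have bound : (K + M * (K / c)) * `|u - u0| <= CC * `|u - u0|.
  by rewrite ler_wpM2r// /CC lerDr addr_ge0 ?ltW.
have pdu x : 0 <= x <= T0 + tau -> `|phi (0, u) x - phi (0, u0) x| <= K * `|u - u0|.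
  exact: pd.
have tTt : 0 <= t <= T0 + tau by case/andP: TuT => _ h; rewrite t0 (le_trans tT).
(* The point at time t is compared with the arc at time min (t, T0), since a neighbour may exit
   later than the arc itself. *)
have [tT0|T0t] := leP t T0.
  exists t; first by rewrite t0.
  rewrite hp ?t0//; apply: le_trans bound; apply: le_trans (pdu t tTt) _.
  by rewrite ler_wpM2r// lerDl mulr_ge0 ?ltW// mulr_gt0// invr_gt0.
exists T0; first by rewrite ltW//= lexx.
rewrite hp ?(ltW T00) ?lexx//; apply: le_trans bound.
apply: le_trans (ler_distD (phi (0, u0) t) _ _) _; rewrite mulrDl.
apply: lerD; first exact: pdu.
apply: le_trans (HM _ _ _) _; rewrite -mulrA ler_pM2l//; apply: le_trans TT.
by rewrite !ger0_norm ?subr_ge0 ?(ltW T0t) ?(le_trans (ltW T0t))// lerD2r.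
Qed.

End HalfMapDerivative.

(** * Filippov trajectories through crossing points *)

Section Trajectories.
Context {R : realType}.
Implicit Types (Z : pw_field R) (g : R -> R * R).

Definition sgn (b : bool) : R := if b then 1 else -1.

Definition side_field Z (b : bool) : R * R -> R * R :=
  if b then field_pos Z else field_neg Z.

Definition global_trajectory Z g := forall a b, trajectory Z a b g.

Lemma norm_sgn b : `|sgn b| = 1.
Proof. by case: b; rewrite /sgn ?normrN normr1. Qed.

Lemma normr_sgnM b (x : R) : `|sgn b * x| = `|x|.
Proof. by rewrite normrM norm_sgn mul1r. Qed.

Lemma side_field_smooth Z b : smooth_field (side_field Z b).
Proof.
case: b => /=.
  have [px [py Hp]] := eval2_taylor (pwP_pos Z).
  have [qx [qy Hq]] := eval2_taylor (pwQ_pos Z).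
  by exists px, py, qx, qy.
have [px [py Hp]] := eval2_taylor (pwP_neg Z).
have [qx [qy Hq]] := eval2_taylor (pwQ_neg Z).
by exists px, py, qx, qy.
Qed.

Lemma smooth_field_cts (X : R * R -> R * R) g t : smooth_field X -> cts g t ->
  cts (fun s => X (g s)) t.
Proof.
move=> HX gc e e0; have [C C0 HC] := smooth_bound HX (`|g t| + 1).
have [d d0 Hd] := gc _ (divr_gt0 e0 C0); have [d1 d10 Hd1] := gc _ ltr01.
exists (Num.min d d1) => [|s]; first by rewrite lt_min d0.
rewrite lt_min => /andP[/Hd + /Hd1 h2]; rewrite ltr_pdivlMr// mulrC.
apply: le_lt_trans; apply: (HC _ _ _ _).2; first by rewrite lerDl.
rewrite -(subrK (g t) (g s)); apply: le_trans (ler_normD _ _) _.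
by rewrite addrC lerD2l ltW.
Qed.

Lemma global_trajectory_cts Z g t : global_trajectory Z g -> cts g t.
Proof.
move=> Hg e e0; have [/(_ _ e0)[d d0 Hd] _] := Hg (t - 1) (t + 1).
exists (Num.min d 1) => [|s]; first by rewrite lt_min d0 ltr01.
rewrite lt_min => /andP[sd s1].
have H a b : t - 1 <= a -> a <= b -> b <= t + 1 -> b - a < d -> `|g b - g a| < e.
  move=> h1 h2 h3 h4; have := Hd 1%N (fun=> a) (fun=> b).
  rewrite !big_ord1; apply => //.
  by move=> i j; rewrite !ord1 eqxx.
move: s1; rewrite ltr_norml => /andP[s1 s2].
have [st|ts] := leP s t.
  rewrite distrC; apply: H => //; try lra.
  by move: sd; rewrite distrC ger0_norm ?subr_ge0.
apply: H; try lra.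
by move: sd; rewrite ger0_norm ?subr_ge0// ltW.
Qed.

Lemma trajectory_rate Z g (a b al be c : R) : global_trajectory Z g -> a <= b ->
  (forall t v, a < t < b -> filippov Z (g t) v -> c <= al * v.1 + be * v.2) ->
  c * (b - a) <= (al * (g b).1 + be * (g b).2) - (al * (g a).1 + be * (g a).2).
Proof.
move=> Hg ab Hc; have [ac ae] := Hg a b.
exact: (abs_continuous_ge (F := fun t => filippov Z (g t)) ab ac ae Hc).
Qed.

Lemma trajectory_rate1 Z g (a b c d : R) : global_trajectory Z g -> a <= b ->
  (forall t v, a < t < b -> filippov Z (g t) v -> c <= v.1 <= d) ->
  c * (b - a) <= (g b).1 - (g a).1 <= d * (b - a).
Proof.
move=> Hg ab Hc; apply/andP; split.
  have := @trajectory_rate Z g a b 1 0 c Hg ab.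
  rewrite !mul1r !mul0r !addr0; apply => t v tab /(Hc _ _ tab)/andP[h _].
  by rewrite mul1r mul0r addr0.
have := @trajectory_rate Z g a b (-1) 0 (- d) Hg ab.
rewrite !mulN1r !mul0r !addr0 mulNr -opprD lerN2; apply => t v tab /(Hc _ _ tab)/andP[_ h].
by rewrite mulN1r mul0r addr0 lerN2.
Qed.

Lemma trajectory_rate2 Z g (a b c d : R) : global_trajectory Z g -> a <= b ->
  (forall t v, a < t < b -> filippov Z (g t) v -> c <= v.2 <= d) ->
  c * (b - a) <= (g b).2 - (g a).2 <= d * (b - a).
Proof.
move=> Hg ab Hc; apply/andP; split.
  have := @trajectory_rate Z g a b 0 1 c Hg ab.
  rewrite !mul1r !mul0r !add0r; apply => t v tab /(Hc _ _ tab)/andP[h _].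
  by rewrite mul1r mul0r add0r.
have := @trajectory_rate Z g a b 0 (-1) (- d) Hg ab.
rewrite !mulN1r !mul0r !add0r mulNr -opprD lerN2; apply => t v tab /(Hc _ _ tab)/andP[_ h].
by rewrite mulN1r mul0r add0r lerN2.
Qed.

Lemma filippov_side Z z v b : 0 < sgn b * z.1 -> filippov Z z v ->
  v = side_field Z b z.
Proof.
case: b; rewrite /sgn ?mul1r ?mulN1r ?oppr_gt0 => z0 [[]|[]|[]] /=.
- by [].
- by move=> /(lt_trans z0); rewrite ltxx.
- by move=> z1; move: z0; rewrite z1 ltxx.
- by move=> /(lt_trans z0); rewrite ltxx.
- by [].
- by move=> z1; move: z0; rewrite z1 ltxx.
Qed.

(** Off the line an absolutely continuous solution is classical: the velocity is prescribed almost
    everywhere by a function continuous along g, and [trajectory_rate] squeezes the increments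
    between its nearby values. *)
Lemma trajectory_solves Z g (a c : R) b : global_trajectory Z g ->
  (forall t, a < t < c -> 0 < sgn b * (g t).1) -> solves (side_field Z b) g a c.
Proof.
move=> Hg pos t /andP[at_ tc]; apply/is_deriveP => e e0.
have [d d0 Hd] := smooth_field_cts (side_field_smooth Z b) (@global_trajectory_cts Z g t Hg) e0.
set X := side_field Z b in Hd *.
exists (Num.min d (Num.min (t - a) (c - t))) => [|h].
  by rewrite !lt_min d0 !subr_gt0 at_ tc.
rewrite !lt_min => /and3P[h1 h2 h3].
have key s v : `|s - t| <= `|h| -> filippov Z (g s) v ->
    (X (g t)).1 - e <= v.1 <= (X (g t)).1 + e /\
    (X (g t)).2 - e <= v.2 <= (X (g t)).2 + e.
  move=> sh fv; have sa : a < s < c.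
    have := le_lt_trans sh h2; have := le_lt_trans sh h3.
    rewrite !ltr_norml => /andP[k1 k2] /andP[k3 k4]; clear -k1 k2 k3 k4.
    by apply/andP; split; lra.
  rewrite (filippov_side (pos _ sa) fv) -/X.
  have /ltW hh := Hd s (le_lt_trans sh h1).
  have := le_trans (norm_ge (X (g s) - X (g t))).1 hh.
  have := le_trans (norm_ge (X (g s) - X (g t))).2 hh.
  rewrite /= !ler_norml => /andP[k1 k2] /andP[k3 k4]; clear -k1 k2 k3 k4.
  by split; apply/andP; split; lra.
have fin (x m : R) (k : R) : (m - e) * `|k| <= x <= (m + e) * `|k| ->
    `|x - `|k| * m| <= e * `|k|.
  by move=> /andP[k1 k2]; rewrite ler_norml; apply/andP; split; lra.
have [h0|h0] := leP 0 h.
  have th : t <= t + h by rewrite lerDl.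
  have kn s : t < s < t + h -> `|s - t| <= `|h|.
    move=> /andP[k1 k2]; rewrite (ger0_norm h0) ger0_norm; lra.
  have := trajectory_rate1 Hg th (fun s v hs fv => (key s v (kn s hs) fv).1).
  have := trajectory_rate2 Hg th (fun s v hs fv => (key s v (kn s hs) fv).2).
  have -> : t + h - t = `|h| by rewrite ger0_norm//; ring.
  move=> r2 r1.
  have -> : g (t + h) - g t - h *: X (g t) = g (t + h) - g t - `|h| *: X (g t).
    by rewrite ger0_norm.
  apply: norm_le_pair; first exact: (fin ((g (t + h)).1 - (g t).1) (X (g t)).1 h r1).
  exact: (fin ((g (t + h)).2 - (g t).2) (X (g t)).2 h r2).
have th : t + h <= t by rewrite gerDl ltW.
have kn s : t + h < s < t -> `|s - t| <= `|h|.
  move=> /andP[k1 k2]; rewrite (ltr0_norm h0) ltr0_norm; lra.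
have := trajectory_rate1 Hg th (fun s v hs fv => (key s v (kn s hs) fv).1).
have := trajectory_rate2 Hg th (fun s v hs fv => (key s v (kn s hs) fv).2).
have -> : t - (t + h) = `|h| by rewrite ltr0_norm//; ring.
move=> r2 r1; rewrite -normrN opprB.
have -> : h *: X (g t) - (g (t + h) - g t) = (g t - g (t + h)) - `|h| *: X (g t).
  by rewrite ltr0_norm// scaleNr opprK opprB addrC.
apply: norm_le_pair; first exact: (fin ((g t).1 - (g (t + h)).1) (X (g t)).1 h r1).
exact: (fin ((g t).2 - (g (t + h)).2) (X (g t)).2 h r2).
Qed.

(** At a crossing point both one-sided normal velocities have the same sign, so this tells which
    half-plane is entered. *)
Definition crossing_side Z (y : R) := 0 < (field_pos Z (0, y)).1.

Lemma crossing_sideP Z y b : crossing_point Z y ->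
  0 < sgn (crossing_side Z y) * (side_field Z b (0, y)).1.
Proof.
rewrite /crossing_point /crossing_side /side_field /sgn /=.
case: ifPn => [p0|]; rewrite ?mul1r ?mulN1r.
  by rewrite pmulr_rgt0//; case: b.
rewrite -leNgt => p0 pq.
have pn : eval2 (pwP_pos Z) (0, y) < 0.
  by rewrite lt_neqAle p0 andbT; apply: contraTN pq => /eqP->; rewrite mul0r ltxx.
by move: pq; rewrite nmulr_rgt0// oppr_gt0; case: b.
Qed.

(** Both one-sided normal velocities keep their common sign near the point, and so do their convex
    combinations. Hence every Filippov velocity has that sign, on or off the line, and neither
    sliding nor turning back can occur. *)
Lemma trajectory_crossing Z g (t : R) : global_trajectory Z g -> (g t).1 = 0 ->
  crossing_point Z (g t).2 ->
  exists2 d : R, 0 < d & forall s, `|s - t| < d ->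
    (t < s -> 0 < sgn (crossing_side Z (g t).2) * (g s).1) /\
    (s < t -> sgn (crossing_side Z (g t).2) * (g s).1 < 0).
Proof.
move=> Hg gt cr; set s0 := sgn _; have gtE := fst0_eq gt.
have Gc := @global_trajectory_cts Z g t Hg.
have pos b : exists2 c : R, 0 < c & exists2 d : R, 0 < d & forall s, `|s - t| < d ->
    c <= s0 * (side_field Z b (g s)).1.
  have p0 := crossing_sideP b cr; rewrite -gtE -/s0 in p0.
  exists (s0 * (side_field Z b (g t)).1 / 2); first by rewrite divr_gt0.
  have [d d0 Hd] := smooth_field_cts (side_field_smooth Z b) Gc (divr_gt0 p0 (ltr0Sn R 1)).
  exists d => // s /Hd /ltW h.
  have := le_trans (norm_ge (_ - _)).1 h.
  rewrite /= -(normr_sgnM (crossing_side Z (g t).2)) -/s0.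
  by rewrite ler_norml mulrBr => /andP[h1 h2]; lra.
have [c1 c10 [d1 d10 H1]] := pos true; have [c2 c20 [d2 d20 H2]] := pos false.
pose c := Num.min c1 c2; have c0 : 0 < c by rewrite lt_min c10.
have c1' : c <= c1 by rewrite ge_min lexx.
have c2' : c <= c2 by rewrite ge_min lexx orbT.
exists (Num.min d1 d2) => [|s]; first by rewrite lt_min d10.
rewrite lt_min => /andP[sd1 sd2].
have key x v : `|x - t| <= `|s - t| -> filippov Z (g x) v -> c <= s0 * v.1 + 0 * v.2.
  move=> xs; have := le_trans c1' (H1 x (le_lt_trans xs sd1)).
  have := le_trans c2' (H2 x (le_lt_trans xs sd2)).
  rewrite mul0r addr0 /= => h2 h1 [[_ ->]|[_ ->]|[_ [l /andP[l0 l1] ->]]] //=.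
  have -> : s0 * (l * eval2 (pwP_pos Z) (g x) + (1 - l) * eval2 (pwP_neg Z) (g x))
    = l * (s0 * eval2 (pwP_pos Z) (g x)) + (1 - l) * (s0 * eval2 (pwP_neg Z) (g x)) by ring.
  have -> : c = l * c + (1 - l) * c by ring.
  by apply: lerD; apply: ler_wpM2l => //; rewrite subr_ge0.
split=> ts.
  have := @trajectory_rate Z g t s s0 0 c Hg (ltW ts).
  rewrite gt mulr0 !mul0r !addr0 subr0 => /(_ _) h.
  apply: lt_le_trans (h _); first by rewrite mulr_gt0// subr_gt0.
  move=> x v /andP[x1 x2]; apply: key.
  by rewrite !ger0_norm ?subr_ge0 ?(ltW x1)// ?lerD2r ltW.
have := @trajectory_rate Z g s t s0 0 c Hg (ltW ts).
rewrite gt mulr0 !mul0r !addr0 sub0r => /(_ _) h.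
rewrite -oppr_gt0; apply: lt_le_trans (h _); first by rewrite mulr_gt0// subr_gt0.
move=> x v /andP[x1 x2]; apply: key.
by rewrite !ltr0_norm ?subr_lt0// lerN2 lerD2r ltW.
Qed.

Definition regular_point Z (z : R * R) := z.1 = 0 -> crossing_point Z z.2.

Definition exit_side Z (z : R * R) : bool :=
  if z.1 == 0 then crossing_side Z z.2 else 0 < z.1.

Lemma exit_sideP Z g t : global_trajectory Z g -> regular_point Z (g t) ->
  exists2 d : R, 0 < d & forall s, t < s < t + d -> 0 < sgn (exit_side Z (g t)) * (g s).1.
Proof.
move=> Hg reg; have [g0|gn0] := eqVneq (g t).1 0.
  have [d d0 Hd] := trajectory_crossing Hg g0 (reg g0).
  exists d => // s /andP[ts std]; rewrite /exit_side g0 eqxx.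
  by apply: (Hd _ _).1 => //; rewrite gtr0_norm ?subr_gt0//; lra.
rewrite /exit_side (negbTE gn0); set s0 := sgn _.
have p0 : 0 < s0 * (g t).1.
  rewrite /s0 /sgn; case: ifPn => [h|]; rewrite ?mul1r// mulN1r oppr_gt0.
  by rewrite -leNgt lt_neqAle gn0.
have /cts_pair[gc _] := @global_trajectory_cts Z g t Hg.
have [d d0 Hd] := gc _ p0; exists d => // s /andP[ts std].
have := Hd s; rewrite gtr0_norm ?subr_gt0// => /(_ _) h.
have {}h : `|(g s).1 - (g t).1| < s0 * (g t).1 by apply: h; lra.
move: h; rewrite -(normr_sgnM (0 < (g t).1)) -/s0.
by rewrite ltr_norml mulrBr => /andP[h _]; lra.
Qed.

End Trajectories.

(** * Forward uniqueness and the arcs of a trajectory *)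

Section Uniqueness.
Context {R : realType}.
Implicit Types (Z : pw_field R) (g : R -> R * R).

Lemma real_induction (P : R -> Prop) (a b : R) : P a ->
  (forall x, a <= x < b -> P x ->
     exists2 d : R, 0 < d & forall w, x < w < x + d -> w <= b -> P w) ->
  (forall x, a < x <= b -> (forall y, a <= y < x -> P y) -> P x) ->
  forall x, a <= x <= b -> P x.
Proof.
move=> Pa ext lim x0 /andP[ax0 x0b]; have ab := le_trans ax0 x0b.
pose S := [set x | a <= x <= b /\ forall y, a <= y <= x -> P y].
have Sa : S a.
  by split=> [|y /andP[h1 h2]]; rewrite ?lexx// (_ : y = a)//; apply: le_anti; rewrite h1 h2.
have hS : has_sup S by split; [exists a | exists b => x [/andP[]]].
pose c := sup S.
have ac : a <= c by apply: ub_le_sup => //; case: hS.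
have cb : c <= b by apply: ge_sup => [|x [/andP[]]]//; exists a.
have lc y : a <= y < c -> P y.
  move=> /andP[ay yc]; have yc0 : 0 < c - y by rewrite subr_gt0.
  have [u [_ Pu]] := sup_adherent yc0 hS.
  rewrite -/c opprB addrC subrK => yu; apply: Pu; by rewrite ay ltW.
have Pc : P c.
  have [->//|ca] := eqVneq c a; apply: lim => //.
  by rewrite lt_neqAle eq_sym ca ac.
have [cx|xc] := leP c x0; last by apply: lc; rewrite ax0.
move: cx; rewrite le_eqVlt => /predU1P[<-//|cx].
have cb' : a <= c < b by rewrite ac (lt_le_trans cx).
have [d d0 Hd] := ext c cb' Pc.
pose w := Num.min (c + d / 2) b.
have cw : c < w by rewrite lt_min ltrDl divr_gt0//= (lt_le_trans cx).
have wd : w < c + d by rewrite gt_min; apply/orP; left; lra.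
have Sw : S w.
  split; first by rewrite (le_trans ac (ltW cw)) ge_min lexx orbT.
  move=> y /andP[ay yw]; have [yc|cy] := ltP y c; first by apply: lc; rewrite ay.
  move: cy; rewrite le_eqVlt => /predU1P[<-//|cy]; apply: Hd.
    by rewrite cy (le_lt_trans yw).
  by apply: le_trans yw _; rewrite ge_min lexx orbT.
by have := ub_le_sup (proj2 hS) Sw; rewrite -/c leNgt cw.
Qed.

Lemma cts_shift {V : normedModType R} (f : R -> V) (a t : R) :
  cts f (a + t) -> cts (fun s => f (a + s)) t.
Proof.
move=> H e e0; have [d d0 Hd] := H _ e0; exists d => // s sd; apply: Hd.
by rewrite opprD addrACA subrr add0r.
Qed.

Lemma solves_shift (X : R * R -> R * R) k (a b c : R) : solves X k (c + a) (c + b) ->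
  solves X (fun s => k (c + s)) a b.
Proof.
move=> H t /andP[at_ tb].
have := @is_derive_shift R _ k t c (X (k (c + t))); rewrite addrC => /(_ _) h.
have -> : (fun s => k (c + s)) = (fun s => k (s + c)) by apply/funext => s; rewrite addrC.
by apply: h; apply: H; rewrite !ltrD2l at_.
Qed.

(** Real induction on agreement: from a common point both curves solve one smooth field for a while,
    and limits are handled by continuity. Only the field ahead must be common, so the curves may
    change fields at the line. *)
Lemma forward_unique (k1 k2 : R -> R * R) (T : R) :
  (forall t, 0 <= t <= T -> cts k1 t) -> (forall t, 0 <= t <= T -> cts k2 t) ->
  k1 0 = k2 0 ->
  (forall t : R, 0 <= t < T -> k1 t = k2 t -> exists (X : R * R -> R * R) (d : R),
     [/\ smooth_field X, 0 < d, solves X k1 t (t + d) & solves X k2 t (t + d)]) ->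
  forall t, 0 <= t <= T -> k1 t = k2 t.
Proof.
move=> c1 c2 k0 H; apply: real_induction => // x /andP[x0 xT].
  move=> kx; have x0T : 0 <= x < T by rewrite x0.
  have [X [d [HX d0 s1 s2]]] := H x x0T kx.
  exists d => // w /andP[xw wd] wT.
  have sub k : solves X k x (x + d) -> solves X (fun s => k (x + s)) 0 (w - x).
    move=> sk; apply: solves_shift => t /andP[t1 t2]; apply: sk.
    by move: t1 t2; rewrite addr0 subrKC => -> /=; move/lt_trans; apply.
  have ct (k : R -> R * R) : (forall t, 0 <= t <= T -> cts k t) -> forall t, 0 <= t <= w - x ->
      cts (fun s => k (x + s)) t.
    move=> kc t /andP[t0 tw]; apply/cts_shift/kc.
    by rewrite addr_ge0//= (le_trans _ wT)// -lerBrDl.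
  have wx0 : 0 <= w - x by rewrite subr_ge0 ltW.
  have kk0 : k1 (x + 0) = k2 (x + 0) by rewrite !addr0.
  have := solves_unique HX wx0 (ct _ c1) (ct _ c2) (sub _ s1) (sub _ s2) kk0.
  by rewrite /= subrKC.
move=> lim; apply/eqP; rewrite -subr_eq0 -normr_le0 leNgt; apply/negP => e0.
have xx : 0 <= x <= T by rewrite ltW.
have e2 : 0 < `|k1 x - k2 x| / 2 by rewrite divr_gt0.
have [d1 d10 H1] := c1 x xx _ e2; have [d2 d20 H2] := c2 x xx _ e2.
pose y := Num.max 0 (x - Num.min d1 d2 / 2).
have dm : 0 < Num.min d1 d2 by rewrite lt_min d10.
have yx : y < x by rewrite gt_max x0 ltrBlDr ltrDl divr_gt0.
have yd : x - y < Num.min d1 d2.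
  rewrite ltrBlDl -ltrBlDr lt_max; apply/orP; right; lra.
have ky : k1 y = k2 y by apply: lim; rewrite yx andbT le_max lexx.
have ad : `|y - x| < Num.min d1 d2 by rewrite distrC gtr0_norm ?subr_gt0.
move: ad; rewrite lt_min => /andP[/H1 + /H2]; rewrite -ky => a1 a2.
have := ler_distD (k1 y) (k1 x) (k2 x); rewrite (distrC (k1 x) (k1 y)); lra.
Qed.

(** Regularity is asked of g alone: wherever the curves agree g' inherits it, and both enter the
    half-plane given by [exit_side]. *)
Lemma trajectory_forward_unique Z g g' (t0 t0' : R) : global_trajectory Z g ->
  global_trajectory Z g' -> (forall t, regular_point Z (g t)) -> g t0 = g' t0' ->
  forall t, 0 <= t -> g (t0 + t) = g' (t0' + t).
Proof.
move=> Hg Hg' reg g0 t tpos.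
apply: (@forward_unique (fun s => g (t0 + s)) (fun s => g' (t0' + s)) t); last by rewrite tpos lexx.
- by move=> s _; apply: cts_shift; exact: global_trajectory_cts Hg.
- by move=> s _; apply: cts_shift; exact: global_trajectory_cts Hg'.
- by rewrite !addr0.
move=> s _ E; set b := exit_side Z (g (t0 + s)).
have [d1 d10 H1] := exit_sideP Hg (reg (t0 + s)).
have reg' : regular_point Z (g' (t0' + s)) by rewrite -E.
have [d2 d20 H2] := exit_sideP Hg' reg'.
exists (side_field Z b), (Num.min d1 d2); split.
- exact: side_field_smooth.
- by rewrite lt_min d10.
- apply: solves_shift; apply: trajectory_solves => // x /andP[x1 x2]; apply: H1.
  rewrite x1; apply: lt_le_trans x2 _; rewrite addrA lerD2l.
  by rewrite ge_min lexx.
apply: solves_shift; apply: trajectory_solves => // x /andP[x1 x2]; rewrite /b E; apply: H2.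
rewrite x1; apply: lt_le_trans x2 _; rewrite addrA lerD2l.
by rewrite ge_min lexx orbT.
Qed.

Lemma sgn_inj (b c : bool) (x : R) : 0 < sgn b * x -> 0 < sgn c * x -> b = c.
Proof.
case: b; case: c; rewrite /sgn ?mul1r ?mulN1r ?oppr_gt0 // => h1 h2.
  by have := lt_trans h1 h2; rewrite ltxx.
by have := lt_trans h1 h2; rewrite ltxx.
Qed.

Lemma crossing_sideE Z b y : crossing_point Z y ->
  0 < sgn b * (side_field Z b (0, y)).1 -> crossing_side Z y = b.
Proof. by move=> cr; apply: sgn_inj; exact: crossing_sideP. Qed.

Lemma exit_side_off Z b (z : R * R) : 0 < sgn b * z.1 ->
  exit_side Z z = b /\ regular_point Z z.
Proof.
move=> h; have z0 : z.1 != 0 by apply: contraTneq h => ->; rewrite mulr0 ltxx.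
split; last by move=> z1; rewrite z1 eqxx in z0.
rewrite /exit_side (negbTE z0); case: b h; rewrite /sgn ?mul1r ?mulN1r ?oppr_gt0 => h //.
by apply/negbTE; rewrite -leNgt ltW.
Qed.

Lemma trajectory_follow_arc Z g b (u v T t0 : R) h : global_trajectory Z g ->
  arc (side_field Z b) (sgn b) u v T h -> crossing_point Z u -> g t0 = (0, u) ->
  forall t, 0 <= t <= T -> g (t0 + t) = h t.
Proof.
move=> Hg [T0 [h0 hT] [su _] hd hpos] cr gt0.
have hc t : 0 <= t <= T -> cts h t by move=> /hd; exact: is_derive_cts.
apply: (@forward_unique (fun s => g (t0 + s)) h T) => //.
- by move=> s _; apply: cts_shift; exact: global_trajectory_cts Hg.
- by rewrite addr0 gt0 h0.
move=> t /andP[t1 t2] E.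
have [eb reg] : exit_side Z (g (t0 + t)) = b /\ regular_point Z (g (t0 + t)).
  move: t1; rewrite le_eqVlt => /predU1P[t0E|tpos].
    rewrite E -t0E h0; split; last by [].
    by rewrite /exit_side eqxx; exact: crossing_sideE.
  by apply: exit_side_off; rewrite E; apply: hpos; rewrite tpos.
have [d d0 Hd] := exit_sideP Hg reg.
have tT0 : 0 < T - t by rewrite subr_gt0.
exists (side_field Z b), (Num.min d (T - t)); split.
- exact: side_field_smooth.
- by rewrite lt_min d0.
- apply: solves_shift; apply: trajectory_solves => // x /andP[x1 x2]; rewrite -eb; apply: Hd.
  rewrite x1; apply: lt_le_trans x2 _; rewrite addrA lerD2l.
  by rewrite ge_min lexx.
move=> x /andP[x1 x2]; apply: hd; rewrite (le_trans t1 (ltW x1))/=.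
apply: le_trans (ltW x2) _; rewrite -lerBrDl.
by rewrite ge_min lexx orbT.
Qed.

Lemma arc_unique (X : R * R -> R * R) (s u v v' T T' : R) h h' : smooth_field X ->
  arc X s u v T h -> arc X s u v' T' h' -> T = T' /\ v = v'.
Proof.
move=> HX; wlog TT : v v' T T' h h' / T <= T'.
  move=> H a1 a2; have [TT|/ltW TT] := leP T T'; first exact: (H _ _ _ _ _ _ TT a1 a2).
  by have [-> ->] := H _ _ _ _ _ _ TT a2 a1.
move=> [T0 [h0 hT] _ hd hpos] [T0' [h0' hT'] _ hd' hpos'].
have E : h T = h' T.
  apply: (solves_unique HX (ltW T0)).
  - by move=> t tT; exact: is_derive_cts (hd t tT).
  - by move=> t /andP[t0 tT]; apply: is_derive_cts (hd' t _); rewrite t0 (le_trans tT).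
  - by move=> t /andP[t0 tT]; apply: hd; rewrite !ltW.
  - by move=> t /andP[t0 tT]; apply: hd'; rewrite ltW//= (le_trans (ltW tT)).
  - by rewrite h0 h0'.
move: TT; rewrite le_eqVlt => /predU1P[TT|TT].
  split=> //; move: E; rewrite hT TT hT' => -[]; exact.
have : 0 < s * (h' T).1 by apply: hpos'; rewrite T0.
by rewrite -E hT mulr0 ltxx.
Qed.

(** At the end times g changes fields, so the arc is taken from the truncated flow of the smooth
    field, which equals g in between. The side flips because g arrives from side b and passes
    strictly through the line. *)
Lemma arc_of_trajectory Z g (t t' : R) b : global_trajectory Z g -> t < t' ->
  (g t).1 = 0 -> (g t').1 = 0 -> crossing_point Z (g t).2 -> crossing_point Z (g t').2 ->
  crossing_side Z (g t).2 = b -> (forall s, t < s < t' -> 0 < sgn b * (g s).1) ->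
  crossing_side Z (g t').2 = ~~ b /\
  exists h, arc (side_field Z b) (sgn b) (g t).2 (g t').2 (t' - t) h /\
    forall s, 0 <= s <= t' - t -> h s = g (t + s).
Proof.
move=> Hg tt gt gt' cr cr' sb pos.
have sb' : crossing_side Z (g t').2 = ~~ b.
  have [d d0 Hd] := trajectory_crossing Hg gt' cr'.
  pose s := Num.max ((t + t') / 2) (t' - d / 2).
  have st : t < s < t'.
    by rewrite lt_max gt_max; apply/andP; split; [apply/orP; left|apply/andP; split]; lra.
  have sd : `|s - t'| < d.
    have /andP[_ st'] := st; rewrite ltr0_norm ?subr_lt0// opprB ltrBlDl -ltrBlDr.
    by rewrite lt_max; apply/orP; right; lra.
  have /andP[_ st'] := st; have := (Hd s sd).2 st'; have := pos s st.
  case: (b) (crossing_side Z (g t').2) => -[] //= h1 h2.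
    by have := lt_trans h1 h2; rewrite ltxx.
  by have := lt_trans h1 h2; rewrite ltxx.
split=> //; have gc s : cts (fun x => g (t + x)) s.
  by apply: cts_shift; exact: global_trajectory_cts Hg.
have [r r0 Hr] := cts_bounded (fun s (_ : 0 <= s <= t' - t) => gc s).
have HX := side_field_smooth Z b.
have [phi Hphi] := box_flow_exists HX (ltW r0).
have sol : solves (side_field Z b) (fun x => g (t + x)) 0 (t' - t).
  by apply: solves_shift; apply: trajectory_solves => // s; rewrite addr0 subrKC; exact: pos.
have E := box_flow_unique HX (ltW r0) Hphi (fun s _ => gc s) sol (or_introl Hr).
have gtE := fst0_eq gt; have gtE' := fst0_eq gt'.
exists (phi (g t)); split; last by move=> s /E; rewrite addr0.
have T0 : 0 < t' - t by rewrite subr_gt0.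
split=> //.
- split; first by rewrite (Hphi (g t)).1.
  have TT : 0 <= t' - t <= t' - t by rewrite ltW//= lexx.
  by have := E _ TT; rewrite addr0 subrKC -gtE' => <-.
- split; first by rewrite -sb; exact: crossing_sideP.
  have := crossing_sideP b cr'; rewrite sb'; case: (b); rewrite /sgn /= ?mul1r ?mulN1r ?oppr_gt0//.
  by rewrite oppr_lt0.
- move=> s sT; have := (Hphi (g t)).2 s; rewrite clamp_id//.
  by have := E s sT; rewrite addr0 => <-; exact: Hr.
- move=> s /andP[s0 sT]; have sT' : 0 <= s <= t' - t by rewrite !ltW.
  have := E s sT'; rewrite addr0 => <-; apply: pos.
  by rewrite ltrDl s0/= -ltrBrDl.
Qed.

End Uniqueness.

(** * The nodes of a crossing limit cycle *)

Section CycleNodes.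
Context {R : realType}.
Implicit Types (Z : pw_field R) (g : R -> R * R).

Definition arcs Z (b : bool) (y T : nat -> R) (h : nat -> R -> R * R) :=
  forall i, arc (side_field Z (b (+) odd i)) (sgn (b (+) odd i)) (y i) (y i.+1) (T i) (h i).

(** If no such zero existed, real induction would preserve the strict sign up to t + T0, where
    periodicity brings g back to the line. *)
Lemma next_crossing Z g (t T0 : R) : global_trajectory Z g -> 0 < T0 ->
  (forall s, g (s + T0) = g s) -> (forall s, regular_point Z (g s)) -> (g t).1 = 0 ->
  exists t', [/\ t < t', t' <= t + T0, (g t').1 = 0 &
    forall s, t < s < t' -> 0 < sgn (crossing_side Z (g t).2) * (g s).1].
Proof.
move=> Hg T0p per reg gt; set c := sgn _.
have [d d0 Hd] := trajectory_crossing Hg gt (reg t gt); rewrite -/c in Hd.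
have gc s : cts (fun x => c * (g x).1) s.
  by apply: ctsM; [exact: cts_cst|case/cts_pair: (@global_trajectory_cts R Z g s Hg)].
pose P s := t < s -> 0 < c * (g s).1.
have ext x : t <= x < t + T0 -> P x ->
    exists2 d : R, 0 < d & forall w, x < w < x + d -> w <= t + T0 -> P w.
  move=> /andP[tx _] Px; move: tx; rewrite le_eqVlt => /predU1P[tx|tx].
    exists d => // w; rewrite -tx => /andP[tw wd] _ _.
    by apply: (Hd w _).1 => //; rewrite gtr0_norm ?subr_gt0// ltrBlDl.
  have [e e0 He] := gc x _ (Px tx); exists e => // w /andP[xw we] _ _.
  have := He w; rewrite gtr0_norm ?subr_gt0// ltrBlDl => /(_ we).
  by rewrite ltr_norml => /andP[+ _]; lra.
apply: contrapT => no.
have lim x : t < x <= t + T0 -> (forall y, t <= y < x -> P y) -> P x.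
  move=> /andP[tx xT] Py _; rewrite ltNge; apply/negP => xn; apply: no.
  have Pc y : t < y < x -> 0 < c * (g y).1.
    by move=> /andP[ty yx]; apply: Py => //; rewrite ltW.
  exists x; split => //.
  have : c * (g x).1 = 0.
    apply/le_anti; rewrite xn /= leNgt; apply/negP => xneg.
    have : 0 < - (c * (g x).1) by rewrite oppr_gt0.
    move=> /(gc x)[e e0 He].
    pose y := Num.max ((t + x) / 2) (x - e / 2).
    have yx : y < x by rewrite gt_max; apply/andP; split; lra.
    have ty : t < y by rewrite lt_max; apply/orP; left; lra.
    have ye : `|y - x| < e.
      rewrite ltr0_norm ?subr_lt0// opprB ltrBlDl -ltrBlDr lt_max; apply/orP; right; lra.
    have := Pc y; rewrite ty yx => /(_ isT).
    by have := He y ye; rewrite ltr_norml => /andP[_]; lra.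
  move=> /eqP; rewrite mulf_eq0 -normr_eq0 norm_sgn oner_eq0 /= => /eqP //.
have Pt : P t by rewrite /P ltxx.
have := real_induction Pt ext lim (x := t + T0).
rewrite lexx andbT lerDl ltW// => /(_ isT); rewrite /P per gt mulr0 ltxx ltrDl.
by move=> /(_ T0p).
Qed.

(** The successive crossing times reach [t0 + T0]: otherwise they would accumulate at a time when g
    is on the line, while hits at crossing points are isolated in time. The sides alternate, so the
    number of nodes is even. *)
Lemma crossing_cycle_nodes Z C : crossing_limit_cycle Z C ->
  exists (N : nat) (y T : nat -> R) (h : nat -> R -> R * R),
    [/\ (0 < N)%N /\ ~~ odd N, forall i, y (i + N)%N = y i,
      forall i j, (i < N)%N -> (j < N)%N -> y i = y j -> i = j,
      arcs Z false y T h & forall i t, 0 <= t <= T i -> C (h i t)].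
Proof.
move=> [[[g [T0 [Hg [T0p per] _ ->]]] _] [z [[tz _ tzE] zS]] _ cr].
have reg s : regular_point Z (g s).
  by move=> gs; apply: cr; rewrite -(fst0_eq gs); exists s.
have ex t : exists t', (g t).1 = 0 -> [/\ t < t', t' <= t + T0, (g t').1 = 0 &
    forall s, t < s < t' -> 0 < sgn (crossing_side Z (g t).2) * (g s).1].
  have [gt|] := eqVneq (g t).1 0; last by move=> /eqP h; exists 0.
  by have [t' Ht'] := next_crossing Hg T0p per reg gt; exists t'.
have [N0 HN0] := choice ex.
have gtz : (g tz).1 = 0 by rewrite tzE.
have step t b : (g t).1 = 0 -> crossing_side Z (g t).2 = b ->
  crossing_side Z (g (N0 t)).2 = ~~ b /\
  exists h, arc (side_field Z b) (sgn b) (g t).2 (g (N0 t)).2 (N0 t - t) h /\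
    forall s, 0 <= s <= N0 t - t -> h s = g (t + s).
  move=> gt sb; have [h1 h2 h3 h4] := HN0 t gt.
  by apply: arc_of_trajectory => //; [exact: reg|exact: reg|rewrite -sb].
(* The numbering starts at a node entering x < 0; the odd arcs are then those in x > 0, which will
   be perturbed. *)
have [t0 [gt0 st0]] : exists t0, (g t0).1 = 0 /\ crossing_side Z (g t0).2 = false.
  case E : (crossing_side Z (g tz).2); last by exists tz.
  by exists (N0 tz); have [] := step tz true gtz E; case: (HN0 tz gtz).
pose tm i := iter i N0 t0.
have gtm i : (g (tm i)).1 = 0 by elim: i => // i IH; have [] := HN0 _ IH.
have stm i : crossing_side Z (g (tm i)).2 = odd i.
  by elim: i => // i IH; have [] := step (tm i) (odd i) (gtm i) IH.
have tlt i : tm i < tm i.+1 by have [] := HN0 _ (gtm i).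
have tmono i j : (i < j)%N -> tm i < tm j.
  elim: j => // j IH; rewrite ltnS leq_eqVlt => /predU1P[->//|/IH h].
  exact: lt_trans h (tlt j).
have tnz i s : tm i < s < tm i.+1 -> (g s).1 <> 0.
  move=> hs gs; have [_ _ _ /(_ s hs)] := HN0 _ (gtm i).
  by rewrite gs mulr0 ltxx.
have [n [n0 tn]] : exists n, (0 < n)%N /\ tm n = t0 + T0.
  apply: contrapT => no.
  have lt i : tm i < t0 + T0.
    elim: i => [|i IH]; first by rewrite /tm /= ltrDl.
    rewrite ltNge le_eqVlt; apply/negP => /predU1P[E|h].
      by apply: no; exists i.+1.
    by apply: (tnz i (t0 + T0)); rewrite ?IH// per.
  pose S := [set tm i | i in setT].
  have hS : has_sup S.
    by split; [exists t0, 0%N|exists (t0 + T0) => _ [i _ <-]; rewrite ltW].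
  pose c := sup S.
  have tc i : tm i < c.
    apply: lt_le_trans (tlt i) _; apply: ub_le_sup; [by case: hS|by exists i.+1].
  have near e : 0 < e -> exists i, c - e < tm i.
    by move=> e0; have [_ [i _ <-] h] := sup_adherent e0 hS; exists i.
  have gc : (g c).1 = 0.
    apply/eqP; rewrite -normr_le0 leNgt; apply/negP => gc0.
    have /cts_pair[+ _] := @global_trajectory_cts R Z g c Hg.
    move=> /(_ _ gc0)[d d0 Hd]; have [i ci] := near d d0.
    have := Hd (tm i); rewrite ltr0_norm ?subr_lt0// gtm sub0r normrN ltxx.
    by rewrite opprB ltrBlDl -ltrBlDr => /(_ ci).
  have [d d0 Hd] := trajectory_crossing Hg gc (reg c gc).
  have [i ci] := near d d0.
  have := (Hd (tm i) _).2 (tc i); rewrite gtm mulr0 ltxx.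
  by rewrite ltr0_norm ?subr_lt0// opprB ltrBlDl -ltrBlDr => /(_ ci).
pose Y i := (g (tm i)).2.
have exN : exists n, (0 < n)%N && (Y n == Y 0%N).
  by exists n; rewrite n0 /Y tn per eqxx.
(* [T0] may be a multiple of the minimal period, so the first return to the starting node is taken;
   this makes the nodes distinct. *)
case: (ex_minnP exN) => N /andP[N0p /eqP YN] Nmin.
have oddN : ~~ odd N by rewrite -(stm N) -/(Y N) YN /Y stm.
have gE i : g (tm i) = (0, Y i) by exact: fst0_eq.
have hex i : exists h, arc (side_field Z (odd i)) (sgn (odd i)) (Y i) (Y i.+1) (tm i.+1 - tm i) h /\
    forall s, 0 <= s <= tm i.+1 - tm i -> h s = g (tm i + s).
  by have [_] := step (tm i) (odd i) (gtm i) (stm i).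
have [H HH] := choice hex.
exists N, (fun i => Y (i %% N)%N), (fun i => tm (i %% N).+1 - tm (i %% N)%N),
  (fun i => H (i %% N)%N).
have succ i : Y (i.+1 %% N)%N = Y (i %% N).+1.
  rewrite -addn1 -modnDml addn1; have : ((i %% N).+1 <= N)%N by rewrite ltn_mod.
  rewrite leq_eqVlt => /predU1P[->|h]; first by rewrite modnn.
  by rewrite modn_small.
split => //.
- by move=> i; rewrite modnDr.
- move=> i j iN jN; rewrite !modn_small// => Yij; apply: contrapT => /eqP ij.
  wlog ltij : i j iN jN Yij ij / (i < j)%N.
    move=> Hw; move: (ij); rewrite neq_ltn => /orP[] h; first exact: (Hw i j).
    by apply: (Hw j i) => //; rewrite eq_sym.
  have fwd k : Y (i + k)%N = Y (j + k)%N.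
    elim: k => [|k IH]; first by rewrite !addn0.
    have [[a1 _] [a2 _]] := (HH (i + k)%N, HH (j + k)%N).
    have odk : odd (i + k) = odd (j + k) by rewrite -!stm -/(Y _) IH.
    rewrite !addnS; rewrite IH odk in a1.
    by have [_] := arc_unique (side_field_smooth Z _) a1 a2.
  (* A repetition i < j would shorten the cycle: the node of index i + (N - j) would already be the
     starting one. *)
  have := fwd (N - j)%N; rewrite subnKC ?(ltnW jN)// YN => E.
  have : (N <= i + (N - j))%N by apply: Nmin; rewrite E eqxx andbT addn_gt0 subn_gt0 jN orbT.
  by rewrite leqNgt -[X in (_ < X)%N](subnKC (ltnW jN)) ltn_add2r ltij.
- move=> i /=; rewrite succ.
  have -> : odd i = odd (i %% N) by rewrite odd_mod//; exact/negbTE.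
  exact: (HH (i %% N)%N).1.
- move=> i t tT; by rewrite (HH (i %% N)%N).2//; exists (tm (i %% N)%N + t).
Qed.

End CycleNodes.

(** * Gluing arcs into periodic Filippov orbits *)

Section Concatenation.
Context {R : realType}.
Implicit Types (Z : pw_field R) (g : R -> R * R).

Lemma lipschitz_trajectory Z g (a b M : R) (E : set R) : 0 <= M ->
  (forall s t, a <= s -> s <= t -> t <= b -> `|g t - g s| <= M * (t - s)) ->
  countable E ->
  (forall t : R, a < t < b -> ~ E t ->
     exists2 v, filippov Z (g t) v & is_derive t (1 : R) g v) ->
  trajectory Z a b g.
Proof.
move=> M0 lip cE der; split.
  move=> e e0; exists (e / (M + 1)) => [|n s t st _ sum].
    by rewrite divr_gt0// ltr_wpDl.
  apply: (@le_lt_trans _ _ (\sum_(i < n) M * (t i - s i))).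
    by apply: ler_sum => i _; have [h1 h2 h3] := st i; exact: lip.
  rewrite -mulr_sumr; move: sum; rewrite ltr_pdivlMr ?ltr_wpDl//.
  have : 0 <= \sum_(i < n) (t i - s i).
    by apply: sumr_ge0 => i _; have [_ h _] := st i; rewrite subr_ge0.
  lra.
have mE : measurable E by apply: countable_measurable => // t; exact: measurable_set1.
exists E; split => //; first exact: countable_lebesgue_measure0.
move=> t /= H; apply: contrapT => nE; apply: H => tab; exact: der.
Qed.

(** More than a trajectory on [0, T]: a Lipschitz bound and finitely many exceptional times survive
    concatenation and periodic extension by direct estimates. *)
Definition piecewise_orbit Z (T : R) g := [/\ 0 < T,
  exists2 M : R, 0 <= M & forall s t, 0 <= s -> s <= t -> t <= T ->
    `|g t - g s| <= M * (t - s) &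
  exists E : seq R, forall t : R, 0 < t < T -> t \notin E ->
     exists2 v, filippov Z (g t) v & is_derive t (1 : R) g v].

Lemma piecewise_orbit_trajectory Z T g : piecewise_orbit Z T g ->
  trajectory Z 0 T g.
Proof.
move=> [T0 [M M0 lip] [E der]].
apply: (@lipschitz_trajectory _ _ _ _ M [set` E]) => //.
  by apply: finite_set_countable; exact: finite_seq.
by move=> t tT /negP tE; apply: der.
Qed.

Lemma arc_piecewise_orbit Z b (u v T : R) h :
  arc (side_field Z b) (sgn b) u v T h -> piecewise_orbit Z T h.
Proof.
move=> [T0 _ _ hd hpos]; split => //.
  have hc t : 0 <= t <= T -> cts (fun s => side_field Z b (h s)) t.
    move=> /hd /is_derive_cts; apply: smooth_field_cts; exact: side_field_smooth.
  have [M M0 HM] := cts_bounded hc.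
  exists M => [|s t s0 st tT]; first exact: ltW.
  have i x : s <= x <= t -> 0 <= x <= T.
    by move=> /andP[h1 h2]; rewrite (le_trans s0)//= (le_trans h2).
  have i' x : s < x < t -> 0 <= x <= T.
    by move=> /andP[h1 h2]; apply: i; rewrite !ltW.
  have c x (sx : s <= x <= t) := (cts_pair h x).1 (is_derive_cts (hd x (i x sx))).
  have d x (sx : s < x < t) := (is_derive_pair h x _).1 (hd x (i' x sx)).
  apply: norm_le_pair.
    apply: (mvt_norm st (fun x sx => (c x sx).1) (fun x sx => (d x sx).1)) => x /i' xT.
    by apply: le_trans (HM x xT); exact: (norm_ge (side_field Z b (h x))).1.
  apply: (mvt_norm st (fun x sx => (c x sx).2) (fun x sx => (d x sx).2)) => x /i' xT.
  by apply: le_trans (HM x xT); exact: (norm_ge (side_field Z b (h x))).2.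
exists [::] => t tT _; exists (side_field Z b (h t)); last first.
  by apply: hd; case/andP: tT => /ltW -> /ltW ->.
have := hpos t tT; rewrite /side_field /sgn; case: (b).
  by rewrite mul1r => h0; apply: Or31.
by rewrite mulN1r oppr_gt0 => h0; apply: Or32.
Qed.

Definition concat (T : R) (g1 g2 : R -> R * R) t :=
  if t <= T then g1 t else g2 (t - T).

Lemma concat_piecewise_orbit Z (T1 T2 : R) g1 g2 : piecewise_orbit Z T1 g1 ->
  piecewise_orbit Z T2 g2 -> g1 T1 = g2 0 ->
  piecewise_orbit Z (T1 + T2) (concat T1 g1 g2).
Proof.
move=> [T10 [M1 M10 lip1] [E1 der1]] [T20 [M2 M20 lip2] [E2 der2]] glue.
split; first exact: addr_gt0.
  exists (M1 + M2) => [|s t s0 st tT]; first exact: addr_ge0.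
  have up x y : `|x| <= M1 * y -> 0 <= y -> `|x : R * R| <= (M1 + M2) * y.
    by move=> h y0; apply: le_trans h _; rewrite ler_wpM2r// lerDl.
  have up' x y : `|x| <= M2 * y -> 0 <= y -> `|x : R * R| <= (M1 + M2) * y.
    by move=> h y0; apply: le_trans h _; rewrite ler_wpM2r// lerDr.
  rewrite /concat; have [tT1|T1t] := leP t T1.
    by rewrite (le_trans st tT1); apply: up; [exact: lip1|rewrite subr_ge0].
  have [sT1|T1s] := leP s T1; last first.
    apply: up'; last by rewrite subr_ge0.
    have -> : t - s = (t - T1) - (s - T1) by ring.
    by apply: lip2; rewrite ?subr_ge0 ?lerD2r ?(ltW T1s)// lerBlDl.
  apply: le_trans (ler_distD (g2 0) _ _) _.
  have -> : (M1 + M2) * (t - s) = (M1 + M2) * (t - T1) + (M1 + M2) * (T1 - s) by ring.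
  have tT1 : 0 <= t - T1 by rewrite subr_ge0 ltW.
  apply: lerD.
    apply: up' => //; rewrite -[X in M2 * X]subr0; apply: lip2 => //.
    by rewrite lerBlDl.
  by rewrite -glue; apply: up; [exact: lip1|rewrite subr_ge0].
exists (T1 :: E1 ++ [seq x + T1 | x <- E2]) => t /andP[t0 tT].
rewrite inE mem_cat !negb_or => /and3P[tT1 tE1 tE2].
have [lt|gt|eq] := ltgtP t T1; last by rewrite eq eqxx in tT1.
  have [|v fv dv] := der1 t _ tE1; first by rewrite t0.
  exists v; first by rewrite /concat ltW.
  apply: near_eq_is_derive dv.
  have : \forall s \near t, s < T1 by exact: lt_nbhsl.
  by apply: filterS => s sT; rewrite /concat ltW.
have [||v fv dv] := der2 (t - T1).
- by rewrite subr_gt0 gt ltrBlDl.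
- by apply: contra tE2 => h; apply/mapP; exists (t - T1); rewrite ?subrK.
exists v; first by rewrite /concat leNgt gt.
have := @is_derive_shift R _ g2 t (- T1) v dv.
apply: near_eq_is_derive.
have : \forall s \near t, T1 < s by exact: lt_nbhsr.
by apply: filterS => s sT; rewrite /concat leNgt sT.
Qed.

Lemma arcs_concat Z b y T h (n : nat) :
  (forall i, (i <= n)%N -> arc (side_field Z (b (+) odd i)) (sgn (b (+) odd i))
     (y i) (y i.+1) (T i) (h i)) ->
  exists (g : R -> R * R) (L : R), [/\ piecewise_orbit Z L g,
    g 0 = (0, y 0%N) /\ g L = (0, y n.+1),
    forall t, 0 < t < L -> (g t).1 = 0 -> exists2 i, (0 < i <= n)%N & g t = (0, y i),
    forall t, 0 <= t <= L -> exists i t', [/\ (i <= n)%N, 0 <= t' <= T i & g t = h i t'] &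
    exists2 t, 0 < t < L & (g t).1 <> 0].
Proof.
elim: n => [|n IH] Harcs.
  have Ha := Harcs 0%N isT; have Hb := arc_piecewise_orbit Ha.
  have [T0 [h0 hT] _ _ hpos] := Ha.
  have nz t : 0 < t < T 0%N -> (h 0%N t).1 <> 0.
    by move=> /hpos h1 h2; rewrite h2 mulr0 ltxx in h1.
  exists (h 0%N), (T 0%N); split => //.
  - by move=> t /nz.
  - by move=> t tT; exists 0%N, t.
  - by exists (T 0%N / 2); [|apply: nz]; apply/andP; split; lra.
have [g [L [Hg [g0 gL] gz gr [tn tnL gtn]]]] := IH (fun i h => Harcs i (leqW h)).
have Ha := Harcs n.+1 (leqnn _); have Hb := arc_piecewise_orbit Ha.
have [T0 [h0 hT] _ _ hpos] := Ha.
have L0 : 0 < L by case: Hg.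
exists (concat L g (h n.+1)), (L + T n.+1); split.
- by apply: concat_piecewise_orbit => //; rewrite gL h0.
- split; first by rewrite /concat ltW.
  by rewrite /concat leNgt ltrDl T0 /= addrAC subrr add0r.
- move=> t /andP[t0 tL]; rewrite /concat; have [tL'|Lt] := leP t L.
    move: tL'; rewrite le_eqVlt => /predU1P[->|tL'] gt0.
      by exists n.+1; rewrite ?gL ?leqnn.
    have [|i /andP[i0 il] ->] := gz t _ gt0; first by rewrite t0.
    by exists i; rewrite // i0 leqW.
  move=> hz; have : 0 < t - L < T n.+1 by rewrite subr_gt0 Lt ltrBlDl.
  by move=> /hpos; rewrite hz mulr0 ltxx.
- move=> t /andP[t0 tL]; rewrite /concat; have [tL'|Lt] := leP t L.
    have [|i [t' [il t'T ->]]] := gr t; first by rewrite t0.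
    by exists i, t'; rewrite leqW.
  by exists n.+1, (t - L); rewrite leqnn subr_ge0 (ltW Lt) lerBlDl tL.
exists tn; last by case/andP: tnL => _ /ltW h1; rewrite /concat h1.
by case/andP: tnL => -> h1 /=; rewrite (lt_le_trans h1)// lerDl ltW.
Qed.

Lemma piecewise_orbit_periodic Z L g : piecewise_orbit Z L g -> g L = g 0 ->
  (exists2 t, 0 < t < L & g t <> g 0) ->
  periodic_orbit Z (g @` [set t | 0 <= t <= L]).
Proof.
move=> [L0 [M M0 lip] [E der]] gL [tn tnL gtn].
have Ln : L != 0 by rewrite gt_eqF.
pose fl t : int := Num.floor (t / L).
pose rm t := t - L * (fl t)%:~R.
have rmP t : 0 <= rm t < L.
  have /andP[h1 h2] := floor_itv (t / L).
  rewrite /rm subr_ge0 ltrBlDr mulrC -ler_pdivlMr// h1 /=.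
  move: h2; rewrite ltr_pdivrMr// intrD mulrDl mul1r.
  by rewrite addrC mulrC.
have rmE t (k : int) : L * k%:~R <= t < L * k%:~R + L -> fl t = k /\ rm t = t - L * k%:~R.
  move=> /andP[h1 h2]; have E1 : fl t = k.
    apply: floor_def; rewrite ler_pdivlMr// ltr_pdivrMr// intrD mulrDl mul1r.
    by rewrite mulrC h1.
  by rewrite /rm E1.
pose G t := g (rm t).
have Gend k : G (L * k%:~R) = g L.
  have [|_ e] := rmE (L * k%:~R) k; first by rewrite lexx ltrDl.
  by rewrite /G e subrr gL.
have base k s t : L * k%:~R <= s -> s <= t -> t <= L * k%:~R + L ->
    `|G t - G s| <= M * (t - s).
  move=> h1 h2 h3.
  have val x : L * k%:~R <= x -> x <= L * k%:~R + L -> G x = g (x - L * k%:~R).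
    move=> x1; rewrite le_eqVlt => /predU1P[->|x2].
      have -> : L * k%:~R + L = L * (k + 1)%:~R by rewrite intrD; ring.
      rewrite Gend; congr g; rewrite intrD; ring.
    by have [|_ e] := rmE x k; rewrite ?x1 ?x2 // /G e.
  rewrite (val s) ?(le_trans h2)// (val t) ?(le_trans h1)//.
  have -> : t - s = (t - L * k%:~R) - (s - L * k%:~R) by ring.
  by apply: lip; rewrite ?subr_ge0 ?lerD2r// lerBlDl.
have glip s t : s <= t -> `|G t - G s| <= M * (t - s).
  (* Induction on the number of period boundaries between s and t, passing through the first
     multiple [m] of [L] after s. *)
  have [n] : exists n : nat, fl t <= fl s + n%:Z.
    by exists `|fl t - fl s|%N; rewrite -lerBlDl; apply: le_trans (ler_norm _) _; rewrite -abszE.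
  elim: n s => [|n IH] s ft st.
    have /andP[s1 _] := rmP s; have /andP[_ t2] := rmP t.
    apply: (base (fl s)) => //; first by rewrite -subr_ge0.
    move: t2; rewrite ltrBlDl => /ltW h; apply: le_trans h _.
    by rewrite lerD2r ler_pM2l// ler_int; rewrite addr0 in ft.
  have /andP[s1 s2] := rmP s.
  pose m := L * (fl s + 1)%:~R.
  have mE : m = L * (fl s)%:~R + L by rewrite /m intrD; ring.
  have sm : s <= m by rewrite mE -lerBlDl ltW.
  have [tm|mt] := leP t m.
    by apply: (base (fl s)) => //; rewrite -?mE// -subr_ge0.
  have fm : fl m = fl s + 1.
    by have [|] := rmE m (fl s + 1) => //; rewrite lexx ltrDl.
  apply: le_trans (ler_distD (G m) _ _) _.
  have -> : M * (t - s) = M * (t - m) + M * (m - s) by ring.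
  apply: lerD; last by apply: (base (fl s)) => //; rewrite -?mE// -subr_ge0.
  by apply: IH; [rewrite fm -addrA -intS|exact: ltW].
(* The multiples of [L] are exceptional too, as the two ends of g need not join smoothly. *)
pose E' : set R := \bigcup_(k in [set: int]) \bigcup_(e in [set` 0 :: E]) [set e + L * k%:~R].
have cE' : countable E'.
  apply: bigcup_countable => // k _; apply: bigcup_countable.
    by apply: finite_set_countable; exact: finite_seq.
  by move=> e _; exact: countable1.
exists G, L; split.
- move=> a b; apply: (@lipschitz_trajectory Z G a b M E' M0) => //.
    by move=> s t _ st _; exact: glip.
  move=> t _ tE.
  have tdec : t = rm t + L * (fl t)%:~R by rewrite /rm subrK.
  have nE : rm t \notin 0 :: E.
    by apply/negP => h; apply: tE; exists (fl t) => //; exists (rm t).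
  move: nE; rewrite inE negb_or => /andP[r0 rE].
  have /andP[r1 r2] := rmP t.
  have rpos : 0 < rm t by rewrite lt_neqAle eq_sym r0.
  have [|v fv dv] := der (rm t) _ rE; first by rewrite rpos.
  exists v => //.
  have := @is_derive_shift R _ g t (- (L * (fl t)%:~R)) v dv.
  apply: near_eq_is_derive.
  have h1 : \forall s \near t, L * (fl t)%:~R < s.
    by apply: lt_nbhsr; rewrite -subr_gt0.
  have h2 : \forall s \near t, s < L * (fl t)%:~R + L.
    by apply: lt_nbhsl; rewrite -ltrBlDl.
  apply: filterS2 h1 h2 => s s1 s2.
  by have [|_ e] := rmE s (fl t); rewrite ?(ltW s1) ?s2 // /G e.
- split=> // t; rewrite /G; congr g; rewrite /rm /fl.
  rewrite mulrDl divff// floorDrz ?int_num1// floor1 intrD; ring.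
- have v x : 0 <= x < L -> G x = g x.
    by move=> xL; have [|_ e] := rmE x 0; rewrite ?mulr0 ?add0r // /G e mulr0 subr0.
  exists tn; rewrite !v ?lexx//.
  by case/andP: tnL => /ltW -> ->.
- rewrite predeqE => z; split.
    move=> [t /andP[t0 +] <-]; rewrite le_eqVlt => /predU1P[->|tL].
      by exists 0 => //; rewrite -[in G _](mulr0 L) (Gend 0).
    exists t => //; have [|_ e] := rmE t 0; rewrite ?mulr0 ?add0r ?t0 // /G e.
    by rewrite mulr0 subr0.
  by move=> [t _ <-]; exists (rm t) => //=; have /andP[-> /ltW] := rmP t.
Qed.

End Concatenation.

(** * Return maps, limit cycles and hyperbolicity *)

Section ReturnChains.
Context {R : realType}.
Implicit Types (Z : pw_field R) (g : R -> R * R).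

Lemma finite_min (N : nat) (P : nat -> R -> Prop) :
  (forall i d d', 0 < d' -> d' <= d -> P i d -> P i d') ->
  (forall i, (i < N)%N -> exists2 d : R, 0 < d & P i d) ->
  exists2 d : R, 0 < d & forall i, (i < N)%N -> P i d.
Proof.
move=> mono; elim: N => [|N IH] H; first by exists 1.
have [d d0 Hd] := IH (fun i h => H i (leqW h)).
have [d' d'0 Hd'] := H N (leqnn _).
have m0 : 0 < Num.min d d' by rewrite lt_min d0.
exists (Num.min d d') => // i; rewrite ltnS leq_eqVlt => /predU1P[->|/Hd].
  by apply: mono Hd' => //; rewrite ge_min lexx orbT.
by apply: mono => //; rewrite ge_min lexx.
Qed.

Lemma periodic_modn (T : Type) (N : nat) (u : nat -> T) :
  (forall i, u (i + N)%N = u i) -> forall i, u i = u (i %% N)%N.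
Proof.
move=> per i; rewrite {1}(divn_eq i N) addnC.
elim: (i %/ N)%N => [|k IH]; first by rewrite mul0n addn0.
by rewrite mulSn addnCA addnC per.
Qed.

Lemma periodic_prod (N : nat) (a : nat -> R) (j : nat) :
  (forall i, a (i + N)%N = a i) -> \prod_(i < N) a (j + i)%N = \prod_(i < N) a i.
Proof.
move=> per; elim: j => [//|j <-].
case: N per => [|N] per; first by rewrite !big_ord0.
rewrite big_ord_recr [in RHS]big_ord_recl /= addn0 addSnnS per mulrC.
by congr (_ * _); apply: eq_bigr => i _; rewrite addSnnS.
Qed.

(** What a cycle must offer to be recognised as a hyperbolic limit cycle: arcs from all points near
    the nodes, but expansions at the nodes only. Indices run over all naturals with period N, so
    that the starting node can be rotated. *)
Record return_chain Z (N : nat) (b : bool) (v : nat -> R) (f : nat -> R -> R)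
    (a : nat -> R) (rho C : R) : Prop := ReturnChain {
  chain_size : (0 < N)%N;
  chain_even : ~~ odd N;
  chain_rho : 0 < rho;
  chain_C : 0 < C;
  chain_v_per : forall i, v (i + N)%N = v i;
  chain_f_per : forall i, f (i + N)%N = f i;
  chain_a_per : forall i, a (i + N)%N = a i;
  chain_inj : forall i j, (i < N)%N -> (j < N)%N -> v i = v j -> i = j;
  chain_arc : forall i u, `|u - v i| <= rho -> exists T h,
    arc (side_field Z (b (+) odd i)) (sgn (b (+) odd i)) u (f i u) T h;
  chain_node : forall i, f i (v i) = v i.+1;
  chain_taylor : forall i u, `|u - v i| <= rho ->
    `|f i u - v i.+1 - a i * (u - v i)| <= C * (u - v i) ^+ 2;
  chain_neg : forall i, a i < 0
}.

Fixpoint iterate_chain (f : nat -> R -> R) (j n : nat) (u : R) : R :=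
  if n is m.+1 then f (j + m)%N (iterate_chain f j m u) else u.

(** Hyperbolicity speaks of every point of the cycle on the line; rotation reduces all of them to
    node 0. *)
Lemma return_chain_shift Z N b v f a rho C j : return_chain Z N b v f a rho C ->
  return_chain Z N (b (+) odd j) (fun i => v (j + i)%N) (fun i => f (j + i)%N)
    (fun i => a (j + i)%N) rho C.
Proof.
move=> H; split.
- exact: chain_size H.
- exact: chain_even H.
- exact: chain_rho H.
- exact: chain_C H.
- by move=> i; rewrite addnA (chain_v_per H).
- by move=> i; rewrite addnA (chain_f_per H).
- by move=> i; rewrite addnA (chain_a_per H).
- move=> i k iN kN; rewrite (periodic_modn (chain_v_per H)) [RHS](periodic_modn (chain_v_per H)).
  move=> /(chain_inj H); rewrite !ltn_mod (chain_size H) => /(_ isT isT) /eqP.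
  by rewrite eqn_modDl !modn_small// => /eqP.
- move=> i u /(chain_arc H); rewrite oddD addbA; exact.
- by move=> i; rewrite (chain_node H) addnS.
- by move=> i u /(chain_taylor H); rewrite addnS.
- by move=> i; exact: chain_neg H _.
Qed.

Section Chain.
Variables (Z : pw_field R) (N : nat) (b : bool) (v : nat -> R) (f : nat -> R -> R).
Variables (a : nat -> R) (rho C : R).
Hypothesis H : return_chain Z N b v f a rho C.

Let N0 : (0 < N)%N := chain_size H.
Let Neven : ~~ odd N := chain_even H.
Let rho0 : 0 < rho := chain_rho H.
Let C0 : 0 < C := chain_C H.

Lemma chain_mod i : v i = v (i %% N)%N.
Proof. exact: periodic_modn (chain_v_per H) i. Qed.

(** One normal velocity gets its sign from the arc leaving the node, the other from the arc arriving
    there. The latter has index i + N - 1 and, as N is even, lies on the other side. *)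
Lemma chain_crossing i : crossing_point Z (v i).
Proof.
have rr (u : R) : `|u - u| <= rho by rewrite subrr normr0 ltW.
have [T [h [_ _ [h1 _] _ _]]] := chain_arc H (rr (v i)).
have [T' [h' [_ _ [_ h2] _ _]]] := chain_arc H (rr (v (i + N.-1)%N)).
move: h2; rewrite (chain_node H) -addnS prednK// (chain_v_per H).
have -> : odd (i + N.-1) = ~~ odd i.
  rewrite oddD -(negbK (odd N.-1)) -oddS prednK// (negbTE Neven) addbT.
  by case: (odd i).
move: h1; rewrite addbN /crossing_point /side_field /sgn.
case: (b (+) odd i); rewrite /= ?mul1r ?mulN1r ?oppr_gt0 ?oppr_lt0.
  by move=> p q; rewrite mulr_gt0.
by move=> p q; rewrite nmulr_rgt0.
Qed.

Lemma chain_lipschitz : exists2 L : R, 1 <= L & forall i u, `|u - v i| <= rho ->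
  `|f i u - v i.+1| <= L * `|u - v i|.
Proof.
have [A A0 HA] : exists2 A : R, 0 < A & forall i, (i < N)%N -> A <= `|a i|^-1.
  apply: (@finite_min N (fun i d => d <= `|a i|^-1)).
    by move=> i d d' _ dd; exact: le_trans dd.
  by move=> i _; exists `|a i|^-1; rewrite // invr_gt0 normr_gt0 lt_eqF// (chain_neg H).
exists (1 + A^-1 + C * rho) => [|i u ur].
  by rewrite -addrA lerDl addr_ge0// ?invr_ge0 ?mulr_ge0 ?ltW.
have ai : `|a i| <= A^-1.
  rewrite (periodic_modn (chain_a_per H)).
  rewrite -(invrK `|_|) lef_pV2 ?posrE ?invr_gt0 ?normr_gt0 ?lt_eqF ?(chain_neg H)//.
  by apply: HA; rewrite ltn_mod.
have -> : f i u - v i.+1 = (f i u - v i.+1 - a i * (u - v i)) + a i * (u - v i) by rewrite subrK.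
apply: le_trans (ler_normD _ _) _; rewrite normrM.
have h1 := chain_taylor H ur.
have h2 : C * (u - v i) ^+ 2 <= C * rho * `|u - v i|.
  by rewrite -real_normK ?num_real// expr2 mulrA ler_wpM2r// ler_pM2l.
have h3 : `|a i| * `|u - v i| <= A^-1 * `|u - v i| by rewrite ler_wpM2r.
have := normr_ge0 (u - v i); rewrite !mulrDl mul1r; move: h1 h2 h3; lra.
Qed.

Lemma chain_gap : exists2 d : R, 0 < d & forall i j, v i <> v j -> d <= `|v i - v j|.
Proof.
have [d d0 Hd] : exists2 d : R, 0 < d & forall i, (i < N)%N ->
    forall j, (j < N)%N -> v i <> v j -> d <= `|v i - v j|.
  apply: (@finite_min N (fun i d => forall j, (j < N)%N -> v i <> v j -> d <= `|v i - v j|)).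
    by move=> i d d' _ dd Hd j jN ij; apply: le_trans dd (Hd j jN ij).
  move=> i iN.
  apply: (@finite_min N (fun j d => v i <> v j -> d <= `|v i - v j|)).
    by move=> j d d' _ dd Hd ij; apply: le_trans dd (Hd ij).
  move=> j jN; have [->|/eqP ij] := eqVneq (v i) (v j); first by exists 1.
  by exists `|v i - v j|; rewrite // normr_gt0 subr_eq0; apply/eqP.
by exists d => // i j; rewrite (chain_mod i) (chain_mod j); apply: Hd; rewrite ltn_mod.
Qed.

Lemma chain_crossing_near : exists2 d : R, 0 < d & forall i u, `|u - v i| <= d ->
  crossing_point Z u.
Proof.
have [d d0 Hd] : exists2 d : R, 0 < d & forall i, (i < N)%N ->
    forall u, `|u - v i| <= d -> crossing_point Z u.
  apply: (@finite_min N (fun i d => forall u, `|u - v i| <= d -> crossing_point Z u)).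
    by move=> i d d' _ dd Hd u ud; apply: Hd; exact: le_trans dd.
  move=> i _; have cr := chain_crossing i.
  have cP (c : bool) : cts (fun u => (side_field Z c (0, u)).1) (v i).
    have cid : cts (fun u : R => (0, u) : R * R) (v i).
      by move=> e e0; exists e => // s; rewrite norm_section.
    by case/cts_pair: (smooth_field_cts (side_field_smooth Z c) cid).
  have cc := ctsM (cP true) (cP false).
  have [d d0 Hd] := cc _ cr; exists (d / 2) => [|u ud]; first by rewrite divr_gt0.
  have := Hd u; rewrite /crossing_point => /(_ _) h.
  have {}h : `|u - v i| < d by apply: le_lt_trans ud _; rewrite ltr_pdivrMr// ltr_pMr// ltr1n.
  move: (Hd u h); rewrite ltr_norml => /andP[+ _]; rewrite /side_field /=.
  set x := _ * _; set y := _ * _; lra.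
by exists d => // i; rewrite (chain_mod i); apply: Hd; rewrite ltn_mod.
Qed.

Lemma iterate_near n (e : R) : 0 < e -> exists2 d : R, 0 < d & forall j u m, (m <= n)%N ->
  `|u - v j| <= d -> `|iterate_chain f j m u - v (j + m)%N| <= e.
Proof.
move=> e0; have [L L1 HL] := chain_lipschitz.
have L0 : 0 < L by exact: lt_le_trans L1.
pose e' := Num.min e rho; have e'0 : 0 < e' by rewrite lt_min e0.
exists (e' / L ^+ n) => [|j u m mn ud]; first by rewrite divr_gt0// exprn_gt0.
suff : `|iterate_chain f j m u - v (j + m)%N| <= L ^+ m * `|u - v j|.
  move=> h; apply: le_trans h _; apply: (@le_trans _ _ e'); last by rewrite ge_min lexx.
  apply: (@le_trans _ _ (L ^+ n * (e' / L ^+ n))).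
    by apply: ler_pM => //; [rewrite exprn_ge0// ltW|exact: ler_weXn2l].
  by rewrite mulrCA divff ?mulr1// expf_neq0// gt_eqF.
elim: m mn => [|m IH] mn /=; first by rewrite addn0 expr0 mul1r.
have im := IH (ltnW mn).
have ir : `|iterate_chain f j m u - v (j + m)%N| <= rho.
  apply: le_trans im _; apply: (@le_trans _ _ e'); last by rewrite ge_min lexx orbT.
  apply: (@le_trans _ _ (L ^+ n * (e' / L ^+ n))).
    by apply: ler_pM => //; [rewrite exprn_ge0// ltW|rewrite ler_weXn2l// ltnW].
  by rewrite mulrCA divff ?mulr1// expf_neq0// gt_eqF.
rewrite addnS; apply: le_trans (HL _ _ ir) _.
by rewrite exprS -mulrA ler_pM2l.
Qed.

Lemma iterate_taylor n : exists2 d : R, 0 < d & exists2 D : R, 0 < D &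
  forall j u, `|u - v j| <= d ->
  `|iterate_chain f j n u - v (j + n)%N - (\prod_(i < n) a (j + i)%N) * (u - v j)|
    <= D * (u - v j) ^+ 2.
Proof.
elim: n => [|n [d d0 [D D0 IH]]].
  exists 1 => //; exists 1 => // j u _.
  by rewrite /= addn0 big_ord0 mul1r subrr normr0 mul1r sqr_ge0.
have [L L1 HL] := chain_lipschitz; have L0 : 0 < L by exact: lt_le_trans L1.
have [d1 d10 Hd1] := iterate_near n.+1 rho0.
(* The slopes are recovered from the Lipschitz bound at distance [rho], with one bound for all i. *)
have aL i : `|a i| <= L + C * rho.
  have ur : `|v i + rho - v i| <= rho by rewrite addrAC subrr add0r gtr0_norm.
  have h1 := HL i _ ur; have h2 := chain_taylor H ur.
  move: h1 h2; have -> : v i + rho - v i = rho by ring.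
  move=> h1 h2; rewrite (gtr0_norm rho0) in h1.
  have h3 : `|a i * rho| <= L * rho + C * rho ^+ 2.
    have -> : a i * rho =
      (f i (v i + rho) - v i.+1) - (f i (v i + rho) - v i.+1 - a i * rho) by ring.
    apply: le_trans (ler_normB _ _) _; exact: lerD.
  rewrite normrM (gtr0_norm rho0) in h3.
  by rewrite -(ler_pM2r rho0) mulrDl -mulrA -expr2.
have B0 : 0 < L + C * rho by rewrite addr_gt0// mulr_gt0.
have lin m j u : (m <= n)%N -> `|u - v j| <= d1 ->
    `|iterate_chain f j m u - v (j + m)%N| <= L ^+ m * `|u - v j|.
  move=> mn ud; elim: m mn => [|m IHm] mn; first by rewrite /= addn0 expr0 mul1r.
  rewrite /= addnS; apply: le_trans (HL _ _ _) _; first by apply: Hd1 => //; rewrite leqW// ltnW.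
  by rewrite exprS -mulrA ler_pM2l//; apply: IHm; exact: ltnW.
pose K := L ^+ n; have K0 : 0 < K by rewrite exprn_gt0.
have HK j u := lin n j u (leqnn n).
exists (Num.min d d1); first by rewrite lt_min d0.
exists (C * K ^+ 2 + (L + C * rho) * D) => [|j u].
  by rewrite addr_gt0// mulr_gt0// exprn_gt0.
rewrite le_min => /andP[ud ud1] /=; rewrite addnS big_ord_recr /=.
set y := iterate_chain f j n u.
have yr : `|y - v (j + n)%N| <= rho by apply: Hd1.
have -> : f (j + n)%N y - v (j + n).+1 - \prod_(i < n) a (j + i)%N * a (j + n)%N * (u - v j) =
  (f (j + n)%N y - v (j + n).+1 - a (j + n)%N * (y - v (j + n)%N))
  + a (j + n)%N * (y - v (j + n)%N - \prod_(i < n) a (j + i)%N * (u - v j)) by ring.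
apply: le_trans (ler_normD _ _) _; rewrite mulrDl; apply: lerD.
  apply: le_trans (chain_taylor H yr) _; rewrite -mulrA ler_pM2l//.
  rewrite -real_normK ?num_real// -[X in _ <= _ * X]real_normK ?num_real//.
  by rewrite -exprMn ler_pXn2r ?nnegrE ?mulr_ge0 ?(ltW K0)//; apply: HK.
by rewrite normrM -mulrA; apply: ler_pM => //; exact: IH.
Qed.

End Chain.

End ReturnChains.

Section ReturnChainCycle.
Context {R : realType}.
Implicit Types (Z : pw_field R) (g : R -> R * R).

Lemma closed_arcs_orbit Z b (N : nat) y T h : (0 < N)%N ->
  (forall i, (i < N)%N -> arc (side_field Z (b (+) odd i)) (sgn (b (+) odd i))
     (y i) (y i.+1) (T i) (h i)) -> y N = y 0%N ->
  exists Co : set (R * R), [/\ periodic_orbit Z Co, Co (0, y 0%N),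
    forall w, Co (0, w) -> exists2 i, (i < N)%N & w = y i &
    forall z, Co z -> exists i t, [/\ (i < N)%N, 0 <= t <= T i & z = h i t]].
Proof.
case: N => // n _ Harcs yN.
have [g [L [Hg [g0 gL] gz gr [tn tnL gtn]]]] := arcs_concat (n := n) Harcs.
have L0 : 0 < L by case: Hg.
exists (g @` [set t | 0 <= t <= L]); split.
- apply: (piecewise_orbit_periodic Hg); first by rewrite g0 gL yN.
  by exists tn => // E; apply: gtn; rewrite E g0.
- by exists 0; rewrite //= lexx ltW.
- move=> w [t /= /andP[]]; rewrite le_eqVlt => /predU1P[<-|t0].
    by move=> _; rewrite g0 => -[<-]; exists 0%N.
  rewrite le_eqVlt => /predU1P[->|tL].
    by rewrite gL yN => -[<-]; exists 0%N.
  move=> gt; have [||i /andP[_ ii] E] := gz t; first by rewrite t0.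
    by rewrite gt.
  by exists i => //; move: E; rewrite gt => -[].
- move=> z [t /= tL <-]; have [i [t' [ii t'T ->]]] := gr t tL.
  by exists i, t'.
Qed.

(** A trajectory that stayed on side b would follow the smooth flow, hence remain close to the
    prolonged arc, which at time [T + tau] is strictly beyond the line. This rules out nearby
    periodic orbits that never meet the line. *)
Lemma arc_exit Z b (u v T : R) h : arc (side_field Z b) (sgn b) u v T h ->
  exists2 e : R, 0 < e & forall g t0 t1, global_trajectory Z g -> 0 <= t0 <= T ->
    `|g t1 - h t0| < e -> exists2 t, t1 <= t & sgn b * (g t).1 <= 0.
Proof.
move=> Ha; have HX := side_field_smooth Z b.
have [r [phi [tau [c [rho [[r0 Hphi [/andP[tau0 _] _] c0 rho0] hp Htube]]]]]] :=
  arc_tube HX (norm_sgn b) Ha.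
have [T0 [h0 _] _ hd _] := Ha.
have uu : `|u - u| <= rho by rewrite subrr normr0 ltW.
have [pr _ _ _ px] := Htube u uu; set p := phi (0, u) in pr px *.
have r1 : 0 <= r + 1 by rewrite addr_ge0.
have [psi Hpsi] := box_flow_exists HX r1.
have Tt : 0 <= T + tau by rewrite addr_ge0 ?ltW.
have [K K0 HK] := box_flow_dist HX r1 Hpsi Tt.
have psol : solves (side_field Z b) p 0 (T + tau).
  move=> t /andP[t0 tT]; have := (Hphi (0, u)).2 t; rewrite clamp_id//.
  by apply: pr; rewrite !ltW.
pose x0 := - (sgn b * (p (T + tau)).1); have x00 : 0 < x0 by rewrite oppr_gt0.
pose e := Num.min (1 / K) (x0 / K).
have e0 : 0 < e by rewrite lt_min !divr_gt0.
have Ke1 : K * e <= 1 by rewrite mulrC -ler_pdivlMr// ge_min lexx.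
have Ke2 : K * e <= x0 by rewrite mulrC -ler_pdivlMr// ge_min lexx orbT.
exists e => // g t0 t1 Hg /andP[t00 t0T] near; apply: contrapT => no.
have pos t : t1 <= t -> 0 < sgn b * (g t).1.
  by move=> tt; rewrite ltNge; apply/negP => le; apply: no; exists t.
pose S := T + tau - t0; have S0 : 0 <= S by rewrite /S; lra.
have inS s : 0 <= s <= S -> 0 <= t0 + s <= T + tau.
  by rewrite /S => /andP[s1 s2]; apply/andP; split; lra.
have pc s : cts p s by exact: box_flow_cts Hphi.
have hE : h t0 = p t0 by apply: hp; rewrite t00.
have psiE s : 0 <= s <= S -> p (t0 + s) = psi (h t0) s.
  rewrite hE -{2}[t0]addr0.
  apply: (box_flow_unique (k := fun s => p (t0 + s)) (T := S) HX r1 Hpsi).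
  - by move=> x _; exact: cts_shift.
  - apply: solves_shift => x /andP[x1 x2]; apply: psol.
    by rewrite (le_lt_trans t00)//=; move: x1 x2; rewrite /S ?addr0//; lra.
  - left => x xS; apply: le_trans (pr _ (inS x xS)) _.
    by rewrite lerDl.
have gc s : cts g s by exact: global_trajectory_cts Hg.
have close s : 0 <= s <= S -> `|psi (g t1) s - p (t0 + s)| < K * e.
  move=> sS; rewrite psiE//; apply: le_lt_trans (HK _ _ _ _) _.
    by case/andP: sS => -> s2; rewrite /S in s2; lra.
  by rewrite ltr_pM2l.
have gE s : 0 <= s <= S -> g (t1 + s) = psi (g t1) s.
  rewrite -{2}[t1]addr0.
  apply: (box_flow_unique (k := fun s => g (t1 + s)) (T := S) HX r1 Hpsi).
  - by move=> x _; exact: cts_shift.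
  - apply: solves_shift; apply: trajectory_solves => // t /andP[tt _].
    by apply: pos; rewrite -[t1]addr0 ltW.
  - right => x xS; rewrite addr0 -(subrK (p (t0 + x)) (psi _ _)).
    apply: le_trans (ler_normD _ _) _; rewrite addrC; apply: lerD; first exact: pr (inS x xS).
    by apply: le_trans (ltW (close x xS)) Ke1.
have SS : 0 <= S <= S by rewrite S0 lexx.
have := close S SS; rewrite -gE// => cl.
have : 0 < sgn b * (g (t1 + S)).1 by apply: pos; rewrite lerDl.
have tS : t0 + S = T + tau by rewrite /S; ring.
have := le_lt_trans (norm_ge (g (t1 + S) - p (t0 + S))).1 cl.
rewrite tS -(normr_sgnM b) => cl'; have := lt_le_trans cl' Ke2.
by rewrite ltr_norml /x0 /= mulrBr => /andP[_]; lra.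
Qed.

Lemma periodic_times g (T : R) : 0 < T -> (forall t, g (t + T) = g t) ->
  forall t t0, exists2 s, 0 <= s & g t = g (t0 + s).
Proof.
move=> T0 per t t0.
have pern (n : nat) x : g (x + n%:R * T) = g x.
  elim: n x => [|n IH] x; first by rewrite mul0r addr0.
  by rewrite -natr1 mulrDl mul1r addrA per IH.
pose n := Num.bound ((t0 - t) / T).
exists (t + n%:R * T - t0); last by rewrite subrKC pern.
rewrite subr_ge0 -lerBlDl -ler_pdivrMr//.
have [h|h] := leP 0 ((t0 - t) / T); first exact: ltW (archi_boundP h).
by apply: le_trans (ltW h) _.
Qed.

Lemma periodic_compact g (T : R) : 0 < T -> (forall t, g (t + T) = g t) ->
  forall t, exists2 s, 0 <= s <= T & g t = g s.
Proof.
move=> T0 per t.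
have pern (n : nat) x : g (x + n%:R * T) = g x.
  elim: n x => [|n IH] x; first by rewrite mul0r addr0.
  by rewrite -natr1 mulrDl mul1r addrA per IH.
have perz (k : int) x : g (x + k%:~R * T) = g x.
  case: k => n; first exact: pern.
  by rewrite NegzE mulrNz mulNr -{2}(subrK (n.+1%:R * T) x) pern.
exists (t - (Num.floor (t / T))%:~R * T); last by rewrite -mulNr -mulrNz perz.
have /andP[h1 h2] := floor_itv (t / T).
rewrite subr_ge0 -ler_pdivlMr// h1 /= lerBlDr -{1}[T]mul1r -mulrDl addrC.
by rewrite -ler_pdivrMr// ltW// -[1 in X in _ < X]/(1%:~R) -intrD.
Qed.

Lemma return_chain_hyperbolic Z N b v f a rho C :
  return_chain Z N b v f a rho C -> \prod_(i < N) a i <> 1 ->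
  exists2 p, return_map Z (v 0%N) p & derivable p (v 0%N) 1 /\ (p^`())%classic (v 0%N) <> 1.
Proof.
move=> H A1; have N0 := chain_size H; have rho0 := chain_rho H.
have vN : v N = v 0%N by rewrite -[N]add0n (chain_v_per H).
have [del del0 Hdel] := chain_gap H.
pose e := Num.min (del / 4) rho; have e0 : 0 < e by rewrite lt_min rho0 divr_gt0.
have [d d0 Hd] := iterate_near H N e0.
have [d1 d10 [D D0 HD]] := iterate_taylor H N.
pose p := iterate_chain f 0 N.
have pv : p (v 0%N) = v 0%N.
  have := HD 0%N (v 0%N); rewrite subrr normr0 mulr0 subr0 expr0n mulr0.
  by rewrite add0n vN => /(_ (ltW d10)); rewrite normr_le0 subr_eq0 => /eqP.
exists p; last first.
  have dp : is_derive (v 0%N) (1 : R) p (\prod_(i < N) a i).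
    apply/is_deriveP => eps eps0.
    exists (Num.min d1 (eps / D)) => [|h]; first by rewrite lt_min d10 divr_gt0.
    rewrite lt_min => /andP[h1 h2]; have := HD 0%N (v 0%N + h).
    rewrite addrAC subrr !add0r => /(_ (ltW h1)); rewrite vN pv.
    rewrite [h *: _]/(h * _) mulrC => /le_trans; apply.
    rewrite -real_normK ?num_real// expr2 mulrA ler_wpM2r// -ler_pdivlMl//.
    by rewrite mulrC ltW.
  by split; [case: dp|rewrite derive1E derive_val].
(* Intermediate hits are within [del / 4] of other nodes, which are at least [del] away from the
   base node, so they miss a section of radius [del / 2]. *)
split=> //; exists (del / 2); first by rewrite divr_gt0.
have nb : \forall y \near v 0%N, `|y - v 0%N| <= d.
  by exists d => //= y; rewrite /ball_/= distrC => /ltW.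
apply: filterS nb => y yd.
have near m : (m <= N)%N -> `|iterate_chain f 0 m y - v m| <= e.
  by move=> mN; have := Hd 0%N y m mN yd; rewrite add0n.
have er : e <= rho by rewrite ge_min lexx orbT.
have ed : e <= del / 4 by rewrite ge_min lexx.
have ex i : exists Th : R * (R -> R * R), (i < N)%N ->
    arc (side_field Z (b (+) odd i)) (sgn (b (+) odd i)) (iterate_chain f 0 i y)
      (iterate_chain f 0 i.+1 y) Th.1 Th.2.
  have [iN|//] := boolP (i < N)%N; last by exists (0, fun=> 0).
  have [T [h Ha]] := chain_arc H (le_trans (near i (ltnW iN)) er).
  by exists (T, h) => _.
have [Th HTh] := choice ex.
have HTh' i : (i <= N.-1)%N -> arc (side_field Z (b (+) odd i)) (sgn (b (+) odd i))
    (iterate_chain f 0 i y) (iterate_chain f 0 i.+1 y) (Th i).1 (Th i).2.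
  by move=> iN; apply: HTh; rewrite -(prednK N0) ltnS.
have [g [L [Hg [g0 gL] gz _ _]]] := arcs_concat HTh'.
rewrite prednK// in gL.
exists g, L; split.
- by case: Hg.
- exact: piecewise_orbit_trajectory.
- by rewrite g0 gL.
- rewrite /ball /= distrC; apply: le_lt_trans (_ : e < _).
    by have := near N (leqnn _); rewrite vN.
  by apply: le_lt_trans ed _; lra.
move=> t w tL; rewrite /ball /= => wv gw.
have [|i /andP[i0 iN] E] := gz t tL; first by rewrite gw.
have iN' : (i < N)%N by rewrite -(prednK N0) ltnS.
move: E; rewrite gw => -[wE].
have vv : v i <> v 0%N by move=> /(chain_inj H iN' N0) i0'; rewrite i0' in i0.
have := Hdel _ _ vv; have := near i (ltnW iN'); rewrite -wE => h1 h2.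
have := ler_distD w (v i) (v 0%N); rewrite (distrC (v i) w) (distrC w (v 0%N)).
by lra.
Qed.

End ReturnChainCycle.

(** * Isolation of cycles with return slope different from 1 *)

Section ReturnChainLimitCycle.
Context {R : realType}.
Implicit Types (Z : pw_field R) (g : R -> R * R).

Lemma prod_neg (a : nat -> R) (n : nat) : (forall i, a i < 0) ->
  0 < (-1) ^+ n * \prod_(i < n) a i.
Proof.
move=> an; elim: n => [|n IH]; first by rewrite big_ord0 expr0 mulr1.
rewrite big_ord_recr exprS /=.
have -> : -1 * (-1) ^+ n * (\prod_(i < n) a i * a n) =
  ((-1) ^+ n * \prod_(i < n) a i) * (- a n) by ring.
by rewrite mulr_gt0// oppr_gt0.
Qed.

Lemma range_eq_forward g g' (t0 t0' T T' : R) : 0 < T -> 0 < T' ->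
  (forall t, g (t + T) = g t) -> (forall t, g' (t + T') = g' t) ->
  (forall t, 0 <= t -> g (t0 + t) = g' (t0' + t)) -> range g = range g'.
Proof.
move=> T0 T0' per per' E; rewrite predeqE => z; split=> -[t _ <-].
  by have [s s0 ->] := periodic_times T0 per t t0; rewrite E//; exists (t0' + s).
by have [s s0 ->] := periodic_times T0' per' t t0'; rewrite -E//; exists (t0 + s).
Qed.

(* A map whose linear part has slope A different from 1 has v as its only
   trapped point: extremal distances to v are contracted or expanded. *)
Lemma trapped_point (S : set R) (p : R -> R) (v A D e : R) : 0 < A -> A <> 1 ->
  0 < D -> 0 < e -> D * e <= `|A - 1| / 2 -> S !=set0 ->
  (forall w, S w -> `|w - v| < e) -> (forall w, S w -> S (p w)) ->
  (forall w, S w -> `|p w - v - A * (w - v)| <= D * (w - v) ^+ 2) ->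
  forall d, 0 < d -> exists2 w, S w & `|w - v| < d.
Proof.
move=> A0 A1 D0 e0 De [w0 Sw0] Se Sp Sd d d0.
pose E := [set `|w - v| | w in S].
have E0 : E !=set0 by exists `|w0 - v|, w0.
have lin w : S w -> `| (`|p w - v|) - A * `|w - v| | <= `|A - 1| / 2 * `|w - v|.
  move=> Sw; have -> : A * `|w - v| = `|A * (w - v)| by rewrite normrM gtr0_norm.
  apply: le_trans (ler_dist_dist _ _) _; apply: le_trans (Sd w Sw) _.
  apply: (@le_trans _ _ (D * e * `|w - v|)); last by rewrite ler_wpM2r.
  rewrite -real_normK ?num_real// expr2 mulrA ler_wpM2r// ler_pM2l//.
  exact: ltW (Se w Sw).
have [A1'|A1'] := ltP A 1.
  have hE : has_inf E by split=> //; exists 0 => _ [w _ <-].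
  (* If A < 1, distances to v shrink at least by q < 1, so their infimum over the invariant set is
     0. If A > 1, they grow at least by q > 1, so their finite supremum is 0. *)
  pose m := inf E; pose q := (1 + A) / 2.
  have q0 : 0 < q by rewrite /q; lra.
  have q1 : q < 1 by rewrite /q; lra.
  have m0 : m <= 0.
    rewrite leNgt; apply/negP => m0.
    have mq : 0 < m / q - m by rewrite subr_gt0 ltr_pdivlMr// gtr_pMr.
    have [_ [w Sw <-]] := inf_adherent mq hE; rewrite -/m subrKC.
    rewrite ltr_pdivlMr// => hw.
    have : m <= `|p w - v| by apply: ge_inf; [case: hE|exists (p w); [exact: Sp|]].
    have := lin w Sw; rewrite ler_norml ltr0_norm ?subr_lt0// => /andP[_].
    move: hw; rewrite /q; set x := `|w - v|; set y := `|p w - v|; clear.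
    by move=> h1 h2 h3; lra.
  have [_ [w Sw <-]] := inf_adherent d0 hE; rewrite -/m => hw.
  by exists w => //; apply: lt_le_trans hw _; lra.
have {}A1' : 1 < A by rewrite lt_neqAle A1' andbT eq_sym; apply/eqP.
have hE : has_sup E by split=> //; exists e => _ [w Sw <-]; exact: ltW (Se w Sw).
pose M := sup E; pose q := (1 + A) / 2.
have q1 : 1 < q by rewrite /q; lra.
have q0 : 0 < q by lra.
have M0 : M <= 0.
  rewrite leNgt; apply/negP => M0.
  have Mq : 0 < M - M / q by rewrite subr_gt0 ltr_pdivrMr// ltr_pMr.
  have [_ [w Sw <-]] := sup_adherent Mq hE; rewrite -/M subKr.
  rewrite ltr_pdivrMr// => hw.
  have : `|p w - v| <= M by apply: ub_le_sup; [case: hE|exists (p w); [exact: Sp|]].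
  have := lin w Sw; rewrite ler_norml gtr0_norm ?subr_gt0// => /andP[+ _].
  move: hw; rewrite /q; set x := `|w - v|; set y := `|p w - v|; clear.
  by move=> h1 h2 h3; lra.
exists w0 => //; apply: le_lt_trans d0; apply: le_trans M0.
by apply: ub_le_sup; [case: hE|exists w0].
Qed.

(** A periodic orbit inside a thin neighbourhood has to meet the line, and its hits near node 0 form
    a set invariant under the return map. By [trapped_point] they come arbitrarily close to node 0,
    by compactness of the orbit one of them is node 0, and forward uniqueness concludes. *)
Lemma return_chain_cycle Z N b v f a rho C : return_chain Z N b v f a rho C ->
  \prod_(i < N) a i <> 1 ->
  exists Co : set (R * R), [/\ crossing_limit_cycle Z Co, hyperbolic Z Co, Co (0, v 0%N) &
    forall w, Co (0, w) -> exists2 i, (i < N)%N & w = v i].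
Proof.
move=> H A1; have N0 := chain_size H; have rho0 := chain_rho H.
have oddm i : odd (i %% N) = odd i by rewrite odd_mod//; exact/negbTE/(chain_even H).
have ex i : exists Th : R * (R -> R * R),
    arc (side_field Z (b (+) odd i)) (sgn (b (+) odd i)) (v i) (v i.+1) Th.1 Th.2.
  have vv : `|v i - v i| <= rho by rewrite subrr normr0 ltW.
  have [T [h Ha]] := chain_arc H vv; exists (T, h); rewrite -(chain_node H); exact: Ha.
have [Th HTh] := choice ex.
pose T i := (Th (i %% N)%N).1; pose h i := (Th (i %% N)%N).2.
have Harc i : arc (side_field Z (b (+) odd i)) (sgn (b (+) odd i)) (v i) (v i.+1) (T i) (h i).
  have := HTh (i %% N)%N; rewrite oddm -(chain_node H) -(periodic_modn (chain_f_per H)).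
  by rewrite -(periodic_modn (chain_v_per H)) (chain_node H).
have vN : v N = v 0%N by rewrite -[N]add0n (chain_v_per H).
have [Co [perCo Co0 CoS CoA]] := closed_arcs_orbit N0 (fun i _ => Harc i) vN.
have crCo y : Co (0, y) -> crossing_point Z y.
  by move=> /CoS[i _ ->]; exact: chain_crossing H i.
have hypCo : hyperbolic Z Co.
  move=> y /CoS[i iN ->].
  have := return_chain_hyperbolic (return_chain_shift i H).
  by rewrite (periodic_prod _ (chain_a_per H)) addn0; apply.
exists Co; split => //; split => //; last first.
- apply: (@sub_finite_set _ _ [set (0, v i) | i in [set i | (i < N)%N]]).
    move=> z [Cz]; rewrite /Sigma /= => z0; move: Cz; rewrite (fst0_eq z0) => /CoS[i iN ->].
    by exists i.
  by apply: finite_image; exact: finite_II.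
- by exists (0, v 0%N); split.
split=> //.
have [del del0 Hdel] := chain_gap H.
have [L L1 HL] := chain_lipschitz H.
have [dc dc0 Hdc] := chain_crossing_near H.
have [d2 d20 [D D0 HD]] := iterate_taylor H N.
have [e1 e10 He1] : exists2 e : R, 0 < e & forall i, (i < N)%N ->
    forall g t0 t1, global_trajectory Z g -> 0 <= t0 <= T i ->
    `|g t1 - h i t0| < e -> exists2 t, t1 <= t & sgn (b (+) odd i) * (g t).1 <= 0.
  apply: (@finite_min R N (fun i e => forall g t0 t1, global_trajectory Z g -> 0 <= t0 <= T i ->
    `|g t1 - h i t0| < e -> exists2 t, t1 <= t & sgn (b (+) odd i) * (g t).1 <= 0)).
    move=> i d d' _ dd Hd g t0 t1 Hg tT near; apply: (Hd g t0 t1 Hg tT).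
    exact: lt_le_trans dd.
  by move=> i _; exact: arc_exit (Harc i).
pose A := \prod_(i < N) a i.
have A0 : 0 < A.
  have := prod_neg N (chain_neg H); rewrite -signr_odd (negbTE (chain_even H)).
  by rewrite expr0 mul1r.
have A1' : 0 < `|A - 1| / 2 by rewrite divr_gt0// normr_gt0 subr_eq0; apply/eqP.
have L10 : 0 < 1 + L by lra.
pose e := Num.min (Num.min (Num.min e1 rho) (Num.min dc d2))
   (Num.min (del / (1 + L)) (`|A - 1| / 2 / D)).
have e0 : 0 < e by rewrite !lt_min e10 rho0 dc0 d20 (divr_gt0 del0 L10) (divr_gt0 A1' D0).
have ee1 : e <= e1 by rewrite !ge_min lexx.
have er : e <= rho by rewrite !ge_min lexx !orbT.
have edc : e <= dc by rewrite !ge_min lexx !orbT.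
have ed2 : e <= d2 by rewrite !ge_min lexx !orbT.
have edel : e * (1 + L) <= del by rewrite -ler_pdivlMr// !ge_min lexx !orbT.
have eD : D * e <= `|A - 1| / 2 by rewrite [D * e]mulrC -ler_pdivlMr// !ge_min lexx !orbT.
pose U := [set z : R * R | (z.1 = 0 -> exists i, `|z.2 - v i| < e) /\
   (z.1 <> 0 -> exists i t0, [/\ 0 <= t0 <= T i, 0 < sgn (b (+) odd i) * z.1 &
      `|z - h i t0| < e])].
exists U; split.
- rewrite openE => z [Uz0 Uz1]; apply/nbhs_ballP.
  have [z0|/eqP z0] := eqVneq z.1 0; last first.
    have [i [t0 [tT sz near]]] := Uz1 z0.
    exists (Num.min `|z.1| (e - `|z - h i t0|)).
      by rewrite /= lt_min normr_gt0 subr_gt0 near andbT; apply/eqP.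
    move=> w; rewrite prod_norm_ball /ball_ /= lt_min => /andP[w1 w2].
    have zw1 := le_lt_trans (norm_ge (z - w)).1 w1.
    have sw : 0 < sgn (b (+) odd i) * w.1.
      move: zw1; rewrite -(normr_sgnM (b (+) odd i)) -(normr_sgnM (b (+) odd i) z.1).
      rewrite (gtr0_norm sz) /= mulrBr ltr_norml => /andP[_].
      lra.
    split=> [w0|_]; first by rewrite w0 mulr0 ltxx in sw.
    exists i, t0; split => //; apply: le_lt_trans (ler_distD z _ _) _.
    by rewrite distrC -ltrBrDr.
  have [i near] := Uz0 z0.
  exists (e - `|z.2 - v i|); first by rewrite /= subr_gt0.
  move=> w; rewrite prod_norm_ball /ball_ /= => wz.
  have w2 : `|w.2 - v i| < e.
    apply: le_lt_trans (ler_distD z.2 _ _) _; rewrite -ltrBrDr distrC.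
    exact: le_lt_trans (norm_ge (z - w)).2 wz.
  have w1 : `|w.1| < e.
    have := le_lt_trans (norm_ge (z - w)).1 wz; rewrite /= z0 sub0r normrN.
    by move=> /lt_le_trans; apply; rewrite gerBl.
  have wv : `|w - (0, v i)| < e by apply: norm_lt_pair => //=; rewrite subr0.
  split=> [_|w0]; first by exists i.
  have [s_w|s_w] : 0 < sgn (b (+) odd i) * w.1 \/ 0 < sgn (~~ (b (+) odd i)) * w.1.
    rewrite /sgn; case: (b (+) odd i); rewrite /= ?mul1r ?mulN1r ?oppr_gt0;
      case: (ltgtP w.1 0) => //; by [left|right].
    exists i, 0; have [T0 [h0 _] _ _ _] := Harc i.
    by rewrite lexx ltW// h0.
  (* On the other side of the node, the point is near the end of the preceding arc. *)
  exists (i + N.-1)%N, (T (i + N.-1)%N); have [T0 [_ hT] _ _ _] := Harc (i + N.-1)%N.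
  rewrite lexx ltW// hT -addnS prednK// (chain_v_per H); split => //.
  have -> : odd (i + N.-1) = ~~ odd i.
    rewrite oddD -(negbK (odd N.-1)) -oddS prednK// (negbTE (chain_even H)) addbT.
    by case: (odd i).
  by rewrite addbN.
- move=> z Cz; split=> z0.
    move: Cz; rewrite (fst0_eq z0) => /CoS[i iN ->]; exists i.
    by rewrite subrr normr0.
  have [i [t [iN /andP[t0 tT] zE]]] := CoA z Cz.
  have [_ [h0 hT] _ _ hpos] := Harc i.
  exists i, t; rewrite t0 tT zE subrr normr0; split => //; apply: hpos.
  rewrite !lt_neqAle t0 tT !andbT; apply/andP; split; apply/eqP => E; apply: z0.
    by rewrite zE -E h0.
  by rewrite zE E hT.
move=> C' [g [T' [Hg [T'0 per] _ ->]]] C'U.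
have Ug t : U (g t) by apply: C'U; exists t.
have gc t : cts g t by exact: global_trajectory_cts Hg.
have [t1 gt1] : exists t1, (g t1).1 = 0.
  have [|/eqP g0] := eqVneq (g 0).1 0; first by exists 0.
  have [i [t0 [tT sz near]]] := (Ug 0).2 g0.
  have modi : T i = T (i %% N)%N /\ h i = h (i %% N)%N by rewrite /T /h modn_mod.
  have [t tpos gt] : exists2 t, 0 <= t & sgn (b (+) odd i) * (g t).1 <= 0.
    have iN : (i %% N < N)%N by rewrite ltn_mod.
    have := He1 _ iN g t0 0 Hg; rewrite -modi.1 -modi.2 oddm; apply => //.
    exact: lt_le_trans ee1.
  have cc s : 0 <= s <= t -> cts (fun x => sgn (b (+) odd i) * (g x).1) s.
    by move=> _; apply: ctsM; [exact: cts_cst|case/cts_pair: (gc s)].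
  have [|s _ sE] := cts_IVT tpos cc; first by right; rewrite gt ltW.
  exists s; move: sE => /eqP; rewrite mulf_eq0 -normr_eq0 norm_sgn oner_eq0 /=.
  by move=> /eqP.
pose S i := [set w | `|w - v i| < e /\ exists t, g t = (0, w)].
have stepS i w : S i w -> S i.+1 (f i w).
  move=> [wv [t gt]].
  have [T0 [h0 Ha]] := chain_arc H (le_trans (ltW wv) er).
  have T00 : 0 <= T0 <= T0 by case: Ha => /ltW ->; rewrite lexx.
  have := trajectory_follow_arc Hg Ha (Hdc i w (le_trans (ltW wv) edc)) gt T00.
  have [_ [_ ->] _ _ _] := Ha => gT.
  split; last by exists (t + T0).
  have [j jn] : exists j, `|f i w - v j| < e.
    by have := (Ug (t + T0)).1; rewrite gT; apply.
  (* The image is within [L * e] of the next node and within e of some node; since [e * (1 + L)] is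
     at most the gap, these coincide. *)
  have [<-//|/eqP vij] := eqVneq (v j) (v i.+1).
  have := Hdel _ _ vij; have := HL i w (le_trans (ltW wv) er).
  have Lw : L * `|w - v i| < L * e by rewrite ltr_pM2l//; exact: lt_le_trans L1.
  have := ler_distD (f i w) (v j) (v i.+1); rewrite (distrC (v j) (f i w)).
  by move=> k1 k2 k3; exfalso; lra.
have iterS n j w : S j w -> S (j + n)%N (iterate_chain f j n w).
  by move=> Sw; elim: n => [|n IH]; rewrite ?addn0//= addnS; exact: stepS.
have [w0 Sw0] : S 0%N !=set0.
  have [i wi] : exists i, `|(g t1).2 - v i| < e by exact: (Ug t1).1.
  have Si : S i (g t1).2 by split=> //; exists t1; exact: fst0_eq.
  have := iterS (i * N.-1)%N _ _ Si.
  rewrite -mulnS prednK// => h1; exists (iterate_chain f i (i * N.-1) (g t1).2).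
  by move: h1; rewrite /S (periodic_modn (chain_v_per H) (i * N)) modnMl.
have SN w : S 0%N w -> S 0%N (iterate_chain f 0 N w).
  by move=> /(iterS N); rewrite add0n /S vN.
have trap := trapped_point A0 A1 D0 e0 eD (ex_intro _ w0 Sw0)
   (fun w (Sw : S 0%N w) => Sw.1) SN.
have {}trap : forall d, 0 < d -> exists2 w, S 0%N w & `|w - v 0%N| < d.
  apply: trap => w [wv _]; have := HD 0%N w (le_trans (ltW wv) ed2).
  by rewrite add0n vN.
(* Otherwise g would keep a positive distance from the node over one period, against the arbitrarily
   close hits. *)
have [t0 gt0] : exists t0, g t0 = (0, v 0%N).
  apply: contrapT => no.
  have cg s : 0 <= s <= T' -> cts (fun x => `|g x - (0, v 0%N)|) s.
    move=> _ eps eps0; have [d d0 Hd] := gc s _ eps0; exists d => // x /Hd.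
    apply: le_lt_trans; apply: le_trans (ler_dist_dist _ _) _.
    by rewrite opprB subrKA.
  have [|m m0 Hm] := cts_min_pos cg.
    by move=> s _; rewrite normr_gt0 subr_eq0; apply/eqP => E; apply: no; exists s.
  have [w [_ [t gt]] wv] := trap m m0.
  have [s sT gs] := periodic_compact T'0 per t.
  by have := Hm s sT; rewrite -gs gt norm_section leNgt wv.
have [gC [TC [HgC [TC0 perC] _ CoE]]] := perCo.
have [tc _ gtc] : range gC (0, v 0%N) by rewrite -CoE.
have regC t : regular_point Z (gC t).
  by move=> gC0; apply: crCo; rewrite CoE -(fst0_eq gC0); exists t.
rewrite CoE; symmetry.
apply: (@range_eq_forward gC g tc t0 TC T') => //.
by apply: (trajectory_forward_unique HgC Hg regC); rewrite gtc gt0.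
Qed.

End ReturnChainLimitCycle.

(** * The perturbation *)

Section PerturbedField.
Context {R : realType}.
Implicit Types (Z : pw_field R) (p q : mpoly 2 R).

Lemma ord2P (i : 'I_2) : i = ord0 \/ i = lift ord0 ord0.
Proof. by case: i => -[|[|//]] ?; [left|right]; apply: val_inj. Qed.

Definition X0 : mpoly 2 R := mpolyX R (mnm1 ord0).
Definition X1 : mpoly 2 R := mpolyX R (mnm1 (lift ord0 ord0)).

Definition shift_poly (mu : R) p : mpoly 2 R :=
  comp_mpoly [tuple X0; X1 - mpolyC 2 mu] p.

Lemma eval2_shift mu p z : eval2 (shift_poly mu p) z = eval2 p (z.1, z.2 - mu).
Proof.
rewrite /eval2 /shift_poly comp_mpoly_meval; apply: meval_eq => i.
case: (ord2P i) => ->; rewrite (tnth_nth 0) /=.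
  by rewrite mevalXU eqxx.
by rewrite mevalB mevalXU mevalC.
Qed.

Lemma eval2M p q z : eval2 (p * q) z = eval2 p z * eval2 q z.
Proof. exact: mevalM. Qed.

Lemma eval2_weight j z : eval2 ((1 + X0) ^+ j) z = (1 + z.1) ^+ j.
Proof.
elim: j => [|j IH]; first by rewrite !expr0 /eval2 meval1.
by rewrite !exprS eval2M IH /eval2 mevalD meval1 mevalXU eqxx.
Qed.

Lemma msize_linM q p : (msize q <= 2)%N -> (msize (q * p) <= (msize p).+1)%N.
Proof.
move=> q2; have [->|q0] := eqVneq q 0; first by rewrite mul0r msize0.
have [->|p0] := eqVneq p 0; first by rewrite mulr0 msize0.
by rewrite msizeM// -ltnS prednK ?ltnS ?(leq_add2r (msize p) _ 2)// addn_gt0 lt0n msize_poly_eq0 q0.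
Qed.

Lemma msize_expM q p k : (msize q <= 2)%N -> (msize (q ^+ k * p) <= k + msize p)%N.
Proof.
move=> q2; elim: k => [|k IH]; first by rewrite expr0 mul1r.
by rewrite exprS -mulrA; apply: leq_trans (msize_linM _ q2) _; rewrite addSn ltnS.
Qed.

Lemma msize_shift mu p : (msize (shift_poly mu p) <= msize p)%N.
Proof.
rewrite /shift_poly comp_mpolyE; apply: leq_trans (msize_sum _ _ _) _.
apply/bigmax_leqP_seq => m mp _.
apply: leq_trans (msizeZ_le _ _) _; apply: leq_trans (msize_mdeg_lt mp).
rewrite !big_ord_recl big_ord0 /= mdegE !big_ord_recl big_ord0 addn0.
rewrite !(tnth_nth 0) /=.
have sX0 : (msize X0 <= 2)%N by rewrite msizeX mdeg1.
have sX1 : (msize (X1 - mpolyC 2 mu) <= 2)%N.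
  apply: leq_trans (msizeD_le _ _) _; rewrite geq_max msizeX mdeg1 /=.
  by rewrite msizeN msizeC; case: (mu != 0).
apply: leq_trans (msize_expM _ _ sX0) _; rewrite -addnS leq_add2l.
by apply: leq_trans (msize_expM _ _ sX1) _; rewrite msize1 addn1.
Qed.

Lemma msize_weight : msize (1 + X0) = 2%N.
Proof.
apply/eqP; rewrite eqn_leq; apply/andP; split.
  by apply: leq_trans (msizeD_le _ _) _; rewrite geq_max msize1 msizeX mdeg1.
have : mnm1 ord0 \in msupp (1 + X0).
  rewrite mcoeff_msupp mcoeffD mcoeff1 mcoeffX eqxx.
  by rewrite mnm1_eq0 add0r oner_eq0.
by move=> /msize_mdeg_lt; rewrite mdeg1.
Qed.

Lemma msize_weightM j p : p != 0 -> msize ((1 + X0) ^+ j * p) = (j + msize p)%N.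
Proof.
move=> p0; have w0 : 1 + X0 != 0 by rewrite -msize_poly_eq0 msize_weight.
elim: j => [|j IH]; first by rewrite expr0 mul1r.
by rewrite exprS -mulrA msizeM ?mulf_neq0 ?expf_neq0// IH msize_weight addSn.
Qed.

(* On x > 0 the field is translated by mu in the direction of x = 0 and
   multiplied by (1 + x) ^ j > 0, which only changes the time
   parametrization but allows any degree to be reached. *)
Definition perturbed Z (mu : R) (j : nat) : pw_field R :=
  PwField ((1 + X0) ^+ j * shift_poly mu (pwP_pos Z))
    ((1 + X0) ^+ j * shift_poly mu (pwQ_pos Z)) (pwP_neg Z) (pwQ_neg Z).

Lemma perturbed_pos Z mu j z : side_field (perturbed Z mu j) true z =
  ((1 + z.1) ^+ j) *: side_field Z true (z.1, z.2 - mu).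
Proof.
by rewrite /side_field /field_pos /= !eval2M eval2_weight !eval2_shift.
Qed.

(** The power of 1 + x makes up what the larger component on x > 0 lacks. A nonzero first component
    ensures that the larger one is nonzero, hence can be raised. *)
Lemma perturbed_degree Z mu n : (sizeP Z <= n.+1)%N -> (sizeQ Z <= n.+1)%N ->
  shift_poly mu (pwP_pos Z) != 0 -> exists j, has_degree (perturbed Z mu j) n.
Proof.
rewrite /sizeP /sizeQ !geq_max => /andP[Pp Pn] /andP[Qp Qn] P0.
set P := shift_poly mu _ in P0; set Q := shift_poly mu (pwQ_pos Z).
have Ps : (msize P <= n.+1)%N by apply: leq_trans (msize_shift _ _) Pp.
have Qs : (msize Q <= n.+1)%N by apply: leq_trans (msize_shift _ _) Qp.
have m0 : (maxn (msize P) (msize Q) <= n.+1)%N by rewrite geq_max Ps.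
exists (n.+1 - maxn (msize P) (msize Q))%N; set j := (_ - _)%N.
have jm : (j + maxn (msize P) (msize Q) = n.+1)%N by rewrite subnK.
rewrite /has_degree /sizeP /sizeQ /= -/P -/Q.
have sP : msize ((1 + X0) ^+ j * P) = (j + msize P)%N by exact: msize_weightM.
apply/eqP; rewrite eqn_leq !geq_max Pn Qn !andbT; apply/andP; split.
  rewrite sP -{1 2}jm leq_add2l leq_maxl /=.
  have [->|Q0] := eqVneq Q 0; first by rewrite mulr0 msize0.
  by rewrite msize_weightM// leq_add2l leq_maxr.
rewrite -{1}jm; have [QP|PQ] := leqP (msize Q) (msize P).
  by rewrite !leq_max sP leqnn.
have Q0 : Q != 0 by rewrite -msize_poly_eq0 -lt0n (leq_ltn_trans (leq0n _) PQ).
by rewrite !leq_max (msize_weightM _ Q0) leqnn !orbT.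
Qed.

Lemma arc_translate (X : R * R -> R * R) (s u v T mu : R) h : arc X s u v T h ->
  arc (fun z => X (z.1, z.2 - mu)) s (u + mu) (v + mu) T
    (fun t => ((h t).1, (h t).2 + mu)).
Proof.
move=> [T0 [h0 hT] [su sv] hd hpos]; split => //=.
- by rewrite h0 hT.
- by rewrite !addrK.
move=> t tT; rewrite addrK; have := hd t tT; case E : (h t) => [x y] /=; rewrite -E.
move=> /is_derive_pair[d1 d2]; apply/is_derive_pair; split => //=.
have := is_deriveD_fun d2 (is_derive_cst mu t (1 : R)).
by rewrite addr0.
Qed.

(** The new clock solves th' = w (h th). Since w is bounded below along the arc, th reaches T in
    finite time, and composing h with it runs through the same image. *)
Lemma arc_time_change Z b (w : R * R -> R) (u v T : R) h : loclip w ->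
  arc (side_field Z b) (sgn b) u v T h -> (forall t, 0 <= t <= T -> 0 < w (h t)) ->
  exists T' h', arc (fun z => w z *: side_field Z b z) (sgn b) u v T' h'.
Proof.
move=> Hw Ha wpos; have [T0 [M M0 hlip] _] := arc_piecewise_orbit Ha.
have [_ [h0 hT] [su sv] hd hpos] := Ha.
pose cl x := Num.max 0 (Num.min T x).
have clT x : 0 <= cl x <= T.
  by rewrite le_max lexx /= ge_max (ltW T0) ge_min lexx.
have cl_id x : 0 <= x <= T -> cl x = x.
  by move=> /andP[x0 xT]; rewrite /cl (min_idPr xT) (max_idPr x0).
have hlip' s t : 0 <= s <= T -> 0 <= t <= T -> `|h t - h s| <= M * `|t - s|.
  wlog st : s t / s <= t => [Hw'|].
    move=> sT tT; have [st|/ltW ts] := leP s t; first exact: Hw'.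
    by rewrite distrC (distrC t); exact: Hw'.
  by move=> /andP[s0 _] /andP[_ tT]; rewrite ger0_norm ?subr_ge0//; exact: hlip.
have hc t : 0 <= t <= T -> cts h t by move=> /hd; exact: is_derive_cts.
have [r r0 Hr] := cts_bounded hc.
have [K K0 HK] := Hw r.
pose W x := w (h (cl x)).
have Wlip x y : `|W x - W y| <= (K * M + 1) * `|x - y|.
  apply: le_trans (HK _ _ (Hr _ (clT y)) (Hr _ (clT x))).2 _.
  rewrite mulrDl mul1r; apply: ler_wpDr => //; rewrite -mulrA ler_pM2l//.
  apply: le_trans (hlip' _ _ (clT y) (clT x)) _; apply: ler_wpM2l => //.
  exact: le_trans (max_lip _ _ _) (min_lip _ _ _).
have KM : 0 < K * M + 1 by rewrite ltr_wpDl// mulr_ge0// ltW.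
have wc t : 0 <= t <= T -> cts (fun s => w (h s)) t.
  move=> tT e e0; have := hc t tT; have [K' K'0 HK'] := Hw (`|h t| + 1).
  move=> hct; have [d d0 Hd] := hct _ (divr_gt0 e0 K'0); have [d1 d10 Hd1] := hct _ ltr01.
  exists (Num.min d d1) => [|s]; first by rewrite lt_min d0.
  rewrite lt_min => /andP[/Hd + /Hd1 h2]; rewrite ltr_pdivlMr// mulrC.
  apply: le_lt_trans; apply: (HK' _ _ _ _).2; first by rewrite lerDl.
  rewrite -(subrK (h t) (h s)); apply: le_trans (ler_normD _ _) _.
  by rewrite addrC lerD2l ltW.
have [m m0 Hm] := cts_min_pos wc wpos.
(* The scalar equation is solved as a planar one with constant second coordinate; [cl] extends the
   speed beyond [0, T], where h is not controlled. *)
have [||g [g0 dg]] := @flow_exists R (fun z => (W z.1, 0)) K _ KM _ _ (0, 0).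
- move=> z; apply: norm_le_pair; last by rewrite normr0 ltW.
  exact: (HK _ _ (Hr _ (clT _)) (Hr _ (clT _))).1.
- move=> z z'; apply: norm_le_pair => /=.
    by apply: le_trans (Wlip _ _) _; rewrite ler_pM2l//; exact: (norm_ge (z - z')).1.
  by rewrite subrr normr0 mulr_ge0// ltW.
pose th t := (g t).1.
have dth t : is_derive t (1 : R) th (W (th t)) by case/is_derive_pair: (dg t).
have Wm x : m <= W x by apply: Hm; exact: clT.
have thc t : cts th t by exact: is_derive_cts (dth t).
have th0 : th 0 = 0 by rewrite /th g0.
have thg s t : s <= t -> m * (t - s) <= th t - th s.
  by move=> st; apply: (mvt_ge st (fun x _ => thc x) (fun x _ => dth x)) => x _.
have Tm : 0 <= T / m by rewrite divr_ge0// ltW.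
have thTc t : 0 <= t <= T / m -> cts (fun t => th t - T) t.
  by move=> _; apply: ctsB => //; exact: cts_cst.
have [|S /andP[S0 _] thS] := cts_IVT Tm thTc.
  left; rewrite th0 sub0r oppr_le0 ltW//= subr_ge0.
  by have := thg 0 (T / m) Tm; rewrite th0 !subr0 mulrC divfK// gt_eqF.
have {}thS : th S = T by apply/eqP; rewrite -subr_eq0; apply/eqP.
have Sp : 0 < S.
  rewrite lt_neqAle S0 andbT; apply/eqP => E.
  by move: T0; rewrite -thS -E th0 ltxx.
have thI t : 0 <= t <= S -> 0 <= th t <= T.
  move=> /andP[t0 tS]; have := thg 0 t t0; have := thg t S tS.
  rewrite th0 thS !subr0 => h1 h2; apply/andP; split.
    by apply: le_trans h2; rewrite mulr_ge0// ltW.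
  by rewrite -subr_ge0; apply: le_trans h1; rewrite mulr_ge0 ?subr_ge0// ltW.
have cE (x y : R * R) b' : (w x *: y).1 * sgn b' = w x * (y.1 * sgn b') by rewrite mulrA.
exists S, (fun t => h (th t)); split => //.
- by rewrite th0 thS.
- have w0 := wpos 0; have wT := wpos T; rewrite h0 lexx ltW// in w0.
  rewrite hT lexx ltW// in wT.
  rewrite [sgn b * _]mulrC [X in _ /\ X < 0]mulrC !cE; split.
    by rewrite pmulr_rgt0 ?w0// mulrC.
  by rewrite pmulr_rlt0 ?wT// mulrC.
- move=> t tS; have thT := thI t tS.
  have [d1 d2] := (is_derive_pair _ _ _).1 (hd _ thT).
  have wE : W (th t) = w (h (th t)) by rewrite /W cl_id.
  apply/is_derive_pair; split.
    have := @is_derive1_comp R (fun s => (h s).1) th t _ _ d1 (dth t).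
    by rewrite wE mulrC.
  have := @is_derive1_comp R (fun s => (h s).2) th t _ _ d2 (dth t).
  by rewrite wE mulrC.
- move=> t /andP[t0 tS]; apply: hpos.
  have := thg 0 t (ltW t0); have := thg t S (ltW tS); rewrite th0 thS !subr0 => h1 h2.
  apply/andP; split; first by apply: lt_le_trans h2; rewrite mulr_gt0.
  by rewrite -subr_gt0; apply: lt_le_trans h1; rewrite mulr_gt0// subr_gt0.
Qed.

Lemma loclip_weight j : loclip (fun z : R * R => (1 + z.1) ^+ j).
Proof.
elim: j => [|j IH].
  have -> : (fun z : R * R => (1 + z.1) ^+ 0) = (fun=> 1) by apply/funext => z; rewrite expr0.
  exact: loclip_cst.
have -> : (fun z : R * R => (1 + z.1) ^+ j.+1) = (fun z => (1 + z.1) * (1 + z.1) ^+ j).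
  by apply/funext => z; rewrite exprS.
by apply: loclipM => //; apply: loclipD; [exact: loclip_cst|exact: loclip_fst].
Qed.

Lemma arc_perturbed Z mu j (u v T : R) h : arc (side_field Z true) (sgn true) u v T h ->
  exists T' h', arc (side_field (perturbed Z mu j) true) (sgn true) (u + mu) (v + mu) T' h'.
Proof.
move=> Ha; pose Z1 := perturbed Z mu 0.
have E1 : side_field Z1 true = (fun z => side_field Z true (z.1, z.2 - mu)).
  by apply/funext => z; rewrite perturbed_pos expr0 scale1r.
have Ha1 : arc (side_field Z1 true) (sgn true) (u + mu) (v + mu) T
    (fun t => ((h t).1, (h t).2 + mu)) by rewrite E1; exact: arc_translate.
have [|T' [h' Ha']] := arc_time_change (loclip_weight j) Ha1.
  move=> t /andP[t0 tT] /=; apply: exprn_gt0.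
  have [T0 [h0 hT] _ _ hpos] := Ha.
  suff : 0 <= (h t).1 by lra.
  move: t0; rewrite le_eqVlt => /predU1P[<-|t0]; first by rewrite h0.
  move: tT; rewrite le_eqVlt => /predU1P[->|tT]; first by rewrite hT.
  by have := hpos t; rewrite t0 tT /sgn mul1r => /(_ isT)/ltW.
exists T', h'; have -> : side_field (perturbed Z mu j) true =
   (fun z => (1 + z.1) ^+ j *: side_field Z1 true z).
  by apply/funext => z; rewrite perturbed_pos E1.
exact: Ha'.
Qed.

End PerturbedField.

(** * Iterates of the perturbed half-return maps *)

Section PerturbedIterates.
Context {R : realType}.
Variables (y : nat -> R) (rho C : R) (F dF : nat -> R -> R).
Hypothesis rho0 : 0 < rho.
Hypothesis C0 : 0 < C.
Hypothesis HF : forall i, decreasing_branch (y i) rho C (F i) (dF i).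
Hypothesis Fy : forall i, F i (y i) = y i.+1.

(** Odd indices are the arcs in x > 0, as the nodes are numbered from one that enters x < 0. *)
Definition branch (mu : R) (i : nat) (u : R) :=
  if odd i then F i (u - mu) + mu else F i u.

Definition branch_slope (mu : R) (i : nat) (u : R) :=
  if odd i then dF i (u - mu) else dF i u.

Fixpoint iterate_branch (mu : R) (n : nat) (u : R) : R :=
  if n is m.+1 then branch mu m (iterate_branch mu m u) else u.

Definition iterate_slope (mu : R) (n : nat) (u : R) : R :=
  \prod_(i < n) branch_slope mu i (iterate_branch mu i u).

Let L := C + C * (2 * rho) + 1.

Let L1 : 1 <= L.
Proof. by rewrite /L lerDr addr_ge0 ?mulr_ge0 ?ltW. Qed.

Let L0 : 0 < L. Proof. exact: lt_le_trans L1. Qed.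

Lemma branch_lipschitz i u v : `|u - y i| <= rho -> `|v - y i| <= rho ->
  `|F i v - F i u| <= L * `|v - u|.
Proof.
move=> ur vr; have [_ h1 h2 _] := HF ur vr.
have -> : F i v - F i u = (F i v - F i u - dF i u * (v - u)) + dF i u * (v - u) by rewrite subrK.
apply: le_trans (ler_normD _ _) _; rewrite normrM.
have h3 : `|v - u| <= 2 * rho.
  have -> : v - u = (v - y i) - (u - y i) by ring.
  by apply: le_trans (ler_normB _ _) _; rewrite mulr_natl mulr2n; exact: lerD.
have h4 : C * (v - u) ^+ 2 <= C * (2 * rho) * `|v - u|.
  by rewrite -(real_normK (num_real (v - u))) expr2 [leLHS]mulrA ler_wpM2r// ler_pM2l.
have h5 : `|dF i u| * `|v - u| <= C * `|v - u| by rewrite ler_wpM2r.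
have h6 := normr_ge0 (v - u).
by rewrite /L; have := le_trans h2 h4; lra.
Qed.

(** Both u and u - mu are kept in the domain, so that no statement depends on the parity of i. *)
Definition admissible (mu : R) (i : nat) (u : R) :=
  `|u - y i| <= rho /\ `|u - mu - y i| <= rho.

Lemma branchB mu i u v : admissible mu i u -> admissible mu i v ->
  [/\ branch_slope mu i u < 0, `|branch_slope mu i u| <= C,
    `|branch mu i v - branch mu i u - branch_slope mu i u * (v - u)| <= C * (v - u) ^+ 2 &
    u <= v -> branch mu i v <= branch mu i u].
Proof.
rewrite /branch /branch_slope => -[u1 u2] [v1 v2]; case: ifP => _; last exact: HF.
have [h1 h2 h3 h4] := HF u2 v2; split => //.
  have -> : F i (v - mu) + mu - (F i (u - mu) + mu) = F i (v - mu) - F i (u - mu) by ring.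
  by have -> : v - u = (v - mu) - (u - mu) by ring.
by move=> uv; rewrite lerD2r; apply: h4; rewrite lerD2r.
Qed.

Lemma branch_near mu i u : admissible mu i u ->
  `|branch mu i u - y i.+1| <= L * `|u - y i| + (L + 1) * `|mu|.
Proof.
move=> [u1 u2]; have yy : `|y i - y i| <= rho by rewrite subrr normr0 ltW.
rewrite /branch -Fy; case: ifP => _; last first.
  apply: le_trans (branch_lipschitz yy u1) _; rewrite lerDl mulr_ge0// addr_ge0//.
  exact: ltW.
have -> : F i (u - mu) + mu - F i (y i) = (F i (u - mu) - F i (y i)) + mu by ring.
apply: le_trans (ler_normD _ _) _.
have h1 := branch_lipschitz yy u2.
have h2 : L * `|u - mu - y i| <= L * (`|u - y i| + `|mu|).
  by rewrite ler_pM2l// addrAC; exact: ler_normB.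
lra.
Qed.

Lemma iterate_branch_near n (e : R) : 0 < e -> exists2 d : R, 0 < d &
  forall u mu i, `|u - y 0%N| <= d -> `|mu| <= d -> (i <= n)%N ->
    `|iterate_branch mu i u - y i| <= e /\ `|iterate_branch mu i u - mu - y i| <= e.
Proof.
elim: n e => [|n IH] e e0.
  exists (e / 2) => [|u mu i ud md]; first by rewrite divr_gt0.
  have ee : e / 2 <= e by lra.
  rewrite leqn0 => /eqP-> /=; split; first exact: le_trans ud ee.
  rewrite addrAC; apply: le_trans (ler_normB _ _) _; lra.
pose e' := Num.min (rho) (e / (2 * L + 2)).
have LL : 0 < 2 * L + 2 by have := L0; lra.
have e'0 : 0 < e' by rewrite lt_min rho0 divr_gt0.
have e'r : e' <= rho by rewrite ge_min lexx.
have e'e : e' * (2 * L + 2) <= e by rewrite -ler_pdivlMr// ge_min lexx orbT.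
have e'le : e' <= e.
  apply: le_trans e'e; rewrite ler_peMr ?(ltW e'0)//; have := L0; lra.
have [d d0 Hd] := IH e' e'0.
exists (Num.min d e') => [|u mu i]; first by rewrite lt_min d0.
move=> ud' md'; have /andP[ud _] : (`|u - y 0%N| <= d) && (`|u - y 0%N| <= e') by rewrite -le_min.
have /andP[md me] : (`|mu| <= d) && (`|mu| <= e') by rewrite -le_min.
rewrite leq_eqVlt ltnS => /predU1P[->|]; last first.
  by move=> iN; have [h1 h2] := Hd u mu i ud md iN; split; exact: le_trans e'le.
have [h1 h2] := Hd u mu n ud md (leqnn n).
have h : `|iterate_branch mu n.+1 u - y n.+1| <=
    L * `|iterate_branch mu n u - y n| + (L + 1) * `|mu|.
  exact: (branch_near (conj (le_trans h1 e'r) (le_trans h2 e'r))).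
have k1 : L * `|iterate_branch mu n u - y n| <= L * e' by rewrite ler_pM2l.
have k2 : (L + 1) * `|mu| <= (L + 1) * e'.
    by apply: ler_wpM2l => //; have := L0; lra.
have h' : `|iterate_branch mu n.+1 u - y n.+1| + `|mu| <= e.
  apply: le_trans e'e; move: h k1 k2 me.
    set X := `|_|; set Y := L * _; set W := (L + 1) * _ => h k1 k2 me.
    have -> : e' * (2 * L + 2) = L * e' + (L + 1) * e' + e' by ring.
    by lra.
split; first by apply: le_trans h'; rewrite lerDl.
by rewrite addrAC; apply: le_trans (ler_normB _ _) h'.
Qed.

(** The chain rule with remainders. Translation by mu leaves the constants of the maps unchanged, so
    K serves all parameters. *)
Lemma iterate_taylor_branch n : exists2 K : R, 0 < K & forall mu u v,
  (forall i, (i < n)%N -> admissible mu i (iterate_branch mu i u)) ->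
  (forall i, (i < n)%N -> admissible mu i (iterate_branch mu i v)) ->
  [/\ `|iterate_slope mu n u| <= K,
    `|iterate_branch mu n v - iterate_branch mu n u| <= K * `|v - u| &
    `|iterate_branch mu n v - iterate_branch mu n u - iterate_slope mu n u * (v - u)|
      <= K * (v - u) ^+ 2].
Proof.
elim: n => [|n [K K0 IH]].
  exists 1 => // mu u v _ _; rewrite /iterate_slope big_ord0 /= !mul1r normr1 subrr normr0.
  by split; rewrite ?sqr_ge0.
have K1 : 0 < C * K ^+ 2 by rewrite mulr_gt0// exprn_gt0.
have K2 : 0 < C * K by rewrite mulr_gt0.
have K3 : 0 < L * K by rewrite mulr_gt0.
exists (C * K ^+ 2 + C * K + L * K) => [|mu u v Hu Hv]; first by rewrite !addr_gt0.
have [h1 h2 h3] := IH mu u v (fun i h => Hu i (leqW h)) (fun i h => Hv i (leqW h)).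
have au := Hu n (leqnn _); have av := Hv n (leqnn _).
have [_ s1 s2 _] := branchB au av.
rewrite /iterate_slope big_ord_recr /= -/(iterate_slope mu n u).
set s := branch_slope _ _ _ in s1 s2 *; set x := iterate_branch mu n u in s2 h2 h3 au av *.
set z := iterate_branch mu n v in s2 h2 h3 av *; set A := iterate_slope mu n u in h1 h3 *.
have sq0 := sqr_ge0 (v - u); have n0 := normr_ge0 (v - u).
split.
- rewrite normrM mulrC; apply: le_trans (ler_pM _ _ s1 h1) _ => //.
  by rewrite -addrA [X in _ <= X]addrCA lerDl addr_ge0// ltW.
- have lip : `|branch mu n z - branch mu n x| <= L * `|z - x|.
    rewrite /branch; have [a1 a2] := au; have [b1 b2] := av.
    case: ifP => _; last exact: branch_lipschitz.
    have -> : F n (z - mu) + mu - (F n (x - mu) + mu) = F n (z - mu) - F n (x - mu) by ring.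
    have -> : z - x = (z - mu) - (x - mu) by ring.
    exact: branch_lipschitz.
  apply: le_trans lip _; apply: (@le_trans _ _ (L * K * `|v - u|)).
    by rewrite -mulrA ler_pM2l.
  by rewrite ler_wpM2r// lerDr addr_ge0// ltW.
have -> : branch mu n z - branch mu n x - A * s * (v - u) =
  (branch mu n z - branch mu n x - s * (z - x)) + s * (z - x - A * (v - u)) by ring.
apply: le_trans (ler_normD _ _) _; rewrite normrM.
apply: (@le_trans _ _ (C * K ^+ 2 * (v - u) ^+ 2 + C * K * (v - u) ^+ 2)); last first.
  by rewrite -mulrDl ler_wpM2r// lerDl ltW.
apply: lerD; last by rewrite -mulrA; apply: ler_pM.
apply: le_trans s2 _; rewrite -mulrA ler_pM2l//.
rewrite -real_normK ?num_real// -[X in _ <= _ * X]real_normK ?num_real//.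
by rewrite -exprMn ler_pXn2r ?nnegrE ?mulr_ge0 ?(ltW K0).
Qed.

(** A decreasing map turns a nonnegative difference into a nonpositive one. The next map, in x > 0,
    has its argument lowered further by the larger parameter, so its value rises, and the final
    translation adds mu' - mu. For n = 0 the factor [(0 < n)] is 0, as nothing has been gained
    yet. *)
Lemma iterate_branch_mono n mu mu' u : mu <= mu' ->
  (forall i, (i < n)%N -> admissible mu i (iterate_branch mu i u)) ->
  (forall i, (i < n)%N -> admissible mu' i (iterate_branch mu' i u)) ->
  if odd n then iterate_branch mu' n u <= iterate_branch mu n u
  else (0 < n)%N%:R * (mu' - mu) <= iterate_branch mu' n u - iterate_branch mu n u.
Proof.
move=> mm; elim: n => [|n IH] Hu Hu'; first by rewrite /= mul0r subrr.
have := IH (fun i h => Hu i (leqW h)) (fun i h => Hu' i (leqW h)).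
have [a1 a2] := Hu n (leqnn _); have [b1 b2] := Hu' n (leqnn _).
rewrite /= /branch; case: ifP => _ /= h.
  rewrite mul1r.
  have [_ _ _ H] := HF b2 a2.
  have : F n (iterate_branch mu n u - mu) <= F n (iterate_branch mu' n u - mu').
    apply: H; move: mm h; set a := iterate_branch _ _ _; set b := iterate_branch _ _ _; lra.
  move: mm; set a := F n _; set b := F n _; move=> /=; lra.
have [_ _ _ H] := HF a1 b1; apply: H; rewrite -subr_ge0; apply: le_trans h.
by rewrite mulr_ge0// subr_ge0.
Qed.

Lemma iterate_branch_lipschitz_mu n : exists2 K : R, 0 < K & forall mu u,
  (forall i, (i < n)%N -> admissible mu i (iterate_branch mu i u)) ->
  (forall i, (i < n)%N -> admissible 0 i (iterate_branch 0 i u)) ->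
  `|iterate_branch mu n u - iterate_branch 0 n u| <= K * `|mu|.
Proof.
elim: n => [|n [K K0 IH]].
  by exists 1 => // mu u _ _; rewrite subrr normr0 mulr_ge0.
exists (L * (K + 1) + 1) => [|mu u Hu Hu'].
  by rewrite addr_gt0// mulr_gt0// addr_gt0.
have := IH mu u (fun i h => Hu i (leqW h)) (fun i h => Hu' i (leqW h)).
have [a1 a2] := Hu n (leqnn _); have [b1 b2] := Hu' n (leqnn _).
rewrite /= /branch; case: ifP => _ h; last first.
  apply: le_trans (branch_lipschitz b1 a1) _.
  apply: (@le_trans _ _ (L * (K * `|mu|))); first by rewrite ler_pM2l.
  rewrite mulrA ler_wpM2r// mulrDr mulr1 -addrA lerDl addr_ge0//; exact: ltW.
set x := iterate_branch mu n u in h a1 a2 *; set x' := iterate_branch 0 n u in h b1 b2 *.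
have -> : F n (x - mu) + mu - (F n (x' - 0) + 0) = (F n (x - mu) - F n (x' - 0)) + mu by ring.
apply: le_trans (ler_normD _ _) _; rewrite mulrDl mul1r lerD2r.
apply: le_trans (branch_lipschitz b2 a2) _; rewrite -mulrA ler_pM2l// subr0 addrAC.
by apply: le_trans (ler_normB _ _) _; rewrite mulrDl mul1r lerD2r.
Qed.

End PerturbedIterates.

(** * Uniform half-return maps along a cycle *)

Section CyclePerturbation.
Context {R : realType}.
Implicit Types (Z : pw_field R) (Co : set (R * R)).

Lemma finite_set_isolated (E : set R) (x : R) : finite_set E ->
  exists2 d : R, 0 < d & forall w, E w -> w <> x -> d <= `|w - x|.
Proof.
move=> /finite_seqP[s ->]; elim: s => [|w s [d d0 Hd]]; first by exists 1.
have [->|wx] := eqVneq w x.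
  exists d => // w'; rewrite /= inE => /predU1P[-> /(_ erefl)//|]; exact: Hd.
exists (Num.min d `|w - x|) => [|w'].
  by rewrite lt_min d0 normr_gt0 subr_eq0.
rewrite /= inE => /predU1P[-> _|ws wx']; first by rewrite ge_min lexx orbT.
by rewrite ge_min Hd.
Qed.

(** Compactness of one period, by [cousin] for a radius valid on all times in [0, w[. Going up to
    [T + 1] includes the time [T]. *)
Lemma periodic_orbit_tube Z Co (U : set (R * R)) : periodic_orbit Z Co -> open U -> Co `<=` U ->
  exists2 e : R, 0 < e & forall z z', Co z -> `|z' - z| < e -> U z'.
Proof.
move=> [g [T [Hg [T0 per] _ ->]]] Uo gU.
pose P w := exists2 e : R, 0 < e & forall t z', 0 <= t < w -> `|z' - g t| < e -> U z'.
have T1 : 0 <= T + 1 by rewrite addr_ge0// ltW.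
have [||e e0 He] := @cousin R P 0 (T + 1) T1.
- by exists 1 => // t z' /andP[t0 /(le_lt_trans t0)]; rewrite ltxx.
- move=> x _.
  have gx : U (g x) by apply: gU; exists x.
  have /nbhs_normP[/= e e0 He] : nbhs (g x) U by exact: open_nbhs_nbhs.
  have e2 : 0 < e / 2 by rewrite divr_gt0.
  have [d d0 Hd] := @global_trajectory_cts R Z g x Hg _ e2.
  exists d => // u w _ _ xu _ _ wx [e1 e10 He1].
  exists (Num.min e1 (e / 2)) => [|t z' /andP[t0 tw]]; first by rewrite lt_min e10.
  rewrite lt_min => /andP[near1 near].
  have [tu|ut] := ltP t u; first by apply: (He1 t); rewrite ?t0.
  apply: He => /=.
  have gt : `|g t - g x| < e / 2 by apply: Hd; rewrite ltr_distl; move: xu ut tw wx; lra.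
  rewrite distrC -(subrK (g t) z') -addrA; apply: le_lt_trans (ler_normD _ _) _.
  move: near gt; lra.
exists e => // z z' [t _ <-]; have [s /andP[s0 sT] ->] := periodic_compact T0 per t.
by apply: He; rewrite s0 (le_lt_trans sT)// ltrDl.
Qed.

Lemma cycle_branches Z Co : crossing_limit_cycle Z Co ->
  exists (N : nat) (y : nat -> R) (rho C : R) (F dF : nat -> R -> R),
   [/\ [/\ (0 < N)%N, ~~ odd N, 0 < rho & 0 < C],
     [/\ forall i, y (i + N)%N = y i,
       forall i j, (i < N)%N -> (j < N)%N -> y i = y j -> i = j & forall i, Co (0, y i)],
     forall i, decreasing_branch (y i) rho C (F i) (dF i),
     forall i, F i (y i) = y i.+1 &
     forall i u, `|u - y i| <= rho -> exists T h,
       arc (side_field Z (odd i)) (sgn (odd i)) u (F i u) T h /\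
       forall t, 0 <= t <= T -> exists2 z, Co z & `|h t - z| <= C * `|u - y i|].
Proof.
move=> HC; have [N [y [T [h [[N0 Nodd] per inj Harcs Hh]]]]] := crossing_cycle_nodes HC.
have oddm i : odd (i %% N) = odd i by rewrite odd_mod//; exact/negbTE.
(* d is both the radius and the inverse of the constant: shrinking this one number weakens every
   clause, so [finite_min] applies. *)
pose Q (i : nat) (d : R) (FF : (R -> R) * (R -> R)) := [/\ FF.1 (y i) = y i.+1,
   decreasing_branch (y i) d d^-1 FF.1 FF.2 &
   forall u, `|u - y i| <= d -> exists T' h',
     arc (side_field Z (odd i)) (sgn (odd i)) u (FF.1 u) T' h' /\
     forall t, 0 <= t <= T' -> exists2 z, Co z & `|h' t - z| <= d^-1 * `|u - y i|].
have [d d0 Hd] : exists2 d : R, 0 < d & forall i, (i < N)%N -> exists FF, Q i d FF.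
  apply: (@finite_min R N (fun i d => exists FF, Q i d FF)) => [i d d' d'0 dd [FF [h1 h2 h3]]|i _].
    have dV : d^-1 <= d'^-1 by rewrite lef_pV2 ?posrE// (lt_le_trans d'0).
    exists FF; split=> // [u v ur vr|u ur].
      have [k1 k2 k3 k4] := h2 u v (le_trans ur dd) (le_trans vr dd).
      split=> //; first exact: le_trans dV.
      by apply: le_trans k3 _; rewrite ler_wpM2r// sqr_ge0.
    have [T' [h' [k1 k2]]] := h3 u (le_trans ur dd).
    exists T', h'; split => // t tT; have [z Cz zh] := k2 t tT; exists z => //.
    by apply: le_trans zh _; rewrite ler_wpM2r.
  have [rho [C [F [dF [rho0 C0 Fy HF Harc]]]]] :=
    half_map (side_field_smooth Z (odd i)) (norm_sgn (odd i)) (Harcs i).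
  pose d := Num.min rho C^-1.
  have d0 : 0 < d by rewrite lt_min rho0 invr_gt0.
  have dr : d <= rho by rewrite ge_min lexx.
  have Cd : C <= d^-1.
    by rewrite -[C]invrK lef_pV2 ?posrE ?invr_gt0// ge_min lexx orbT.
  exists d => //; exists (F, dF); split=> // [u v ur vr|u ur] /=.
    have [k1 k2 k3 k4] := HF u v (le_trans ur dr) (le_trans vr dr).
    split=> //; first exact: le_trans Cd.
    by apply: le_trans k3 _; rewrite ler_wpM2r// sqr_ge0.
  have [T' [h' [k1 k2]]] := Harc u (le_trans ur dr).
  exists T', h'; split => // t tT; have [t' t'T zh] := k2 t tT.
  exists (h i t'); first exact: Hh.
  by apply: le_trans zh _; rewrite ler_wpM2r.
have [FF HFF] := choice (fun i => Hd (i %% N)%N (ltn_pmod i N0)).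
have yS i : y (i %% N).+1 = y i.+1.
  have E : ((i %% N).+1 %% N = i.+1 %% N)%N by rewrite -addn1 modnDml addn1.
  exact: etrans (periodic_modn per _) (etrans (congr1 y E) (esym (periodic_modn per _))).
exists N, y, d, d^-1, (fun i => (FF i).1), (fun i => (FF i).2); split.
- by split; rewrite ?invr_gt0.
- split=> // i.
  have [T0 [h0 _] _ _ _] := Harcs i; rewrite -h0; apply: Hh.
  by rewrite lexx ltW.
- by move=> i; have [_ + _] := HFF i; rewrite -(periodic_modn per).
- by move=> i; have [+ _ _] := HFF i; rewrite -(periodic_modn per) yS.
- move=> i u; have [_ _] := HFF i; rewrite -(periodic_modn per) oddm; exact.
Qed.

End CyclePerturbation.

(** * The displacement function of a cycle *)

Section CycleDisplacement.
Context {R : realType}.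
Implicit Types (Z : pw_field R) (Co : set (R * R)).

(* [D mu u] is the displacement of the return map of [perturbed Z mu j] at
   [(0, u)], which does not depend on [j], and [A mu u] is its derivative in u. *)
Record displacement Z Co (r y0 rho K : R) (D A : R -> R -> R) : Prop := Displacement {
  displacement_base : Co (0, y0);
  displacement_rho : 0 < rho;
  displacement_rho_le : rho <= r;
  displacement_K : 0 < K;
  displacement_cycle : forall mu u j, `|mu| <= rho -> `|u - y0| <= rho ->
    D mu u = 0 -> A mu u <> 0 -> exists C' : set (R * R),
    [/\ crossing_limit_cycle (perturbed Z mu j) C', hyperbolic (perturbed Z mu j) C',
      C' (0, u) & forall w, C' (0, w) -> w = u \/
        exists2 w', Co (0, w') /\ w' <> y0 & `|w - w'| < r];
  displacement_zero : D 0 y0 = 0;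
  displacement_isolated : forall u, `|u - y0| <= rho -> D 0 u = 0 -> u = y0;
  displacement_mono : forall mu mu' u, `|mu| <= rho -> `|mu'| <= rho ->
    `|u - y0| <= rho -> mu <= mu' -> mu' - mu <= D mu' u - D mu u;
  displacement_taylor : forall mu u v, `|mu| <= rho -> `|u - y0| <= rho -> `|v - y0| <= rho ->
    `|D mu v - D mu u - A mu u * (v - u)| <= K * (v - u) ^+ 2;
  displacement_slope : forall mu u, `|mu| <= rho -> `|u - y0| <= rho -> `|A mu u| <= K;
  displacement_lip : forall mu u, `|mu| <= rho -> `|u - y0| <= rho ->
    `|D mu u - D 0 u| <= K * `|mu|
}.

(** A fixed point of the N-fold composition closes up the chain. Its nodes lie within e of the old
    ones, so the gap [3 * e] keeps them distinct and balls of radius [rho / 2] about them stay in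
    the domains of the half-maps. *)
Lemma perturbed_return_chain Z (N : nat) (y : nat -> R) (rho C e mu u : R)
    (F dF : nat -> R -> R) (j : nat) :
  (0 < N)%N -> ~~ odd N -> 0 < rho -> 0 < C ->
  (forall i, decreasing_branch (y i) rho C (F i) (dF i)) ->
  (forall i u, `|u - y i| <= rho -> exists T h,
     arc (side_field Z (odd i)) (sgn (odd i)) u (F i u) T h) ->
  (forall i k, (i < N)%N -> (k < N)%N -> i <> k -> 3 * e <= `|y i - y k|) ->
  0 < e -> e <= rho / 2 ->
  (forall i, (i < N)%N -> `|iterate_branch F mu i u - y i| <= e /\
     `|iterate_branch F mu i u - mu - y i| <= e) ->
  iterate_branch F mu N u = u ->
  return_chain (perturbed Z mu j) N false (fun i => iterate_branch F mu (i %% N) u)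
    (fun i => branch F mu (i %% N))
    (fun i => branch_slope dF mu (i %% N) (iterate_branch F mu (i %% N) u)) (rho / 2) C.
Proof.
move=> N0 Nodd rho0 C0 HF Harc gap e0 er near close.
have oddm i : odd (i %% N) = odd i by rewrite odd_mod//; exact/negbTE.
have h2 : rho / 2 <= rho by rewrite ler_pdivrMr// ler_peMr ?ler1n// ltW.
have adm i : (i < N)%N -> admissible y rho mu i (iterate_branch F mu i u).
  by move=> /near[h k]; split; [apply: le_trans h _|apply: le_trans k _]; exact: le_trans er h2.
have adm' i w : `|w - iterate_branch F mu (i %% N) u| <= rho / 2 -> admissible y rho mu (i %% N) w.
  have [h k] := near _ (ltn_pmod i N0); set x := iterate_branch _ _ _ _ in h k *.
  move=> wx; split.
    rewrite -(subrK x w) -addrA; apply: le_trans (ler_normD _ _) _.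
    by rewrite [rho]splitr; apply: lerD => //; exact: le_trans er.
  have -> : w - mu - y (i %% N)%N = (w - x) + (x - mu - y (i %% N)%N) by ring.
  apply: le_trans (ler_normD _ _) _.
  by rewrite [rho]splitr; apply: lerD => //; exact: le_trans er.
have step i : branch F mu (i %% N) (iterate_branch F mu (i %% N) u) =
    iterate_branch F mu (i.+1 %% N) u.
  have E : ((i %% N).+1 %% N = i.+1 %% N)%N by rewrite -addn1 modnDml addn1.
  rewrite -E; have := ltn_pmod i N0; rewrite leq_eqVlt => /predU1P[iN|iN].
    rewrite iN modnn /= -[RHS]close. by rewrite -[in RHS]iN.
  by rewrite (modn_small iN).
split => //.
- by rewrite divr_gt0.
- by move=> i; rewrite modnDr.
- by move=> i; rewrite modnDr.
- by move=> i; rewrite modnDr.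
- move=> i k iN kN; rewrite !modn_small// => E; apply: contrapT => ik.
  have := gap i k iN kN ik; have [h _] := near i iN; have [h' _] := near k kN.
  rewrite E in h.
  have : `|y i - y k| <= e + e.
    have -> : y i - y k = (iterate_branch F mu k u - y k) - (iterate_branch F mu k u - y i) by ring.
    by apply: le_trans (ler_normB _ _) _; exact: lerD.
  lra.
- move=> i w /adm'[w1 w2]; rewrite addFb -oddm /branch; case: ifP => ii.
    have [T [h Ha]] := Harc _ _ w2; rewrite ii in Ha.
    by have := arc_perturbed mu j Ha; rewrite subrK.
  by have [T [h Ha]] := Harc _ _ w1; exists T, h; rewrite ii in Ha.
- by move=> i w /adm' aw; have [_ _] := branchB HF (adm _ (ltn_pmod i N0)) aw; rewrite step.
- by move=> i; have ai := adm _ (ltn_pmod i N0); have [] := branchB HF ai ai.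
Qed.

Lemma cycle_displacement Z Co (r : R) : crossing_limit_cycle Z Co -> 0 < r ->
  exists y0 rho K D A, displacement Z Co r y0 rho K D A.
Proof.
move=> HC r0.
have [N [y [rho [C [F [dF [[N0 Nodd rho0 C0] [per inj Cy] HF Fy Harc]]]]]]] := cycle_branches HC.
have [[po [U [Uo CU iso]]] _ fin _] := HC.
have fin' : finite_set [set w | Co (0, w)].
  apply: sub_finite_set (finite_image snd fin) => w Cw.
  by exists (0, w) => //; split.
have [del del0 Hdel] : exists2 del : R, 0 < del & forall i, (i < N)%N ->
    forall w, Co (0, w) -> w <> y i -> del <= `|w - y i|.
  apply: (@finite_min R N (fun i d => forall w, Co (0, w) -> w <> y i -> d <= `|w - y i|)).
    by move=> i d d' _ dd Hd w Cw wy; apply: le_trans dd (Hd _ Cw wy).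
  by move=> i _; have [d d0 Hd] := finite_set_isolated (y i) fin'; exists d.
have [e1 e10 Htube] := periodic_orbit_tube po Uo CU.
(* In order: domains of the half-maps, distinct nodes, arcs inside the isolating neighbourhood [U],
   and location of the other hits to within r. *)
pose e := Num.min (Num.min (rho / 2) (del / 3)) (Num.min (e1 / (2 * C)) (r / 2)).
have /andP[/andP[er ed] /andP[eC e_r]] : ((e <= rho / 2) && (e <= del / 3)) &&
   ((e <= e1 / (2 * C)) && (e <= r / 2)) by rewrite -!le_min.
have e0 : 0 < e by rewrite !lt_min !divr_gt0// mulr_gt0.
have Ce : C * e < e1.
  move: eC; rewrite ler_pdivlMr ?mulr_gt0// => eC.
  by have := mulr_gt0 C0 e0; move: eC; rewrite mulrCA [e * C]mulrC; lra.
have [d1 d10 near] := iterate_branch_near rho0 C0 HF Fy N e0.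
have adm mu u : `|mu| <= d1 -> `|u - y 0%N| <= d1 -> forall i, (i < N)%N ->
    admissible y rho mu i (iterate_branch F mu i u).
  move=> mud ud i /ltnW iN; have [h1 h2] := near u mu i ud mud iN.
  have er' : e <= rho by move: er rho0; clear; lra.
  by split; [apply: le_trans h1 _|apply: le_trans h2 _].
have [K1 K10 HK1] := iterate_taylor_branch rho0 C0 HF N.
have [K2 K20 HK2] := iterate_branch_lipschitz_mu rho0 C0 HF N.
pose d := Num.min d1 (Num.min r (del / 2)).
have /andP[dd1 /andP[dr ddel]] : (d <= d1) && ((d <= r) && (d <= del / 2)) by rewrite -!le_min.
have d0 : 0 < d by rewrite !lt_min d10 r0 divr_gt0.
have y00 : `|y 0%N - y 0%N| <= d1 by rewrite subrr normr0 ltW.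
have m0 : `|0 : R| <= d1 by rewrite normr0 ltW.
have ity i : iterate_branch F 0 i (y 0%N) = y i.
  elim: i => //= i ->; rewrite /branch; case: ifP => _; rewrite ?subr0 ?addr0; exact: Fy.
have gap i k : (i < N)%N -> (k < N)%N -> i <> k -> 3 * e <= `|y i - y k|.
  move=> iN kN ik; have := Hdel k kN (y i) (Cy i) (fun E => ik (inj _ _ iN kN E)).
  by move: ed; rewrite ler_pdivlMr// mulrC; exact: le_trans.
have Harc' i u : `|u - y i| <= rho -> exists T h,
    arc (side_field Z (odd i)) (sgn (odd i)) u (F i u) T h.
  by move=> /Harc[T [h [h1 _]]]; exists T, h.
exists (y 0%N), d, (K1 + K2 + 1), (fun mu u => iterate_branch F mu N u - u),
  (fun mu u => iterate_slope F dF mu N u - 1); split => //.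
- by rewrite !addr_gt0.
- move=> mu u j mud ud /eqP; rewrite subr_eq0 => /eqP Du Au.
  have ud1 := le_trans ud dd1; have mud1 := le_trans mud dd1.
  have nr i : (i < N)%N -> `|iterate_branch F mu i u - y i| <= e /\
     `|iterate_branch F mu i u - mu - y i| <= e by move=> /ltnW; exact: near.
  have Hch := perturbed_return_chain j N0 Nodd rho0 C0 HF Harc' gap e0 er nr Du.
  have [|C' [h1 h2 h3 h4]] := return_chain_cycle Hch.
    move=> E; apply: Au; rewrite -E; apply/eqP; rewrite subr_eq0; apply/eqP.
    by apply: eq_bigr => i _; rewrite modn_small.
  exists C'; split => //; first by move: h3; rewrite mod0n.
  move=> w /h4[[|i] iN ->]; first by left; rewrite mod0n.
  right; rewrite modn_small//; exists (y i.+1).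
    by split=> // /inj => /(_ iN N0).
  have [h _] := nr _ iN; apply: le_lt_trans h _; move: e_r r0; clear; lra.
- by rewrite ity (per 0%N) subrr.
(* A zero of [D 0] closes up arcs within [C * e] of [Co], hence inside [U]. By isolation their orbit
   is [Co], whose only point on the line within [del / 2] of node 0 is that node. *)
- move=> u ud /eqP; rewrite subr_eq0 => /eqP Du; apply: contrapT => uy.
  have ud1 := le_trans ud dd1; have adu := adm 0 u m0 ud1.
  have ex i : exists Th : R * (R -> R * R), (i < N)%N ->
      arc (side_field Z (odd i)) (sgn (odd i)) (iterate_branch F 0 i u)
        (iterate_branch F 0 i.+1 u) Th.1 Th.2 /\
      forall t, 0 <= t <= Th.1 -> exists2 z, Co z & `|Th.2 t - z| <= C * e.
    have [iN|] := ltnP i N; last by move=> Ni; exists (0, cst 0).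
    have [a1 _] := adu i iN; have [T [h [Ha Hh]]] := Harc i _ a1.
    exists (T, h) => _; split=> [|t /Hh[z Cz hz]].
      by rewrite /= /branch subr0 addr0 if_same.
    exists z => //; apply: le_trans hz _; rewrite ler_pM2l//.
    exact: (near u 0 i ud1 m0 (ltnW iN)).1.
  have [Th HTh] := choice ex.
  have [||Co' [h1 h2 _ h4]] := @closed_arcs_orbit R Z false N (fun i => iterate_branch F 0 i u)
      (fun i => (Th i).1) (fun i => (Th i).2) N0 _ _.
  - by move=> i iN; exact: (HTh i iN).1.
  - exact: Du.
  have E : Co' = Co.
    apply: iso => // z /h4[i [t [iN tT ->]]]; have [_ /(_ t tT)[z' Cz' hz]] := HTh i iN.
    by apply: Htube Cz' _; exact: le_lt_trans Ce.
  rewrite E in h2; have := Hdel 0%N N0 u h2 uy; move: ud ddel del0; clear; lra.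
- move=> mu mu' u mud mud' ud mm.
  have ud1 := le_trans ud dd1.
  have := iterate_branch_mono HF mm (adm _ _ (le_trans mud dd1) ud1)
    (adm _ _ (le_trans mud' dd1) ud1).
  rewrite (negbTE Nodd) (_ : (0 < N)%N = true)// mul1r => h; apply: le_trans h _.
  by rewrite le_eqVlt; apply/orP; left; apply/eqP; ring.
- move=> mu u v mud ud vd; have mud1 := le_trans mud dd1.
  have [_ _ h] := HK1 mu u v (adm _ _ mud1 (le_trans ud dd1)) (adm _ _ mud1 (le_trans vd dd1)).
  have -> : iterate_branch F mu N v - v - (iterate_branch F mu N u - u) -
      (iterate_slope F dF mu N u - 1) * (v - u) = iterate_branch F mu N v -
      iterate_branch F mu N u - iterate_slope F dF mu N u * (v - u) by ring.
  by apply: le_trans h _; rewrite ler_wpM2r ?sqr_ge0// -addrA lerDl addr_ge0// ltW.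
- move=> mu u mud ud; have a := adm _ _ (le_trans mud dd1) (le_trans ud dd1).
  have [h _ _] := HK1 mu u u a a; apply: le_trans (ler_normB _ _) _.
  by rewrite normr1 lerD2r (le_trans h)// lerDl ltW.
- move=> mu u mud ud; have ud1 := le_trans ud dd1.
  have h := HK2 mu u (adm _ _ (le_trans mud dd1) ud1) (adm _ _ m0 ud1).
  have -> : iterate_branch F mu N u - u - (iterate_branch F 0 N u - u) =
    iterate_branch F mu N u - iterate_branch F 0 N u by ring.
  by apply: le_trans h _; rewrite ler_wpM2r// addrAC lerDr addr_ge0// ltW.
Qed.

End CycleDisplacement.

(** * Parameters without critical zeros, and the count of cycles *)

Section CriticalParameters.
Context {R : realType}.
Implicit Types (Z : pw_field R) (Co : set (R * R)).

Lemma truncn_eq_dist (x y : R) : 0 <= x -> 0 <= y -> Num.truncn x = Num.truncn y -> `|x - y| < 1.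
Proof.
move=> /truncn_itv + /truncn_itv + E; rewrite E -natr1 ltr_norml => /andP[h1 h2] /andP[h3 h4].
by move: h1 h2 h3 h4; lra.
Qed.

(* A quantitative Sard argument: a cell of a subdivision of the u-intervals
   into q cells has critical points only for values of mu within O(q ^- 2) of
   each other, so the O(q) cells cannot exhaust q ^ 2 equidistant values. *)
Lemma critical_avoidance (m : nat) (y rho K : nat -> R) (bad : nat -> R -> R -> Prop) (eta : R) :
  (forall i, (i < m)%N -> 0 < rho i) -> (forall i, (i < m)%N -> 0 < K i) -> 0 < eta ->
  (forall i mu u, (i < m)%N -> bad i mu u -> `|u - y i| <= rho i) ->
  (forall i mu mu' u u', (i < m)%N -> 0 < mu <= eta -> 0 < mu' <= eta ->
     bad i mu u -> bad i mu' u' -> `|mu - mu'| <= K i * (u - u') ^+ 2) ->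
  exists2 mu : R, 0 < mu <= eta & forall i u, (i < m)%N -> ~ bad i mu u.
Proof.
move=> rho0 K0 eta0 near crit; apply: contrapT => no.
have ex mu : 0 < mu <= eta -> exists iu : 'I_m * R, bad iu.1 mu iu.2.
  move=> mue; apply: contrapT => H; apply: no; exists mu => // i u im bi.
  by apply: H; exists (Ordinal im, u).
(* Two bad parameters with zeros in one cell of length 2 rho / q differ by at most 4 K rho^2 / q^2,
   hence by at most 1 / (del q^2). *)
have [del del0 Hdel] : exists2 del : R, 0 < del &
    forall i, (i < m)%N -> del * (4 * K i * rho i ^+ 2) <= 1.
  have c0 i : (i < m)%N -> 0 < 4 * K i * rho i ^+ 2.
    move=> im; apply: mulr_gt0; first by apply: mulr_gt0 => //; exact: K0.
    by apply: exprn_gt0; exact: rho0.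
  suff [d d0 Hd] : exists2 d : R, 0 < d & forall i, (i < m)%N ->
      (i < m)%N -> d * (4 * K i * rho i ^+ 2) <= 1 by exists d => // i im; exact: Hd.
  apply: finite_min => [i d d' d'0 dd H im|i im].
    by apply: le_trans (H im); rewrite ler_wpM2r// ltW// c0.
  exists (4 * K i * rho i ^+ 2)^-1 => [|_]; first by rewrite invr_gt0 c0.
  by rewrite mulVf// gt_eqF// c0.
(* q is so large that [del * eta * q ^+ 2] exceeds [(2 * m + 1) * q], which in turn bounds the
   number [M] of sampled values. *)
pose q := (Num.bound ((2 * m + 1)%N%:R / (del * eta))).
have q0 : 0 < (q%:R : R).
  apply: le_lt_trans (archi_boundP _); rewrite divr_ge0// mulr_ge0 ?ltW//.
have qlarge : (2 * m + 1)%N%:R < del * eta * q%:R.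
  rewrite mulrC -ltr_pdivrMr ?mulr_gt0//; apply: archi_boundP.
  by rewrite divr_ge0// mulr_ge0 ?ltW.
(* One value more than there are cells: each interval is rescaled to [0, q], and its right end takes
   a cell of its own, which makes q + 1. *)
pose M := (m * q.+1).+1.
have M0 : 0 < (M%:R : R) by rewrite ltr0n.
pose val (k : 'I_M) : R := eta * (k.+1%:R / M%:R).
have valP k : 0 < val k <= eta.
  rewrite /val mulr_gt0 ?divr_gt0//= ler_piMr ?(ltW eta0)// ler_pdivrMr// mul1r.
  by rewrite ler_nat; exact: ltn_ord.
have [iu Hiu] := choice (fun k : 'I_M => ex (val k) (valP k)).
pose X (k : 'I_M) := let i := (iu k).1 in
  ((iu k).2 - y i + rho i) * (q%:R / (2 * rho i)).
have rk k : 0 < 2 * rho (iu k).1 by rewrite mulr_gt0// rho0.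
have X0 k : 0 <= X k.
  rewrite mulr_ge0 ?divr_ge0 ?(ltW q0) ?(ltW (rk k))//.
  by have := near _ _ _ (ltn_ord _) (Hiu k); rewrite ler_norml; lra.
have Xq k : (Num.truncn (X k) < q.+1)%N.
  rewrite ltnS -(ler_nat R); apply: (@le_trans _ _ (X k)).
    by rewrite truncn_le.
  rewrite /X mulrA ler_pdivrMr// mulrC ler_pM2l//.
  by have := near _ _ _ (ltn_ord _) (Hiu k); rewrite ler_norml; lra.
pose f k := ((iu k).1, Ordinal (Xq k)).
have /injectivePn[k [k' kk' []]] : ~~ injectiveb f.
  apply/negP => /injectiveP/leq_card; rewrite card_prod !card_ord /M.
  by rewrite ltnn.
move=> ik /(truncn_eq_dist (X0 k) (X0 k')); rewrite /X ik.
set i := (iu k').1 in ik *; set u := (iu k).2; set u' := (iu k').2 => XX.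
have im : (i < m)%N := ltn_ord i.
have bk := Hiu k; have bk' := Hiu k'; rewrite ik in bk.
have := crit i _ _ _ _ im (valP k) (valP k') bk bk'; rewrite -/u -/u' => E.
have r2 : 0 < 2 * rho i by rewrite mulr_gt0// rho0.
have s1 : (u - u') ^+ 2 * q%:R ^+ 2 <= 4 * rho i ^+ 2.
  move: XX; rewrite -mulrBl normrM (gtr0_norm (divr_gt0 q0 r2)) mulrA ltr_pdivrMr// mul1r.
  have -> : u - y i + rho i - (u' - y i + rho i) = u - u' by ring.
  move=> XX; rewrite -real_normK ?num_real// -exprMn.
  have -> : 4 * rho i ^+ 2 = (2 * rho i) ^+ 2 by ring.
  by rewrite ler_pXn2r// ?nnegrE ?(ltW XX) ?(ltW r2)// mulr_ge0// ltW.
have s2 : eta <= M%:R * `|val k - val k'|.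
  rewrite /val -mulrBr normrM (gtr0_norm eta0) mulrCA ler_peMr ?(ltW eta0)//.
  rewrite -mulrBl normrM (gtr0_norm (x := M%:R^-1)) ?invr_gt0// mulrC divfK ?gt_eqF//.
  have -> : k.+1%:R - k'.+1%:R = k%:R - k'%:R :> R by rewrite -!natr1 opprD addrACA subrr addr0.
  have := kk'; rewrite neq_ltn => /orP[lt|lt].
    by rewrite distrC -natrB ?(ltnW lt)// normr_nat ler1n subn_gt0.
  by rewrite -natrB ?(ltnW lt)// normr_nat ler1n subn_gt0.
have MM : (M%:R : R) <= (2 * m + 1)%N%:R * q%:R.
  have q1 : (0 < q)%N by rewrite -(ltr0n R).
  rewrite -natrM ler_nat /M mulnS mulnDl mul1n mul2n -addnn mulnDl -addn1.
  by rewrite leq_add// leq_add2r leq_pmulr.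
have : del * eta * q%:R ^+ 2 <= (2 * m + 1)%N%:R * q%:R.
  apply: le_trans MM.
  have Kp := K0 i im; have dd := Hdel i im.
  have a1 : eta <= M%:R * (K i * (u - u') ^+ 2).
    by apply: le_trans s2 _; rewrite ler_pM2l.
  apply: (@le_trans _ _ (del * (M%:R * (K i * (u - u') ^+ 2)) * q%:R ^+ 2)).
    by rewrite ler_wpM2r ?sqr_ge0// ler_pM2l.
  have -> : del * (M%:R * (K i * (u - u') ^+ 2)) * q%:R ^+ 2 =
    M%:R * (del * (K i * ((u - u') ^+ 2 * q%:R ^+ 2))) by ring.
  rewrite -[leRHS]mulr1 ler_pM2l//; apply: le_trans dd; rewrite ler_pM2l//.
  have := ler_wpM2l (ltW Kp) s1.
  by have -> : K i * (4 * rho i ^+ 2) = 4 * K i * rho i ^+ 2 by ring.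
by rewrite expr2 mulrA ler_pM2r// leNgt qlarge.
Qed.

Section Displacement.
Context {Z : pw_field R} {Co : set (R * R)} {r y0 rho K : R} {D A : R -> R -> R}.
Hypothesis H : displacement Z Co r y0 rho K D A.

Let rho0 : 0 < rho := displacement_rho H.
Let K0 : 0 < K := displacement_K H.

(** The expansion at the critical zero u makes D mu u' quadratically small, while D mu' u' = 0 and
    growth at rate at least 1 in mu bound |mu - mu'| by |D mu u'|. *)
Lemma displacement_critical mu mu' u u' : `|mu| <= rho -> `|mu'| <= rho ->
  `|u - y0| <= rho -> `|u' - y0| <= rho -> D mu u = 0 -> A mu u = 0 -> D mu' u' = 0 ->
  `|mu - mu'| <= K * (u - u') ^+ 2.
Proof.
move=> m1 m2 u1 u2 Du Au Du'.
have : `|D mu u'| <= K * (u - u') ^+ 2.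
  have := displacement_taylor H m1 u1 u2; rewrite Du Au mul0r !subr0.
  by rewrite -sqrrN opprB.
apply: le_trans; have [le|/ltW le] := leP mu mu'.
  have := displacement_mono H m1 m2 u2 le; rewrite Du' sub0r distrC ger0_norm ?subr_ge0//.
  by move=> /le_trans; apply; rewrite -normrN ler_norm.
have := displacement_mono H m2 m1 u2 le; rewrite Du' subr0 ger0_norm ?subr_ge0//.
by move=> /le_trans; apply; exact: ler_norm.
Qed.

Lemma displacement_side_zero (b : bool) : exists c : bool, exists2 eta : R, 0 < eta &
  forall mu, 0 < mu <= eta -> exists2 u, `|u - y0| <= rho &
    0 < sgn b * (u - y0) /\ D (sgn c * mu) u = 0.
Proof.
(* Clamping makes p a Lipschitz map of the whole line into side b, so that continuity at both ends
   is two-sided, as [cts_IVT] asks. *)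
pose p t := y0 + sgn b * Num.max 0 (Num.min rho t).
have pE t : 0 <= t <= rho -> p t = y0 + sgn b * t.
  by move=> /andP[t0 tr]; rewrite /p (min_idPr tr) (max_idPr t0).
have sb : `|sgn b : R| = 1 by exact: norm_sgn.
have ss : sgn b * sgn b = 1 :> R by case: b {p pE sb}; rewrite /sgn ?mulrNN mulr1.
have pr t : `|p t - y0| <= rho.
  rewrite /p addrC addKr normrM sb mul1r ger0_norm ?le_max ?lexx//.
  by rewrite ge_max (ltW rho0) ge_min lexx.
have plip s t : `|p s - p t| <= `|s - t|.
  rewrite /p opprD addrACA subrr add0r -mulrBr normrM sb mul1r.
  exact: le_trans (max_lip _ _ _) (min_lip _ _ _).
have p0 : p 0 = y0 by rewrite pE ?mulr0 ?addr0// lexx ltW.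
have prho : p rho != y0.
  by rewrite pE ?lexx ?ltW// -subr_eq0 addrC addKr mulf_neq0 ?(gt_eqF rho0)// -normr_gt0 sb.
have Dp0 : D 0 (p rho) != 0.
  by apply: contra prho => /eqP Dp; apply/eqP; exact: (displacement_isolated H (pr _) Dp).
have d0 : 0 < `|D 0 (p rho)| by rewrite normr_gt0.
(* The parameter takes the sign opposite to that of [D 0] at the far end, so the displacement
   changes sign between y0 and that end. *)
exists (D 0 (p rho) < 0); set c := (_ < _).
have cD : sgn c * D 0 (p rho) = - `|D 0 (p rho)|.
  rewrite /c /sgn; have [lt|ge] := ltP (D 0 (p rho)) 0; first by rewrite mul1r ltr0_norm// opprK.
  by rewrite mulN1r ger0_norm.
have sc : `|sgn c : R| = 1 by exact: norm_sgn.
have nm (mu : R) : `|sgn c * mu| = `|mu| by rewrite normrM sc mul1r.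
(* Up to this size the Lipschitz bound in mu cannot reverse the sign at the far end. *)
pose eta := Num.min rho (`|D 0 (p rho)| / K).
have eta0 : 0 < eta by rewrite lt_min rho0 divr_gt0.
exists eta => // mu /andP[mu0 mueta].
have /andP[mur muD] : (mu <= rho) && (mu <= `|D 0 (p rho)| / K) by rewrite -le_min.
have mn : `|sgn c * mu| <= rho by rewrite nm gtr0_norm.
have z0 : `|0 : R| <= rho by rewrite normr0 ltW.
have yy : `|y0 - y0| <= rho by rewrite subrr normr0 ltW.
have end0 : mu <= sgn c * D (sgn c * mu) y0.
  case: c cD nm sc mn => _ _ _; rewrite /sgn ?mul1r ?mulN1r => mn.
    have := displacement_mono H z0 mn yy (ltW mu0).
    by rewrite (displacement_zero H) !subr0.
  have mn' : - mu <= 0 by rewrite oppr_le0 ltW.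
  have := displacement_mono H mn z0 yy mn'.
  by rewrite (displacement_zero H) !sub0r opprK.
have end1 : sgn c * D (sgn c * mu) (p rho) <= 0.
  have := displacement_lip H mn (pr rho); rewrite nm (gtr0_norm mu0).
  have -> : sgn c * D (sgn c * mu) (p rho) =
      sgn c * (D (sgn c * mu) (p rho) - D 0 (p rho)) + sgn c * D 0 (p rho) by ring.
  rewrite cD subr_le0 => h; apply: le_trans (ler_norm _) _; rewrite nm; apply: le_trans h _.
  by rewrite mulrC -ler_pdivlMr.
have cont t : 0 <= t <= rho -> cts (fun t => D (sgn c * mu) (p t)) t.
  move=> _ e e0; pose L := K + K * (2 * rho).
  have L0 : 0 < L by rewrite addr_gt0// mulr_gt0// mulr_gt0.
  exists (e / L) => [|s]; first exact: divr_gt0.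
  rewrite ltr_pdivlMr// mulrC; apply: le_lt_trans.
  have h1 := displacement_taylor H mn (pr t) (pr s).
  have h2 := displacement_slope H mn (pr t).
  have h3 : `|p s - p t| <= 2 * rho.
    have -> : p s - p t = (p s - y0) - (p t - y0) by ring.
    by apply: le_trans (ler_normB _ _) _; rewrite mulr_natl mulr2n lerD.
  have h4 := plip s t; set x := p s - p t in h1 h3 h4.
  have -> : D (sgn c * mu) (p s) - D (sgn c * mu) (p t) =
     A (sgn c * mu) (p t) * x + (D (sgn c * mu) (p s) - D (sgn c * mu) (p t) -
     A (sgn c * mu) (p t) * x) by rewrite subrKC.
  apply: le_trans (ler_normD _ _) _.
  apply: (@le_trans _ _ (L * `|x|)); last by rewrite ler_pM2l.
  rewrite /L mulrDl; apply: lerD; first by rewrite normrM ler_wpM2r.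
  apply: le_trans h1 _; rewrite -real_normK ?num_real// -mulrA ler_pM2l// expr2.
  by rewrite ler_wpM2r.
have [|t trho Dt] := cts_IVT (ltW rho0) cont.
  rewrite /= p0; case: c end0 end1 {cD nm sc mn cont}; rewrite /sgn ?mul1r ?mulN1r => h1 h2.
    by right; rewrite h2 (le_trans (ltW mu0)).
  by left; rewrite -oppr_ge0 (le_trans (ltW mu0) h1)/= -oppr_le0.
exists (p t) => //; split => //; rewrite pE// addrC addKr mulrA ss mul1r.
have /andP[t0 _] := trho; rewrite lt_neqAle t0 andbT; apply/eqP => E.
move: end0; rewrite -p0 E Dt mulr0 => /(lt_le_trans mu0); by rewrite ltxx.
Qed.

End Displacement.

End CriticalParameters.

(** * Counting cycles of the perturbed field *)

Section Counting.
Context {R : realType}.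
Implicit Types (Z : pw_field R) (Co : set (R * R)).

Lemma crossing_limit_cycle_eq Z C1 C2 w : crossing_limit_cycle Z C1 -> crossing_limit_cycle Z C2 ->
  C1 (0, w) -> C2 (0, w) -> C1 = C2.
Proof.
move=> [[[g1 [T1 [H1 [T10 per1] _ E1]]] _] _ _ cr1] [[[g2 [T2 [H2 [T20 per2] _ E2]]] _] _ _ _].
rewrite E1 E2 => -[t1 _ g1w] [t2 _ g2w].
apply: (range_eq_forward (t0 := t1) (t0' := t2) T10 T20 per1 per2).
apply: (trajectory_forward_unique H1 H2); last by rewrite g1w g2w.
by move=> t gt; apply: cr1; rewrite -(fst0_eq gt) E1; exists t.
Qed.

Lemma finite_set_gap (E : set R) : finite_set E ->
  exists2 d : R, 0 < d & forall x w, E x -> E w -> w <> x -> d <= `|w - x|.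
Proof.
move=> fE; have /finite_seqP[s Es] := fE.
have [d d0 Hd] : exists2 d : R, 0 < d & forall i, (i < size s)%N ->
    forall w, E w -> w <> nth 0 s i -> d <= `|w - nth 0 s i|.
  apply: (@finite_min R (size s) (fun i d => forall w, E w -> w <> nth 0 s i ->
    d <= `|w - nth 0 s i|)) => [i d d' _ dd H w Ew wi|i _].
    exact: le_trans dd (H _ Ew wi).
  by have [d d0 Hd] := finite_set_isolated (nth 0 s i) fE; exists d.
exists d => // x w; rewrite {1}Es /= => xs Ew wx.
by have := Hd (index x s) _ w Ew; rewrite nth_index// index_mem; exact.
Qed.

Lemma counting_ge (T : choiceType) (B : set T) (s : seq T) : uniq s ->
  (forall x, x \in s -> B x) -> ((size s)%:R%:E <= counting B :> \bar R)%E.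
Proof.
move=> us sB; rewrite /counting; case: asboolP => [fB|_]; last exact: leey.
rewrite lee_fin ler_nat; apply: uniq_leq_size => // x /sB Bx.
by rewrite in_fset_set// inE.
Qed.

Lemma counting_fin (T : choiceType) (B : set T) : (counting B < +oo :> \bar R)%E ->
  exists s : seq T, [/\ uniq s, forall x, x \in s -> B x & counting B = (size s)%:R%:E :> \bar R].
Proof.
rewrite /counting; case: asboolP => [fB _|_]; last by rewrite ltxx.
exists (finmap.enum_fset (fset_set B)); split => //.
by move=> x; rewrite in_fset_set// inE.
Qed.

Lemma num_hyperbolic_le Z : (num_hyperbolic_crossing Z <= num_crossing Z)%E.
Proof.
have [h|] := ltP (num_crossing Z) +oo%E; last by rewrite leye_eq => /eqP->; exact: leey.
rewrite /num_hyperbolic_crossing [X in (X <= _)%E]/counting; case: asboolP => [fB|inf].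
  apply: counting_ge; first exact: finmap.fset_uniq.
  by move=> C; rewrite in_fset_set// inE => -[].
move: h; rewrite /num_crossing /counting; case: asboolP => [fA _|_]; last by rewrite ltxx.
by case: inf; apply: sub_finite_set fA => C [].
Qed.

Lemma majority (m : nat) (c : 'I_m * bool -> bool) :
  exists s : bool, (m <= #|[pred t | c t == s]|)%N.
Proof.
have := cardC [pred t | c t == true]; rewrite card_prod card_ord card_bool => E.
have E' : #|[predC [pred t | c t == true]]| = #|[pred t | c t == false]|.
  by apply: eq_card => t; rewrite !inE; case: (c t).
have [h|h] := leqP m #|[pred t | c t == true]|; first by exists true.
exists false; rewrite -E' -(leq_add2l #|[pred t | c t == true]|) E muln2 -addnn leq_add2r.
exact: ltnW.
Qed.

Lemma shift_poly_neq0 (mu : R) p z : eval2 p z != 0 -> shift_poly mu p != 0.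
Proof.
case: z => a b; apply: contra => /eqP p0; have := eval2_shift mu p (a, b + mu).
by rewrite p0 /= addrK => <-; rewrite /eval2 meval0.
Qed.

(** Provides the field when the maximal number of cycles is 0, and shows that the supremum is taken
    over a nonempty family. *)
Lemma degree_exists (n : nat) : exists Z : pw_field R, has_degree Z n.
Proof.
have s0 : (msize (0 : mpoly 2 R) <= n.+1)%N by rewrite msize0.
have s1 : (msize (1 : mpoly 2 R) <= n.+1)%N by rewrite msize1.
have [|||j Hj] := @perturbed_degree R (PwField 1 0 0 0) 0 n _ _ _.
- by rewrite /sizeP geq_max /= s1 s0.
- by rewrite /sizeQ geq_max /= s0.
- by apply: (@shift_poly_neq0 _ _ (0, 0)); rewrite /eval2 meval1 oner_eq0.
by exists (perturbed (PwField 1 0 0 0) 0 j).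
Qed.

(* Each cycle yields, for mu of one sign, a cycle of the perturbed field on
   its left and, for mu of one sign, a cycle on its right. Of these 2 m cycles
   at least m exist for the same sign of mu. *)
Lemma hyperbolic_perturbation Z (n m : nat) (cyc : nat -> set (R * R)) :
  (sizeP Z <= n.+1)%N -> (sizeQ Z <= n.+1)%N -> (0 < m)%N ->
  (forall i, (i < m)%N -> crossing_limit_cycle Z (cyc i)) ->
  (forall i k, (i < m)%N -> (k < m)%N -> cyc i = cyc k -> i = k) ->
  exists2 Z' : pw_field R, has_degree Z' n & (m%:R%:E <= num_hyperbolic_crossing Z')%E.
Proof.
move=> sP sQ m0 Hcyc inj.
have fE : finite_set (\bigcup_(i in `I_m) [set w | cyc i (0, w)]).
  apply: bigcup_finite; first exact: finite_II.
  move=> i /= im; have [_ _ fin _] := Hcyc i im.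
  apply: sub_finite_set (finite_image snd fin) => w Cw.
  by exists (0, w) => //; split.
have [d d0 gap] := finite_set_gap fE.
(* d separates all points where the given cycles meet the line. With errors below [d / 3], a hit
   cannot be near two of them. *)
have r0 : 0 < d / 3 by rewrite divr_gt0.
have same i k w : (i < m)%N -> (k < m)%N -> cyc i (0, w) -> cyc k (0, w) -> i = k.
  by move=> im km Ci Ck; apply: inj => //; apply: crossing_limit_cycle_eq Ci Ck; exact: Hcyc.
have close i k w w' : (i < m)%N -> (k < m)%N -> cyc i (0, w) -> cyc k (0, w') ->
    `|w - w'| < d -> w = w'.
  move=> im km Ci Ck ww; apply: contrapT => ne; move: ww; rewrite ltNge => /negP; apply.
  by apply: gap => //; [exists k|exists i].
have exd i : exists q : R * R * R * (R -> R -> R) * (R -> R -> R), (i < m)%N ->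
    displacement Z (cyc i) (d / 3) q.1.1.1.1 q.1.1.1.2 q.1.1.2 q.1.2 q.2.
  have [im|mi] := ltnP i m; last by exists (0, 0, 0, fun=> id, fun=> id).
  have [y0 [rho [K [D [A H]]]]] := cycle_displacement (Hcyc i im) r0.
  by exists (y0, rho, K, D, A).
have [q Hq] := choice exd.
pose y i := (q i).1.1.1.1; pose rho i := (q i).1.1.1.2; pose K i := (q i).1.1.2.
pose D i := (q i).1.2; pose A i := (q i).2.
have HD i : (i < m)%N -> displacement Z (cyc i) (d / 3) (y i) (rho i) (K i) (D i) (A i) := @Hq i.
have exs (t : nat * bool) : exists ce : bool * R, (t.1 < m)%N -> 0 < ce.2 /\
   forall mu, 0 < mu <= ce.2 -> exists2 u, `|u - y t.1| <= rho t.1 &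
    0 < sgn t.2 * (u - y t.1) /\ D t.1 (sgn ce.1 * mu) u = 0.
  have [im|mi] := ltnP t.1 m; last by exists (true, 0).
  have [c [eta eta0 H]] := displacement_side_zero (HD t.1 im) t.2.
  by exists (c, eta).
have [ce Hce] := choice exs.
have [s ms] := majority (fun t : 'I_m * bool => (ce (t.1 : nat, t.2)).1).
have [eta eta0 Heta] : exists2 eta : R, 0 < eta & forall i, (i < m)%N -> (i < m)%N ->
    eta <= rho i /\ forall b, eta <= (ce (i, b)).2.
  apply: (@finite_min R m (fun i e => (i < m)%N -> e <= rho i /\ forall b, e <= (ce (i, b)).2)).
    move=> i e e' _ ee H im; have [h1 h2] := H im.
    by split=> [|b]; [exact: le_trans h1|exact: le_trans (h2 b)].
  move=> i im; pose e b := (ce (i, b)).2.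
  exists (Num.min (rho i) (Num.min (e true) (e false))).
    rewrite !lt_min (displacement_rho (HD i im)) /e.
    by rewrite (Hce (i, true) im).1 (Hce (i, false) im).1.
  move=> _; split=> [|b]; first by rewrite ge_min lexx.
  by case: b; rewrite !ge_min lexx ?orbT.
have small i mu : (i < m)%N -> 0 < mu <= eta -> `|sgn s * mu| <= rho i.
  move=> im /andP[mu0 mue]; rewrite normrM norm_sgn mul1r gtr0_norm//.
  exact: le_trans mue (Heta i im im).1.
pose bad i mu u := [/\ `|u - y i| <= rho i, D i (sgn s * mu) u = 0 & A i (sgn s * mu) u = 0].
have crit i mu mu' u u' : (i < m)%N -> 0 < mu <= eta -> 0 < mu' <= eta ->
    bad i mu u -> bad i mu' u' -> `|mu - mu'| <= K i * (u - u') ^+ 2.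
  move=> im h h' [u1 Du Au] [u1' Du' _].
  have := displacement_critical (HD i im) (small _ _ im h) (small _ _ im h') u1 u1' Du Au Du'.
  by rewrite -mulrBr normrM norm_sgn mul1r.
(* A single parameter has to avoid the critical zeros of all m displacements at once. *)
have [|||mu mue nobad] := @critical_avoidance R m y rho K
  bad eta _ _ eta0 _ crit.
- by move=> i im; exact: displacement_rho (HD i im).
- by move=> i im; exact: displacement_K (HD i im).
- by move=> i mu u _ [].
have [j Hj] : exists j, has_degree (perturbed Z (sgn s * mu) j) n.
  (* The first component on x > 0 is not the zero polynomial, since it does not vanish at a crossing
     point. *)
  apply: perturbed_degree => //; apply: (@shift_poly_neq0 _ _ (0, y 0%N)).
  have [_ _ _ cr] := Hcyc 0%N m0; have := cr _ (displacement_base (HD 0%N m0)).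
  by rewrite /crossing_point; apply: contraTneq => ->; rewrite mul0r ltxx.
exists (perturbed Z (sgn s * mu) j) => //.
have exf (t : 'I_m * bool) : exists C' : set (R * R), (ce (t.1 : nat, t.2)).1 = s ->
  [/\ crossing_limit_cycle (perturbed Z (sgn s * mu) j) C',
    hyperbolic (perturbed Z (sgn s * mu) j) C' &
    exists u, [/\ `|u - y t.1| <= d / 3, 0 < sgn t.2 * (u - y t.1), C' (0, u) &
    forall w, C' (0, w) ->
      w = u \/ exists2 w', cyc t.1 (0, w') /\ w' <> y t.1 & `|w - w'| < d / 3]].
  case: t => -[i im] b /=; have [cs|cs] := eqVneq (ce (i, b)).1 s; last first.
    by exists set0 => cs'; rewrite cs' eqxx in cs.
  have [_ /(_ mu)] := Hce (i, b) im.
  have /andP[mu0 mu1] := mue; rewrite mu0 (le_trans mu1 ((Heta i im im).2 b)).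
  rewrite cs => /(_ isT)[u /= ur [ub Du]].
  have Au : A i (sgn s * mu) u <> 0 by move=> Au; exact: (nobad i u im).
  have [C' [h1 h2 h3 h4]] := displacement_cycle (HD i im) j (small i mu im mue) ur Du Au.
  exists C' => _; split => //; exists u; split => //.
  exact: le_trans ur (displacement_rho_le (HD i im)).
have [f Hf] := choice exf.
pose S := enum [pred t : 'I_m * bool | (ce (t.1 : nat, t.2)).1 == s].
have inS t : t \in S -> (ce (t.1 : nat, t.2)).1 = s by rewrite mem_enum inE => /eqP.
apply: (@le_trans _ _ ((size [seq f t | t <- S])%:R%:E)).
  by rewrite lee_fin ler_nat size_map -cardE.
apply: counting_ge; last first.
  by move=> C' /mapP[t /inS ts ->]; have [h1 h2 _] := Hf t ts.
rewrite map_inj_in_uniq ?enum_uniq// => -[i b] [i' b'] /inS ts /inS ts' E.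
have [_ _ [u [u1 u2 u3 u4]]] := Hf _ ts; have [_ _ [u' [u1' u2' u3' u4']]] := Hf _ ts'.
rewrite -E in u3'; rewrite /= in u1 u2 u4 u1' u2' u4'.
have base k : (k < m)%N -> cyc k (0, y k) by move=> km; exact: displacement_base (HD k km).
(* If two sides give the same cycle, the hit u' of the second is either u, so that base point and
   side agree, or near another point w' of the first cycle. Then w' would be the base point of the
   second, the two old cycles would coincide, and w' could not be another point. *)
have := u4 _ u3' => -[uu|[w' [Cw' wy] uw]].
  have yy : y i = y i'.
    apply: (close i i') => //; try exact: base.
    have -> : y i - y i' = (u - y i') - (u - y i) by ring.
    apply: le_lt_trans (ler_normB _ _) _; rewrite uu in u1'.
    by move: u1 u1' d0; clear; lra.
  have ii : i = i'.
    have b2 := base i' (ltn_ord i'); rewrite -yy in b2.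
    by apply: val_inj; exact: same (base i (ltn_ord i)) b2.
  rewrite -ii in u2' *; rewrite uu in u2'; congr (_, _).
  exact: sgn_inj u2 u2'.
have yw : y i' = w'.
  apply: (close i' i) => //; first exact: base.
  have -> : y i' - w' = (u' - w') - (u' - y i') by ring.
  apply: le_lt_trans (ler_normB _ _) _.
  by move: uw u1' d0; clear; lra.
case: wy; rewrite -yw; congr (y _).
by rewrite -yw in Cw'; exact: same (base i' (ltn_ord i')) Cw'.
Qed.

End Counting.

Theorem proposition2 (R : realType) (n : nat) (hfin : (Hc R n < +oo)%E) :
  exists Z : pw_field R, has_degree Z n /\ num_hyperbolic_crossing Z = Hc R n.
Proof.
pose small (Z : pw_field R) := (sizeP Z <= n.+1)%N /\ (sizeQ Z <= n.+1)%N.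
have le_Hc Z : small Z -> (num_crossing Z <= Hc R n)%E.
  by move=> sZ; apply: ereal_sup_ubound; exists Z.
have small_deg Z : has_degree Z n -> small Z.
  by rewrite /has_degree /small => <-; rewrite leq_maxl leq_maxr.
pose P k := `[< exists2 Z, small Z & num_crossing Z = k%:R%:E :> \bar R >].
have num_fin Z : small Z -> exists s : seq (set (R * R)), [/\ uniq s,
    forall C, C \in s -> crossing_limit_cycle Z C & num_crossing Z = (size s)%:R%:E].
  by move=> /le_Hc h; apply: counting_fin; exact: le_lt_trans hfin.
have [Z0 deg0] := @degree_exists R n.
have exP : exists k, P k.
  have [s [_ _ Es]] := num_fin Z0 (small_deg _ deg0).
  by exists (size s); apply/asboolP; exists Z0 => //; exact: small_deg.
have [B HB] : exists B : nat, (Hc R n <= B%:R%:E)%E.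
  case: (Hc R n) hfin => [x _| |_]; last by exists 0%N; exact: leNye.
    exists (Num.bound x); rewrite lee_fin; have [x0|/ltW x0] := leP 0 x.
      by rewrite ltW// archi_boundP.
    exact: le_trans x0 _.
  by rewrite ltxx.
have Pub k : P k -> (k <= B)%N.
  move=> /asboolP[Z sZ E]; rewrite -(ler_nat R) -lee_fin -E.
  exact: le_trans (le_Hc _ sZ) HB.
(* Finiteness makes the cycle counts a nonempty bounded set of naturals, so the supremum is attained
   by some [Z], whose degree may be less than n. *)
have [m /asboolP[Z sZ Zm] mmax] := ex_maxnP exP Pub.
have HcE : Hc R n = m%:R%:E.
  apply/eqP; rewrite eq_le -{2}Zm le_Hc// andbT.
  apply: ge_ereal_sup => _ [Z' sZ' <-].
  have [s [_ _ Es]] := num_fin Z' sZ'; rewrite Es lee_fin ler_nat.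
  by apply: mmax; apply/asboolP; exists Z'.
suff [Z' deg' ge] : exists2 Z' : pw_field R, has_degree Z' n &
    (m%:R%:E <= num_hyperbolic_crossing Z')%E.
  exists Z'; split => //; apply/eqP; rewrite eq_le {2}HcE ge andbT.
  exact: le_trans (num_hyperbolic_le _) (le_Hc _ (small_deg _ deg')).
(* With no cycle to perturb, any field of degree n will do. *)
have [m0|m0] := posnP m.
  exists Z0 => //; rewrite m0; apply: le_trans (counting_ge (s := [::]) _ _) => //.
have [s [us sC Es]] := num_fin Z sZ.
have sm : size s = m.
  by move: Es; rewrite Zm => -[/eqP]; rewrite eqr_nat => /eqP.
apply: (hyperbolic_perturbation (Z := Z) (cyc := nth set0 s)) m0 _ _; rewrite -?sm.
- exact: sZ.1.
- exact: sZ.2.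
- by move=> i im; apply: sC; rewrite mem_nth.
- by move=> i k im km /eqP; rewrite nth_uniq// => /eqP.
Qed.
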